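(* Let $\mathcal{X}$ be a Fréchet space (over $\mathbb{C}$) and let $\{\mathbf{a}_k\}_{k=0}^\infty$ be an arbitrary sequence of elements of $\mathcal{X}$. Let $\{f_k\}_{k=0}^\infty$ be a sequence of distributions in $\mathcal{S}'_+$ that satisfies conditions (P1) and (P2). Then the moment problem $$\langle f_j,\boldsymbol{\phi}\rangle=\mathbf{a}_j,\quad j\in\mathbb{N},$$ has solutions $\boldsymbol{\phi}\in\mathcal{S}((0,\infty),\mathcal{X})$.
   Context: $\mathbb{N}=\{0,1,2,\dots\}$. $\mathcal{S}(0,\infty)=\{\phi\in\mathcal{S}(\mathbb{R}):\operatorname{supp}\phi\subseteq[0,\infty)\}$, where $\mathcal{S}(\mathbb{R})$ is the Schwartz space. $\mathcal{S}'_+$ is the space of tempered distributions on $\mathbb{R}$ with support in $[0,\infty)$. $\mathcal{N}_0\subset\mathcal{S}'_+$ is the annihilator of $\mathcal{S}(0,\infty)$, i.e. the set of all finite linear combinations of the Dirac delta $\delta$ at the origin and its derivatives (including $0$). $\mathcal{S}(\mathbb{R},\mathcal{X})\cong\mathcal{S}(\mathbb{R})\widehat\otimes\mathcal{X}$ is the space of smooth functions $\boldsymbol{\psi}:\mathbb{R}\to\mathcal{X}$ such that $\{x^k\boldsymbol{\psi}^{(m)}(x):x\in\mathbb{R}\}$ is bounded in $\mathcal{X}$ for all $k,m\in\mathbb{N}$, and $\mathcal{S}((0,\infty),\mathcal{X})\cong\mathcal{S}(0,\infty)\widehat\otimes\mathcal{X}$ is the subspace of those with support in $[0,\infty)$.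 For $f\in\mathcal{S}'_+$ and $\boldsymbol{\phi}\in\mathcal{S}((0,\infty),\mathcal{X})$, $\langle f,\boldsymbol{\phi}\rangle\in\mathcal{X}$ is the evaluation obtained by extending $f\otimes\mathrm{id}_{\mathcal{X}}$ continuously; equivalently, it is the element of $\mathcal{X}$ with $x'(\langle f,\boldsymbol{\phi}\rangle)=\langle f,x'\circ\boldsymbol{\phi}\rangle$ for all $x'\in\mathcal{X}'$. For $f\in\mathcal{S}'_+$ and $m\in\mathbb{N}$, $f^{(-m)}$ denotes the $m$-primitive of $f$ lying in $\mathcal{S}'_+$ (the unique element of $\mathcal{S}'_+$ whose $m$-th derivative is $f$). Cesàro order symbols: for $f\in\mathcal{S}'_+$, $m\in\mathbb{N}$ and $\alpha>0$, $\alpha\notin\mathbb{Z}$: - $f(x)=O(x^\alpha)$ $(\mathrm{C},m)$, $x\to\infty$, means that $f^{(-m)}$ is a regular distribution (locally Lebesgue integrable function) for large arguments and there is a polynomial $P$ of degree at most $m-1$ such that $f^{(-m)}(x)=P(x)+O(x^{\alpha+m})$ as $x\to\infty$; - $f(x)=O(x^{-\alpha})$ $(\mathrm{C},m)$, $x\to0^+$, means that $f^{(-m)}$ is a locally Lebesgue integrable function on some interval $(0,\delta)$ and there is a polynomial $P$ of degree at most $m-1$ such that $f^{(-m)}(x)=P(x)+O(x^{-\alpha+m})$ as $x\to0^+$. (P1): no element of $\mathcal{N}_0$ is a nontrivial linear combination of the $f_n$; that is, if $\sum_{n=0}^N b_nf_n\in\mathcal{N}_0$ with $b_n\in\mathbb{C}$,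 then $b_0=\dots=b_N=0$. (P2) (Cesàro admissibility): there is an increasing sequence $\{m_j\}_{j=0}^\infty$ of (non-negative) integers such that for every $j\in\mathbb{N}$ and every $\alpha>0$, $\alpha\notin\mathbb{Z}$, there exists $\nu=\nu_{j,\alpha}\in\mathbb{N}$ such that whenever $N\ge\nu$ and $b_0,\dots,b_N\in\mathbb{C}$ satisfy the three conditions: $\sum_{n=0}^N b_nf_n(x)=O(x^\alpha)$ $(\mathrm{C},m_j)$, $x\to\infty$; the restriction of $\sum_{n=0}^N b_nf_n^{(-m_j)}$ to $(0,\infty)$ is a continuous function; and $\sum_{n=0}^N b_nf_n(x)=O(x^{-\alpha})$ $(\mathrm{C},m_j)$, $x\to0^+$; then $b_\nu=b_{\nu+1}=\dots=b_N=0$. *)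

(* Defs.v *)
From HB Require Import structures.
From mathcomp Require Import all_boot all_order all_algebra.
From mathcomp Require Import complex.
From mathcomp Require Import all_classical all_reals all_analysis.

Set Implicit Arguments.
Unset Strict Implicit.
Unset Printing Implicit Defensive.

Import Order.TTheory GRing.Theory Num.Theory.
Import numFieldNormedType.Exports.
Import Normc.

Local Open Scope classical_set_scope.
Local Open Scope ring_scope.
Local Open Scope complex_scope.

Section tvs_notions.
Context {R : realType} (X : tvsType R[i]).

(* The uniformity carried by a [tvsType] is only required to induce its
   topology, so Cauchy filters are taken with respect to translations of the
   neighbourhoods of 0 instead of the library's [cauchy]. *)
Definition tvs_cauchy (F : set_system X) : Prop :=
  (fun p : X * X => p.1 - p.2) @ (F, F) --> (0 : X).

(* Local convexity is part of [tvsType]; a Hausdorff topological vector space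
   is metrizable when 0 has a countable base of neighbourhoods. *)
Definition frechet_space : Prop :=
  [/\ hausdorff_space X,
      exists B : nat -> set X,
        (forall n, nbhs (0 : X) (B n)) /\
        (forall U, nbhs (0 : X) U -> exists n, B n `<=` U) &
      forall F : set_system X, ProperFilter F -> tvs_cauchy F ->
        exists l : X, F --> l].

Definition tvs_bounded (A : set X) : Prop :=
  forall U, nbhs (0 : X) U ->
    \forall t \near +oo, A `<=` [set t%:C *: u | u in U].

End tvs_notions.

Section vector_valued.
Context {R : realType} {X : tvsType R[i]}.
Implicit Types (f : R -> X).

Definition vquot f (x h : R) : X := (h^-1)%:C *: (f (x + h) - f x).

Definition vderivable f (x : R) : Prop :=
  exists l : X, vquot f x @ 0^' --> l.

(* unique when X is Hausdorff; 0 where f is not differentiable *)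
Definition vderive f (x : R) : X := xget 0 [set l | vquot f x @ 0^' --> l].

Definition vderiven (n : nat) f : R -> X := iter n vderive f.

Definition vsmooth f : Prop := forall n x, vderivable (vderiven n f) x.

Definition schwartz_fun f : Prop :=
  vsmooth f /\
  forall k m : nat,
    tvs_bounded [set ((x ^+ k)%:C *: vderiven m f x : X) | x in [set: R]].

Definition fsupp f : set R := closure [set x | f x != 0].

End vector_valued.

(* Closure properties that make S(R) an [lmodType] and give a meaning to the
   composition of a vector-valued Schwartz function with a functional. *)
Section schwartz_theory.
Context {R : realType}.
Implicit Types (X Y : tvsType R[i]).

Lemma vderive_cvg X (f : R -> X) x :
  vderivable f x -> vquot f x @ 0^' --> vderive f x.
Proof. by case=> l fl; rewrite /vderive; case: xgetP => [y _ //|/(_ l)]. Qed.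

Lemma vderive_eq X (f : R -> X) x (l : X) : hausdorff_space X ->
  vquot f x @ 0^' --> l -> vderive f x = l.
Proof.
move=> hX fl; apply: (@cvg_unique X hX (vquot f x @ 0^')) => //.
by apply: vderive_cvg; exists l.
Qed.

Lemma vquot_linear X Y (T : {linear X -> Y}) (f : R -> X) x l :
  continuous T -> vquot f x @ 0^' --> l -> vquot (T \o f) x @ 0^' --> T l.
Proof.
move=> cT fl.
have -> : vquot (T \o f) x = T \o vquot f x.
  by apply/funext => h; rewrite /vquot /comp [RHS]linearZ/= [in RHS]linearB.
exact: (cvg_comp _ _ fl (cT l)).
Qed.

Lemma vderiven_linear X Y (T : {linear X -> Y}) (f : R -> X) n :
  hausdorff_space Y -> continuous T -> vsmooth f ->
  vderiven n (T \o f) = T \o vderiven n f.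
Proof.
move=> hY cT fs; elim: n => [//|n IHn]; apply/funext => x /=.
rewrite /vderiven /= -/(vderiven n _) IHn; apply: vderive_eq => //.
by apply: vquot_linear => //; apply: vderive_cvg; exact: fs.
Qed.

Lemma tvs_bounded_linear X Y (T : {linear X -> Y}) (A : set X) :
  continuous T -> tvs_bounded A -> tvs_bounded [set T x | x in A].
Proof.
move=> cT bA U U0.
have {}U0 : nbhs (0 : X) (T @^-1` U) by apply: cT; rewrite linear0.
apply: filterS (bA _ U0) => t At _ [x Ax <-].
by have [u Uu <-] := At x Ax; exists (T u) => //; rewrite linearZ.
Qed.

Lemma schwartz_fun_linear X Y (T : {linear X -> Y}) (f : R -> X) :
  hausdorff_space Y -> continuous T -> schwartz_fun f -> schwartz_fun (T \o f).
Proof.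
move=> hY cT [fs fb]; split=> [n x|k m].
  rewrite vderiven_linear//; exists (T (vderive (vderiven n f) x)).
  by apply: vquot_linear => //; apply: vderive_cvg; exact: fs.
rewrite vderiven_linear//; move: (tvs_bounded_linear cT (fb k m)).
rewrite image_comp; congr (tvs_bounded _); apply: eq_imagel => x _ /=.
by rewrite linearZ.
Qed.

Lemma tvs_boundedD X (I : Type) (f g : I -> X) :
  tvs_bounded (range f) -> tvs_bounded (range g) ->
  tvs_bounded (range (fun i => f i + g i)).
Proof.
move=> bf bg U U0.
have : nbhs ((0 : X), (0 : X)) [set p | U (p.1 + p.2)].
  by apply: (@add_continuous X (0, 0)); rewrite /= addr0.
case=> -[V W] /= [V0 W0] VWU.
near=> t => _ [i _ <-].
have ft : range f `<=` [set t%:C *: u | u in V] by near: t; exact: bf.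
have gt : range g `<=` [set t%:C *: u | u in W] by near: t; exact: bg.
have [v Vv <-] := ft _ (imageT f i); have [w Ww <-] := gt _ (imageT g i).
by exists (v + w); rewrite ?scalerDr//; apply: (VWU (v, w)).
Unshelve. all: by end_near. Qed.

Lemma vquotD X (f g : R -> X) x (l m : X) :
  vquot f x @ 0^' --> l -> vquot g x @ 0^' --> m ->
  vquot (f + g) x @ 0^' --> l + m.
Proof.
move=> fl gm.
have -> : vquot (f + g) x = vquot f x + vquot g x.
  by apply/funext => h; rewrite /vquot !fctE opprD addrACA scalerDr.
apply: (@cvg_comp _ _ _ (fun h => (vquot f x h, vquot g x h))
  (fun z : X * X => z.1 + z.2) _ (nbhs (l, m))); first exact: cvg_pair.
exact: (@add_continuous X (l, m)).
Qed.

Lemma vderivenD X (f g : R -> X) n : hausdorff_space X ->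
  vsmooth f -> vsmooth g -> vderiven n (f + g) = vderiven n f + vderiven n g.
Proof.
move=> hX fs gs; elim: n => [//|n IHn]; apply/funext => x.
rewrite /vderiven /= -!/(vderiven n _) IHn; apply: vderive_eq => //.
by apply: vquotD; apply: vderive_cvg; [exact: fs|exact: gs].
Qed.

Lemma schwartz_funD X (f g : R -> X) : hausdorff_space X ->
  schwartz_fun f -> schwartz_fun g -> schwartz_fun (f + g).
Proof.
move=> hX [fs fb] [gs gb]; split=> [n x|k m].
  rewrite vderivenD//; eexists.
  by apply: vquotD; apply: vderive_cvg; [exact: fs|exact: gs].
rewrite vderivenD//; have := tvs_boundedD (fb k m) (gb k m).
by congr (tvs_bounded _); apply: eq_imagel => x _; rewrite !fctE scalerDr.
Qed.

Lemma schwartz_funZ X (c : R[i]) (f : R -> X) : hausdorff_space X ->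
  schwartz_fun f -> schwartz_fun (c *: f).
Proof.
move=> hX; apply: (@schwartz_fun_linear _ _ ( *:%R c : {linear X -> X})) => //.
move=> x; apply: (@cvg_comp _ _ _ (fun y : X => (c : R[i]^o, y))
  (fun z : R[i]^o * X => z.1 *: z.2) _ (nbhs ((c : R[i]^o), x))).
  by apply: (@cvg_pair _ _ _ _ (nbhs (c : R[i]^o)));
    [exact: cvg_cst|exact: cvg_id].
exact: (@scale_continuous _ X (c, x)).
Qed.

Lemma schwartz_fun0 X : hausdorff_space X -> schwartz_fun (0 : R -> X).
Proof.
move=> hX; have d0 n : vderiven n (0 : R -> X) = 0.
  elim: n => [//|n IHn]; apply/funext => x.
  rewrite /vderiven /= -/(vderiven n _) IHn; apply: vderive_eq => //.
  have -> : vquot (0 : R -> X) x = cst 0.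
    by apply/funext => h; rewrite /vquot !fctE subrr scaler0.
  exact: cvg_cst.
split=> [n x|k m]; rewrite d0.
  exists 0; have -> : vquot (0 : R -> X) x = cst 0.
    by apply/funext => h; rewrite /vquot !fctE subrr scaler0.
  exact: cvg_cst.
move=> U U0; near=> t => _ [x _ <-].
by exists 0; rewrite ?scaler0//; exact: nbhs_singleton.
Unshelve. all: by end_near. Qed.

Lemma schwartz_fun_derive X (f : R -> X) :
  schwartz_fun f -> schwartz_fun (vderive f).
Proof.
have dS n : vderiven n (vderive f) = vderiven n.+1 f.
  by rewrite /vderiven iterSr.
by move=> [fs fb]; split=> [n x|k m]; rewrite dS; [exact: fs|exact: fb].
Qed.

End schwartz_theory.

Lemma regular_hausdorff (K : numFieldType) : hausdorff_space K^o.
Proof. exact: norm_hausdorff. Qed.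

Section schwartz_space.
Context (R : realType).

Definition schwartz_pred : {pred (R -> R[i]^o)} :=
  fun f => `[< schwartz_fun f >].

Lemma schwartz_submod_closed : submod_closed schwartz_pred.
Proof.
have hC := @regular_hausdorff R[i].
split=> [|c f g /asboolP fs /asboolP gs]; apply/asboolP.
  exact: schwartz_fun0.
exact: (schwartz_funD hC (schwartz_funZ c hC fs) gs).
Qed.

HB.instance Definition _ :=
  GRing.isSubmodClosed.Build R[i] (R -> R[i]^o) schwartz_pred
    schwartz_submod_closed.

Record schwartz := Schwartz {
  schwartz_val :> R -> R[i]^o;
  schwartz_valP : schwartz_val \in schwartz_pred }.

HB.instance Definition _ := [isSub for schwartz_val].
HB.instance Definition _ := [Choice of schwartz by <:].
HB.instance Definition _ := [SubChoice_isSubLmodule of schwartz by <:].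

End schwartz_space.

Section distributions.
Context {R : realType}.
Implicit Types (phi : schwartz R) (u : schwartz R -> R[i]^o) (U : set R).

Lemma schwartz_derive_subproof phi : vderive phi \in @schwartz_pred R.
Proof.
by apply/asboolP; exact: (schwartz_fun_derive (asboolW (schwartz_valP phi))).
Qed.

Definition schwartz_derive phi : schwartz R :=
  Schwartz (schwartz_derive_subproof phi).

Definition schwartz_seminorm (k m : nat) phi : R :=
  sup [set normc ((x ^+ k)%:C * vderiven m phi x) | x in [set: R]].

(* continuity for the Schwartz seminorms *)
Definition tempered u : Prop :=
  (forall (c : R[i]) phi psi, u (c *: phi + psi) = c *: u phi + u psi) /\
  exists (n : nat) (M : R), forall phi,
    normc (u phi) <= M * \sum_(k < n) \sum_(m < n) schwartz_seminorm k m phi.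

Definition test_on U phi : Prop :=
  compact (fsupp phi) /\ fsupp phi `<=` U.

Definition dvanish u U : Prop := forall phi, test_on U phi -> u phi = 0.

Definition dsupp u : set R :=
  ~` \bigcup_(U in [set U | open U /\ dvanish u U]) U.

(* S'_+ *)
Definition tempered_pos u : Prop :=
  tempered u /\ dsupp u `<=` `[0, +oo[%classic.

(* N_0, as the annihilator of S(0,oo) in S'_+ *)
Definition annihilator_pos u : Prop :=
  tempered_pos u /\
  forall phi, fsupp phi `<=` `[0, +oo[%classic -> u phi = 0.

Definition dderive u : schwartz R -> R[i]^o :=
  fun phi => - u (schwartz_derive phi).

(* u^(-m), i.e. the unique m-primitive of u in S'_+ *)
Definition dprimitive (m : nat) u : schwartz R -> R[i]^o :=
  xget 0 [set v | tempered_pos v /\ iter m dderive v = u].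

Definition cintegral U (h : R -> R[i]) : R[i] :=
  (\int[lebesgue_measure]_(x in U) complex.Re (h x)) +i*
  (\int[lebesgue_measure]_(x in U) complex.Im (h x)).

Definition clocally_integrable U (g : R -> R[i]) : Prop :=
  locally_integrable U (fun x => complex.Re (g x)) /\
  locally_integrable U (fun x => complex.Im (g x)).

(* the restriction of u to the open set U is the regular distribution g *)
Definition regular_on U u (g : R -> R[i]) : Prop :=
  clocally_integrable U g /\
  forall phi, test_on U phi -> u phi = cintegral U (fun x => g x * phi x).

(* u(x) = O(x^alpha) (C,m) as x -> oo; [size P <= m] is deg P <= m - 1 *)
Definition cesaro_bigO_pinfty (m : nat) (alpha : R) u : Prop :=
  exists (A : R) (g : R -> R[i]) (P : {poly R[i]}),
    [/\ regular_on `]A, +oo[%classic (dprimitive m u) g,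
        (size P <= m)%N &
        exists M : R, \forall x \near +oo,
          normc (g x - P.[x%:C]) <= M * x `^ (alpha + m%:R)].

(* u(x) = O(x^(-alpha)) (C,m) as x -> 0^+ *)
Definition cesaro_bigO_0 (m : nat) (alpha : R) u : Prop :=
  exists (delta : R) (g : R -> R[i]) (P : {poly R[i]}),
    [/\ 0 < delta,
        regular_on `]0, delta[%classic (dprimitive m u) g,
        (size P <= m)%N &
        exists M : R, \forall x \near 0^'+,
          normc (g x - P.[x%:C]) <= M * x `^ (- alpha + m%:R)].

Definition continuous_on_pos u : Prop :=
  exists2 g : R -> R[i]^o,
    (forall x, 0 < x -> {for x, continuous g}) &
    regular_on `]0, +oo[%classic u g.

Definition condP1 (f : nat -> schwartz R -> R[i]^o) : Prop :=
  forall (N : nat) (b : nat -> R[i]),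
    annihilator_pos (\sum_(n < N.+1) b n *: f n) ->
    forall n, (n <= N)%N -> b n = 0.

Definition condP2 (f : nat -> schwartz R -> R[i]^o) : Prop :=
  exists m : nat -> nat, (forall j, (m j < m j.+1)%N) /\
    forall (j : nat) (alpha : R), 0 < alpha -> alpha \isn't a Num.int ->
      exists nu : nat, forall (N : nat) (b : nat -> R[i]), (nu <= N)%N ->
        cesaro_bigO_pinfty (m j) alpha (\sum_(n < N.+1) b n *: f n) ->
        continuous_on_pos (\sum_(n < N.+1) b n *: dprimitive (m j) (f n)) ->
        cesaro_bigO_0 (m j) alpha (\sum_(n < N.+1) b n *: f n) ->
        forall n, (nu <= n <= N)%N -> b n = 0.

End distributions.

Section evaluation.
Context {R : realType} {X : tvsType R[i]}.

(* S((0,oo), X) *)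
Record schwartz_pos := SchwartzPos {
  schwartz_pos_val :> R -> X;
  schwartz_pos_fun : schwartz_fun schwartz_pos_val;
  schwartz_pos_supp : fsupp schwartz_pos_val `<=` `[0, +oo[%classic }.

Lemma schwartz_linear_subproof (T : {linear X -> R[i]^o}) (cT : continuous T)
  (phi : schwartz_pos) : T \o phi \in @schwartz_pred R.
Proof.
apply/asboolP; exact: (schwartz_fun_linear (@regular_hausdorff R[i]) cT
  (schwartz_pos_fun phi)).
Qed.

Definition schwartz_linear (T : {linear X -> R[i]^o}) (cT : continuous T)
  (phi : schwartz_pos) : schwartz R :=
  Schwartz (schwartz_linear_subproof cT phi).

(* a is the evaluation of u at phi: when X is locally convex and Hausdorff,
   continuous functionals separate points and there is at most one such a. *)
Definition is_eval (u : schwartz R -> R[i]^o) (phi : schwartz_pos) (a : X) :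
    Prop :=
  forall (T : {linear X -> R[i]^o}) (cT : continuous T),
    T a = u (schwartz_linear cT phi).

End evaluation.
Arguments schwartz_pos {R} X.

(* Main.v *)
(** Eidelheit's method, with values in [X]. Let E be S(0,oo) with the norms p_n
    of [tempered]. Suppose that, for each n, a combination of the f_j which is
    p_n-bounded on E only involves indices j < nu_n. Extending functionals across
    finite codimension gives, whenever nu_n <= k, some phi_k in E with
    f_i(phi_k) = 0 for i < k, f_k(phi_k) = 1 and p_n(phi_k) as small as we like.
    Put c_k = a_k - sum_(j < k) f_k(phi_j) c_j and choose phi_k after c_k, so
    small that the series of the phi_k c_k converges in S((0,oo), X) together
    with all its derivatives; its sum solves the moment problem. The scalars
    carry all the estimates, so neither nuclearity nor seminorms on X are used.

    It remains to find nu_n. As p_0 = 0, (P1) gives nu_0 = 0. For n > 0 let g be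
    a p_n-bounded combination and v an m-primitive of g with m > n. Replacing a
    test function phi by the primitive of phi - (int phi) rho, m times over,
    bounds |v(phi)| by the supremum of the primitive of phi times a power of the
    size of its support; the same holds for v'. Hence the values of v on
    mollifiers at x converge to h(x), where h is locally Lipschitz and of
    polynomial growth of a degree depending on m and n only, and v = h on
    (0,oo). So all three conditions of (P2) hold with P = 0 and alpha large.

    Since [dprimitive] is defined by choice, primitives in S'_+ must be shown to
    exist: v(phi) = - u(psi), where psi' = phi - (int phi) rho, is a tempered
    primitive of u which on (-oo,0) is locally a multiple of the integral, hence
    a fixed multiple, to be subtracted. *)

(* The conditions f_i(phi_k) = 0 for i < k make the system triangular: f_j sees only the first j + 1
   terms of the series, and c_j is what corrects the earlier ones.

   The obstacle in finding nu_n is uniformity. It may depend on n alone, whereas the constant in the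
   p_n-bound changes with the combination; so constants are free in all estimates, but the exponents
   must come from m and n only.

   Test functions are measured by an antiderivative because a mollifier at scale e has values of
   size 1/e while its antiderivative stays in [0,1]. The bound on v thus survives as e tends to 0.
   The bound on v' gives convergence: the difference of two mollifiers is the derivative of a
   function bounded by 1 with short support, whose antiderivative is small. Bounding v' in the same
   way uses up one primitive, whence m > n rather than m >= n.

   All estimates concern supports in [0,b], the end 0 included. So h is bounded near 0, and this is
   all that the condition at 0 asks for once alpha exceeds m. *)
Require Import Defs.
From mathcomp Require Import all_boot all_order all_algebra.
From mathcomp Require Import complex.
From mathcomp Require Import all_classical all_reals all_analysis.
From mathcomp Require Import ring lra.

Set Implicit Arguments.
Unset Strict Implicit.
Unset Printing Implicit Defensive.

Import Order.TTheory GRing.Theory Num.Theory.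
Import numFieldNormedType.Exports.
Import Normc.

Local Open Scope classical_set_scope.
Local Open Scope ring_scope.
Local Open Scope complex_scope.

(** * Complex derivatives *)

Section complex_norm.
Context {R : realType}.
Implicit Types (z w : R[i]) (x e : R).

Lemma normcCE z : `|z| = (normc z)%:C.
Proof. by case: z. Qed.

Lemma normc_ge0 z : 0 <= normc z.
Proof. by case: z => a b; exact: sqrtr_ge0. Qed.

Lemma normc_le_add z w : normc (z + w) <= normc z + normc w.
Proof. exact: le_normcD. Qed.

Lemma normc_opp z : normc (- z) = normc z.
Proof. exact: normcN. Qed.

Lemma normc_real x : normc x%:C = `|x|.
Proof. by rewrite /normc /= expr0n/= addr0 sqrtr_sqr. Qed.

Lemma normc_le_sub z w : normc (z - w) <= normc z + normc w.
Proof. by rewrite -(normc_opp w) normc_le_add. Qed.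

Lemma normc_distC z w : normc (z - w) = normc (w - z).
Proof. by rewrite -normc_opp opprB. Qed.

Lemma normc_dist_trans w z (t : R[i]) :
  normc (z - t) <= normc (z - w) + normc (w - t).
Proof. by apply: le_trans (normc_le_add _ _); rewrite addrA subrK. Qed.

Lemma normc_eq0 z : (normc z == 0) = (z == 0).
Proof.
by apply/eqP/eqP => [/eq0_normc//|->]; rewrite normc0.
Qed.

Lemma Re_le_normc z : `|complex.Re z| <= normc z.
Proof.
case: z => a b /=; rewrite -sqrtr_sqr; apply: ler_wsqrtr.
by rewrite lerDl sqr_ge0.
Qed.

Lemma Im_le_normc z : `|complex.Im z| <= normc z.
Proof.
case: z => a b /=; rewrite -sqrtr_sqr; apply: ler_wsqrtr.
by rewrite lerDr sqr_ge0.
Qed.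

Lemma normc_le_ReIm z : normc z <= `|complex.Re z| + `|complex.Im z|.
Proof.
case: z => a b /=; rewrite -[leRHS]ger0_norm ?addr_ge0// -sqrtr_sqr.
apply: ler_wsqrtr; rewrite sqrrD !real_normK ?num_real//.
by rewrite -addrA lerD2l lerDr mulrn_wge0// mulr_ge0.
Qed.

Lemma ReB z w : complex.Re (z - w) = complex.Re z - complex.Re w.
Proof. by case: z w => a b [c d]. Qed.

Lemma ImB z w : complex.Im (z - w) = complex.Im z - complex.Im w.
Proof. by case: z w => a b [c d]. Qed.

Lemma ReZ x z : complex.Re (x%:C * z) = x * complex.Re z.
Proof. by case: z => a b /=; rewrite mul0r subr0. Qed.

Lemma ImZ x z : complex.Im (x%:C * z) = x * complex.Im z.
Proof. by case: z => a b /=; rewrite mul0r addr0. Qed.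

Lemma ReIm_inj z w :
  complex.Re z = complex.Re w -> complex.Im z = complex.Im w -> z = w.
Proof. by case: z w => a b [c d] /= -> ->. Qed.

Lemma nbhs_normcP (z : R[i]^o) (U : set R[i]^o) :
  nbhs z U <-> exists2 e, 0 < e & forall w, normc (w - z) < e -> U w.
Proof.
split=> [|[e e0 eU]].
  move=> /nbhs_ballP[[e e'] /= e0 eU].
  (* The order of [R[i]] compares only numbers with the same imaginary part, so a positive radius is
     real. *)
  move: e0; rewrite ltcE/= => /andP[/eqP e'0 e0].
  exists e => // w wz; apply: eU; rewrite -ball_normE /ball_/=.
  by rewrite distrC normcCE ltcE/= e'0 eqxx.
apply/nbhs_ballP; exists e%:C => /=; first by rewrite ltcE/= eqxx.
move=> w; rewrite -ball_normE /ball_/= distrC normcCE ltcE/= eqxx/=.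
exact: eU.
Qed.

Lemma cvg_normcP (T : Type) (F : set_system T) (FF : Filter F)
    (f : T -> R[i]^o) (z : R[i]^o) :
  f @ F --> z <-> forall e, 0 < e -> \forall t \near F, normc (f t - z) < e.
Proof.
split=> [fz e e0|fz U /nbhs_normcP[e e0 eU]].
  by apply: (fz [set w | normc (w - z) < e]); apply/nbhs_normcP; exists e.
by apply: filterS (fz e e0) => t; exact: eU.
Qed.

Lemma cvg_ReImP (T : Type) (F : set_system T) (FF : Filter F)
    (f : T -> R[i]^o) (z : R[i]^o) :
  f @ F --> z <-> ((fun t => complex.Re (f t)) @ F --> complex.Re z /\
                   (fun t => complex.Im (f t)) @ F --> complex.Im z).
Proof.
rewrite cvg_normcP; split=> [fz|[fr fi] e e0].
  split; apply/cvgrPdist_lt => e e0; apply: filterS (fz e e0) => t;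
    apply: le_lt_trans; rewrite distrC.
    by rewrite -ReB; exact: Re_le_normc.
  by rewrite -ImB; exact: Im_le_normc.
have e20 : 0 < e / 2 by rewrite divr_gt0.
move/cvgrPdist_lt : fr => /(_ _ e20) fr; move/cvgrPdist_lt : fi => /(_ _ e20).
apply: filterS2 fr => t; rewrite distrC -ReB => a; rewrite distrC -ImB => b.
by rewrite (le_lt_trans (normc_le_ReIm _))// (splitr e) ltrD.
Qed.

Lemma hausC : hausdorff_space R[i]^o.
Proof. exact: regular_hausdorff. Qed.

End complex_norm.

Section complex_derivative.
Context {R : realType}.
Implicit Types (f g : R -> R[i]^o) (x : R) (l : R[i]^o).

(* A variant, so that implicit arguments do not see through the limit. *)
Variant has_cderiv f x l : Prop := HasCderiv of vquot f x @ 0^' --> l.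

Lemma has_cderivE f x l : has_cderiv f x l <-> vquot f x @ 0^' --> l.
Proof. by split=> [[]|]. Qed.

Lemma is_deriveP (u : R -> R) (x r : R) : is_derive x 1 u r <->
  (fun h => h^-1 * (u (x + h) - u x)) @ 0^' --> r.
Proof.
have -> : (fun h => h^-1 * (u (x + h) - u x)) =
    (fun h => h^-1 *: ((u \o shift x) (h *: (1 : R)) - u x)).
  by apply/funext => h; rewrite /= [h *: _]mulr1 [h + x]addrC.
split=> [[du <-]|ur]; first exact: du.
have du : derivable u x 1 by apply/cvg_ex; exists r.
by split => //; exact: (cvg_lim (@Rhausdorff R) ur).
Qed.

Lemma has_cderivP f x l : has_cderiv f x l <->
  (is_derive x 1 (fun t => complex.Re (f t)) (complex.Re l) /\
   is_derive x 1 (fun t => complex.Im (f t)) (complex.Im l)).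
Proof.
rewrite !is_deriveP has_cderivE cvg_ReImP.
have -> : (fun t => complex.Re (vquot f x t)) =
    (fun h => h^-1 * (complex.Re (f (x + h)) - complex.Re (f x))).
  by apply/funext => h; rewrite /vquot ReZ ReB.
have -> : (fun t => complex.Im (vquot f x t)) =
    (fun h => h^-1 * (complex.Im (f (x + h)) - complex.Im (f x))).
  by apply/funext => h; rewrite /vquot ImZ ImB.
by [].
Qed.

Lemma has_cderiv_eq f x l : has_cderiv f x l -> vderive f x = l.
Proof. by case=> fl; apply: vderive_eq fl; exact: hausC. Qed.

End complex_derivative.

Section real_derivative.
Context {R : realType}.

(** By the mean value theorem [G + f] and [G - f] are nondecreasing. A general majorant [G] is
    allowed because the decay of primitives is later compared with the arctangent. *)
Lemma derive_dist_le (f df G dG : R -> R) (a b : R) : a <= b ->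
  (forall x, a <= x <= b -> is_derive x 1 f (df x)) ->
  (forall x, a <= x <= b -> is_derive x 1 G (dG x)) ->
  (forall x, a <= x <= b -> `|df x| <= dG x) ->
  `|f b - f a| <= G b - G a.
Proof.
move=> ab fdf GdG dfdG.
have cont (u du : R -> R) : (forall x, a <= x <= b -> is_derive x 1 u (du x)) ->
    {within `[a, b], continuous u}.
  move=> udu; apply: derivable_within_continuous => x.
  by rewrite in_itv/= => /udu[].
have mono (u du : R -> R) : (forall x, a <= x <= b -> is_derive x 1 u (du x)) ->
    (forall x, a <= x <= b -> 0 <= du x) -> u a <= u b.
  move=> udu du0; have [||c] := @MVT_segment _ u du a b ab.
  - by move=> x /subset_itv_oo_cc; rewrite in_itv/=; exact: udu.
  - exact: cont udu.
  rewrite in_itv/= => cab E.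
  by rewrite -subr_ge0 E mulr_ge0 ?du0 ?subr_ge0.
rewrite ler_norml; apply/andP; split.
  have := mono (G + f) (dG + df); rewrite !fctE lerNl opprB => H.
  suff : G a + f a <= G b + f b by lra.
  apply: H => x xab; first by apply: is_deriveD; [exact: GdG|exact: fdf].
  by have := dfdG x xab; rewrite ler_norml => /andP[]; lra.
have := mono (G - f) (dG - df); rewrite !fctE => H.
suff : G a - f a <= G b - f b by lra.
apply: H => x xab; first by apply: is_deriveB; [exact: GdG|exact: fdf].
by have := dfdG x xab; rewrite ler_norml => /andP[]; lra.
Qed.

End real_derivative.

Section complex_derivative.
Context {R : realType}.
Implicit Types (f g : R -> R[i]^o) (x : R) (l : R[i]^o).

Lemma has_cderivD f g x l m : has_cderiv f x l -> has_cderiv g x m ->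
  has_cderiv (f + g) x (l + m).
Proof. by move=> [fl] [gm]; exact: (HasCderiv (vquotD fl gm)). Qed.

Lemma mulc_continuous (c : R[i]) : continuous ( *%R c : R[i]^o -> R[i]^o).
Proof. exact: mulrl_continuous. Qed.

Lemma has_cderivZ (c : R[i]) f x l : has_cderiv f x l ->
  has_cderiv (c *: f) x (c * l).
Proof.
case=> fl; split.
exact: (@vquot_linear _ _ _ ( *:%R c : {linear R[i]^o -> R[i]^o}) f x l
  (mulc_continuous (c := c)) fl).
Qed.

Lemma has_cderivB f g x l m : has_cderiv f x l -> has_cderiv g x m ->
  has_cderiv (f - g) x (l - m).
Proof.
move=> /has_cderivP[fr fi] /has_cderivP[gr gi]; apply/has_cderivP; split.
  rewrite ReB (_ : (fun t => _) = (fun t => complex.Re (f t)) -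
    (fun t => complex.Re (g t))); first exact: is_deriveB.
  by apply/funext => t; rewrite !fctE ReB.
rewrite ImB (_ : (fun t => _) = (fun t => complex.Im (f t)) -
  (fun t => complex.Im (g t))); first exact: is_deriveB.
by apply/funext => t; rewrite !fctE ImB.
Qed.

Lemma has_cderiv_cst l x : has_cderiv (cst l) x 0.
Proof.
by apply/has_cderivP; split; rewrite /cst; exact: is_derive_cst.
Qed.

Lemma has_cderiv_real (u : R -> R) (du : R) (c : R[i]) x : is_derive x 1 u du ->
  has_cderiv (fun t => (u t)%:C * c) x (du%:C * c).
Proof.
move=> udu.
have E : (fun t => (u t)%:C * c) = (c *: (fun t => (u t)%:C : R[i]^o)).
  by apply/funext => t; rewrite mulrC.
rewrite E mulrC; apply: has_cderivZ; apply/has_cderivP; split => //=.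
exact: is_derive_cst.
Qed.

Lemma has_cderiv_near f g x l : (\forall t \near x, f t = g t) ->
  has_cderiv g x l -> has_cderiv f x l.
Proof.
move=> fg /has_cderivP[gr gi]; apply/has_cderivP; split.
  by apply: near_eq_is_derive gr; apply: filterS fg => t /= ->.
by apply: near_eq_is_derive gi; apply: filterS fg => t /= ->.
Qed.

Lemma has_cderiv_uniq f x l m : has_cderiv f x l -> has_cderiv f x m -> l = m.
Proof. by move=> /has_cderiv_eq <- /has_cderiv_eq. Qed.

(** The factor 2 is the price of treating real and imaginary parts separately. *)
Lemma cderiv_dist_le (f df : R -> R[i]^o) (G dG : R -> R) (a b : R) : a <= b ->
  (forall x, a <= x <= b -> has_cderiv f x (df x)) ->
  (forall x, a <= x <= b -> is_derive x 1 G (dG x)) ->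
  (forall x, a <= x <= b -> normc (df x) <= dG x) ->
  normc (f b - f a) <= 2 * (G b - G a).
Proof.
move=> ab fdf GdG dfdG.
rewrite (le_trans (normc_le_ReIm _))// ReB ImB mulrDl !mul1r lerD//.
  apply: (@derive_dist_le _ (fun t => complex.Re (f t)) (fun t => complex.Re (df
    t)) _ dG) => // x xab.
    by have /has_cderivP[] := fdf x xab.
  exact: le_trans (Re_le_normc _) (dfdG x xab).
apply: (@derive_dist_le _ (fun t => complex.Im (f t)) (fun t => complex.Im (df
  t)) _ dG) => // x xab.
  by have /has_cderivP[] := fdf x xab.
exact: le_trans (Im_le_normc _) (dfdG x xab).
Qed.

Lemma cderiv_lipschitz (f df : R -> R[i]^o) (M a b : R) : a <= b ->
  (forall x, a <= x <= b -> has_cderiv f x (df x)) ->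
  (forall x, a <= x <= b -> normc (df x) <= M) ->
  normc (f b - f a) <= 2 * M * (b - a).
Proof.
move=> ab fdf dfM.
have idM x : a <= x <= b -> is_derive x 1 (fun t => M * t) M.
  move=> _; have : is_derive x 1 (M *: (id : R -> R)) (M *: (1 : R)).
    exact: is_deriveZ.
  by rewrite [X in is_derive _ _ _ X]mulr1.
apply: le_trans (cderiv_dist_le ab fdf idM dfM) _.
by rewrite -mulrBr mulrA.
Qed.

Lemma cderiv_lipschitz_dist (f df : R -> R[i]^o) (M a b : R) :
  (forall x, has_cderiv f x (df x)) -> (forall x, normc (df x) <= M) ->
  normc (f b - f a) <= 2 * M * `|b - a|.
Proof.
move=> fdf dfM; wlog ab : a b / a <= b => [W|].
  by have [/W//|/ltW/W] := leP a b; rewrite normc_distC distrC.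
by rewrite ger0_norm ?subr_ge0//; exact: cderiv_lipschitz.
Qed.

Lemma cderiv0_cst (f : R -> R[i]^o) (a b : R) : a <= b ->
  (forall x, a <= x <= b -> has_cderiv f x 0) -> f a = f b.
Proof.
move=> ab f0; apply/esym/eqP; rewrite -subr_eq0 -normc_eq0 eq_le normc_ge0
  andbT.
have := @cderiv_lipschitz f (fun=> 0) 0 a b ab f0; rewrite mulr0 mul0r; apply.
by move=> x _; rewrite normc0.
Qed.

Lemma cderiv0_cstT (f : R -> R[i]^o) (a b : R) :
  (forall x, has_cderiv f x 0) -> f a = f b.
Proof.
by move=> f0; have [ab|/ltW ba] := leP a b; [|apply/esym];
  apply: cderiv0_cst => // x _.
Qed.

Lemma has_cderiv_continuous f x l : has_cderiv f x l -> {for x, continuous f}.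
Proof.
move=> /has_cderivP[[fr _] [fi _]].
by apply/cvg_ReImP; split; apply/differentiable_continuous;
  apply/derivable1_diffP.
Qed.

(** The mean value inequality is used twice, each time with its factor 2: first for [f1], then for
    [g], whose derivative is [f1 t - f1 x]. The error depends on [f] only through [M], which is what
    differentiating a series term by term requires. *)
Lemma vquot_dist_le (f f1 f2 : R -> R[i]^o) (M x h : R) : h != 0 ->
  (forall t, has_cderiv f t (f1 t)) -> (forall t, has_cderiv f1 t (f2 t)) ->
  (forall t, normc (f2 t) <= M) ->
  normc (vquot f x h - f1 x) <= 4 * M * `|h|.
Proof.
move=> h0 ff1 f1f2 f2M.
pose g := f - (fun t => (t%:C : R[i]) * f1 x).
have gd t : has_cderiv g t (f1 t - f1 x).
  apply: has_cderivB; first exact: ff1.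
  have := @has_cderiv_real id 1 (f1 x) t; rewrite mul1r; apply.
have M0 : 0 <= M by exact: le_trans (normc_ge0 _) (f2M 0).
have E : vquot f x h - f1 x = (h^-1)%:C * (g (x + h) - g x).
  rewrite /vquot /g !fctE rmorphD/= mulrDl.
  rewrite (_ : _ - _ - _ = f (x + h) - f x - h%:C * f1 x); last by ring.
  rewrite mulrBr mulrA -rmorphM mulVf//= mul1r.
  by [].
rewrite E normcM normc_real normfV ler_pdivrMl ?normr_gt0//.
have B a b t : a <= b -> (a = x /\ b = x + h) \/ (a = x + h /\ b = x) ->
    a <= t <= b -> normc (f1 t - f1 x) <= 2 * M * `|h|.
  move=> ab abx tab.
  apply: le_trans (cderiv_lipschitz_dist _ _ f1f2 f2M) _.
  rewrite ler_wpM2l// ?mulr_ge0//.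
  case: abx tab => -[-> ->] /andP[t1 t2].
    by rewrite !ger0_norm; lra.
  by rewrite !ler0_norm; lra.
have [hp|hn] := leP 0 h.
  have := @cderiv_lipschitz g _ (2 * M * `|h|) x (x + h) _ (fun t _ => gd t).
  rewrite lerDl hp => /(_ isT) H.
  apply: le_trans (H _) _; first by move=> t; apply: B; [lra|left].
  rewrite (_ : x + h - x = h); last by ring.
  by rewrite (ger0_norm hp) le_eqVlt; apply/orP; left; apply/eqP; ring.
rewrite normc_distC.
have xhx : x + h <= x by lra.
have := @cderiv_lipschitz g _ (2 * M * `|h|) (x + h) x _ (fun t _ => gd t).
move=> /(_ xhx) H.
apply: le_trans (H _) _; first by move=> t; apply: B; [lra|right].
rewrite (_ : x - (x + h) = - h); last by ring.
by rewrite (ltr0_norm hn) le_eqVlt; apply/orP; left; apply/eqP; ring.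
Qed.

End complex_derivative.

(** * Schwartz norms *)

Section schwartz_estimates.
Context {R : realType}.
Implicit Types (phi psi : schwartz R) (k m n : nat) (x M : R).

Lemma schwartzP phi : schwartz_fun (phi : R -> R[i]^o).
Proof. exact: asboolW (schwartz_valP phi). Qed.

Lemma schwartz_has_cderiv phi n x :
  has_cderiv (vderiven n phi) x (vderiven n.+1 phi x).
Proof. by split; apply: vderive_cvg; have [+ _] := schwartzP phi; apply. Qed.

Lemma schwartz_has_cderiv0 phi x : has_cderiv phi x (vderiven 1%N phi x).
Proof. exact: (@schwartz_has_cderiv phi 0%N). Qed.

Lemma tvs_bounded_normcP (A : set R[i]^o) :
  tvs_bounded A <-> exists M, forall z, A z -> normc z <= M.
Proof.
split=> [bA|[M AM]].
  have U0 : nbhs (0 : R[i]^o) [set z | normc z < 1].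
    by apply/nbhs_normcP; exists 1 => // w; rewrite subr0.
  have [t [t0 At]] : exists t : R, 0 < t /\ A `<=` [set t%:C *: u | u in [set z
    : R[i]^o | normc z < 1]].
    near (+oo : set_system R) => t; exists t; split; near: t.
      exact: nbhs_pinfty_gt.
    exact: bA.
  exists t => z /At[u /= u1 <-]; rewrite normcM normc_real gtr0_norm//.
  by rewrite ler_piMr ?ltW.
move=> U /nbhs_normcP[e e0 eU].
near=> t => z Az; have t0 : 0 < t by near: t; exact: nbhs_pinfty_gt.
exists ((t^-1)%:C * z).
  apply: eU; rewrite subr0 normcM normc_real ger0_norm ?invr_ge0 ?ltW//.
  rewrite ltr_pdivrMl// (le_lt_trans (AM _ Az))// -ltr_pdivrMr//.
  by near: t; apply: nbhs_pinfty_gt; exact: num_real.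
by rewrite /= -[_ *: _]/(_ * _) mulrA -rmorphM mulfV ?gt_eqF// mul1r.
Unshelve. all: by end_near. Qed.

Lemma schwartz_bounded phi k m :
  exists M, forall x, `|x| ^+ k * normc (vderiven m phi x) <= M.
Proof.
have [_ /(_ k m)/tvs_bounded_normcP[M kM]] := schwartzP phi.
exists M => x; rewrite -normrX -normc_real -normcM.
by apply: kM; exists x.
Qed.

Lemma schwartz_seminorm_ge phi k m x :
  `|x| ^+ k * normc (vderiven m phi x) <= schwartz_seminorm k m phi.
Proof.
rewrite -normrX -normc_real -normcM; apply: ub_le_sup; last by exists x.
have [M kM] := schwartz_bounded phi k m.
by exists M => _ [t _ <-]; rewrite normcM normc_real normrX.
Qed.

Lemma schwartz_seminorm_le phi k m M :
  (forall x, `|x| ^+ k * normc (vderiven m phi x) <= M) ->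
  schwartz_seminorm k m phi <= M.
Proof.
move=> kM; apply: ge_sup; first by exists (normc ((0 ^+ k)%:C * vderiven m phi
  0)); exists 0.
by move=> _ [x _ <-]; rewrite normcM normc_real normrX.
Qed.

Lemma schwartz_seminorm_ge0 phi k m : 0 <= schwartz_seminorm k m phi.
Proof.
apply: le_trans (schwartz_seminorm_ge phi k m 0).
by rewrite mulr_ge0 ?normc_ge0// exprn_ge0.
Qed.

Lemma vderiven_schwartzD phi psi m :
  vderiven m (phi + psi : schwartz R) = vderiven m phi + vderiven m psi.
Proof.
have [phis _] := schwartzP phi; have [psis _] := schwartzP psi.
exact: (@vderivenD R R[i]^o phi psi m hausC phis psis).
Qed.

Lemma vderiven_schwartzZ (c : R[i]) phi m x :
  vderiven m (c *: phi : schwartz R) x = c * vderiven m phi x.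
Proof.
have [phis _] := schwartzP phi.
by rewrite (@vderiven_linear _ _ _ ( *:%R c : {linear R[i]^o -> R[i]^o}) phi m
  hausC (mulc_continuous (c := c)) phis).
Qed.

Lemma vderiven_schwartzZD (c : R[i]) phi psi m x :
  vderiven m (c *: phi + psi : schwartz R) x =
  c * vderiven m phi x + vderiven m psi x.
Proof. by rewrite vderiven_schwartzD fctE vderiven_schwartzZ. Qed.

Lemma vderiven_schwartz_derive phi m :
  vderiven m (schwartz_derive phi) = vderiven m.+1 phi.
Proof. by rewrite /vderiven iterSr. Qed.

Lemma schwartz_ext phi psi : (forall x, phi x = psi x) -> phi = psi.
Proof. by move=> E; apply/val_inj/funext. Qed.

(* the norms in the definition of [tempered] *)
Definition schwartz_norm n phi : R :=
  \sum_(k < n) \sum_(m < n) schwartz_seminorm k m phi.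

Lemma schwartz_norm_ge n phi k m : (k < n)%N -> (m < n)%N ->
  schwartz_seminorm k m phi <= schwartz_norm n phi.
Proof.
move=> kn mn; rewrite /schwartz_norm (bigD1 (Ordinal kn))//=.
rewrite (bigD1 (Ordinal mn))//= -addrA lerDl addr_ge0//.
  by apply: sumr_ge0 => i _; exact: schwartz_seminorm_ge0.
by apply: sumr_ge0 => i _; apply: sumr_ge0 => j _; exact: schwartz_seminorm_ge0.
Qed.

Lemma schwartz_norm_ge_at n phi k m x : (k < n)%N -> (m < n)%N ->
  `|x| ^+ k * normc (vderiven m phi x) <= schwartz_norm n phi.
Proof.
by move=> kn mn; apply: le_trans (schwartz_norm_ge _ kn mn);
  exact: schwartz_seminorm_ge.
Qed.

Lemma schwartz_norm_le n phi M :
  (forall k m x, (k < n)%N -> (m < n)%N ->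
     `|x| ^+ k * normc (vderiven m phi x) <= M) ->
  schwartz_norm n phi <= (n * n)%:R * M.
Proof.
move=> nM; rewrite natrM -mulrA mulr_natl /schwartz_norm.
rewrite -[X in _ *+ X]card_ord -sumr_const; apply: ler_sum => k _.
rewrite mulr_natl -[X in _ *+ X]card_ord -sumr_const; apply: ler_sum => m _.
by apply: schwartz_seminorm_le => x; exact: nM.
Qed.

Lemma schwartz_norm_ge0 n phi : 0 <= schwartz_norm n phi.
Proof.
by apply: sumr_ge0 => i _; apply: sumr_ge0 => j _; exact: schwartz_seminorm_ge0.
Qed.

Lemma schwartz_normD n phi psi :
  schwartz_norm n (phi + psi) <= schwartz_norm n phi + schwartz_norm n psi.
Proof.
rewrite /schwartz_norm -big_split; apply: ler_sum => k _ /=.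
rewrite -big_split; apply: ler_sum => m _ /=.
apply: schwartz_seminorm_le => x; rewrite vderiven_schwartzD fctE.
apply: le_trans (lerD (schwartz_seminorm_ge phi k m x)
  (schwartz_seminorm_ge psi k m x)).
by rewrite -mulrDr ler_wpM2l ?exprn_ge0// normc_le_add.
Qed.

Lemma schwartz_normZ n (c : R[i]) phi :
  schwartz_norm n (c *: phi) <= normc c * schwartz_norm n phi.
Proof.
rewrite /schwartz_norm mulr_sumr; apply: ler_sum => k _ /=.
rewrite mulr_sumr; apply: ler_sum => m _ /=.
apply: schwartz_seminorm_le => x; rewrite vderiven_schwartzZ normcM mulrCA.
by rewrite ler_wpM2l ?normc_ge0// schwartz_seminorm_ge.
Qed.

Lemma schwartz_norm_mono m n phi : (m <= n)%N ->
  schwartz_norm m phi <= schwartz_norm n phi.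
Proof.
move=> mn; rewrite /schwartz_norm (big_ord_widen n (fun k => \sum_(j < m)
  schwartz_seminorm k j phi) mn).
rewrite big_mkcond/=; apply: ler_sum => k _; case: ifP => _; last first.
  by apply: sumr_ge0 => j _; exact: schwartz_seminorm_ge0.
rewrite (big_ord_widen n (fun j => schwartz_seminorm k j phi) mn).
rewrite big_mkcond/=; apply: ler_sum => j _; case: ifP => _ //.
exact: schwartz_seminorm_ge0.
Qed.

(** A Schwartz function is presented by the whole sequence of its derivatives, since [vderive] is
    defined by choice and can only be identified. *)
Lemma has_cderiv_seq_vderiven (F : nat -> R -> R[i]^o) :
  (forall n x, has_cderiv (F n) x (F n.+1 x)) ->
  forall n, vderiven n (F 0%N) = F n.
Proof.
move=> FF; elim=> [//|n IHn]; apply/funext => x.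
by rewrite /vderiven iterS -/(vderiven n _) IHn; exact: has_cderiv_eq.
Qed.

Lemma schwartz_fun_intro (F : nat -> R -> R[i]^o) :
  (forall n x, has_cderiv (F n) x (F n.+1 x)) ->
  (forall k n, exists M, forall x, `|x| ^+ k * normc (F n x) <= M) ->
  schwartz_fun (F 0%N).
Proof.
move=> FF FB; have E := has_cderiv_seq_vderiven FF.
split=> [n x|k m]; rewrite E; first by exists (F n.+1 x); case: (FF n x).
apply/tvs_bounded_normcP; have [M kM] := FB k m; exists M => _ [x _ <-].
by rewrite normcM normc_real normrX.
Qed.

Lemma schwartz_intro (F : nat -> R -> R[i]^o) :
  (forall n x, has_cderiv (F n) x (F n.+1 x)) ->
  (forall k n, exists M, forall x, `|x| ^+ k * normc (F n x) <= M) ->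
  exists phi, forall n, vderiven n phi = F n.
Proof.
move=> FF FB; have Fs : F 0%N \in @schwartz_pred R.
  by apply/asboolP; exact: schwartz_fun_intro.
by exists (Schwartz Fs); exact: has_cderiv_seq_vderiven.
Qed.

(** Only [F] itself calls for a decay estimate: its derivatives are those of [psi]. *)
Lemma schwartz_primitive_intro (F : R -> R[i]^o) psi :
  (forall x, has_cderiv F x (psi x)) ->
  (forall k, exists M, forall x, `|x| ^+ k * normc (F x) <= M) ->
  exists phi, (forall x, phi x = F x) /\ schwartz_derive phi = psi.
Proof.
move=> Fpsi FB.
pose G n := if n is n'.+1 then vderiven n' psi else F.
have [||phi phiG] := @schwartz_intro G.
- by case=> [|n] x //=; exact: schwartz_has_cderiv.
- by move=> k [|n]; [exact: FB|exact: schwartz_bounded].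
exists phi; split=> [x|]; first by rewrite -[LHS]/(vderiven 0%N phi x) phiG.
by apply: schwartz_ext => x; rewrite -[LHS]/(vderiven 1%N phi x) phiG.
Qed.

Lemma dderive_iter (u : schwartz R -> R[i]^o) n phi :
  iter n dderive u phi = (-1) ^+ n * u (iter n (@schwartz_derive R) phi).
Proof.
elim: n phi => [|n IHn] phi; first by rewrite expr0 mul1r.
by rewrite iterS /dderive IHn exprS mulN1r mulNr -iterSr.
Qed.

Lemma tempered_linD (u : schwartz R -> R[i]^o) phi psi : tempered u ->
  u (phi + psi) = u phi + u psi.
Proof. by move=> [uL _]; rewrite -[phi]scale1r uL !scale1r. Qed.

Lemma tempered_lin0 (u : schwartz R -> R[i]^o) : tempered u -> u 0 = 0.
Proof.
move=> tu; apply: (addrI (u 0)); by rewrite -tempered_linD// !addr0.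
Qed.

Lemma tempered_linZ (u : schwartz R -> R[i]^o) (c : R[i]) phi : tempered u ->
  u (c *: phi) = c * u phi.
Proof.
move=> tu; have [uL _] := tu.
by rewrite -[c *: phi]addr0 uL tempered_lin0// addr0.
Qed.

Lemma tempered_linB (u : schwartz R -> R[i]^o) phi psi : tempered u ->
  u (phi - psi) = u phi - u psi.
Proof.
by move=> tu; rewrite -scaleN1r tempered_linD// tempered_linZ// mulN1r.
Qed.

Lemma tempered_lin_sum (u : schwartz R -> R[i]^o) (I : Type) (r : seq I)
    (P : pred I) (F : I -> schwartz R) : tempered u ->
  u (\sum_(i <- r | P i) F i) = \sum_(i <- r | P i) u (F i).
Proof.
move=> tu; elim/big_rec2 : _ => [|i y1 y2 _ <-]; first exact: tempered_lin0.
exact: tempered_linD.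
Qed.

Lemma tempered_bound (u : schwartz R -> R[i]^o) : tempered u ->
  exists n M, 0 <= M /\ forall phi, normc (u phi) <= M * schwartz_norm n phi.
Proof.
move=> [_ [n [M uM]]]; exists n, `|M|; split => // phi.
apply: le_trans (uM phi) _; rewrite -/(schwartz_norm n phi).
by rewrite ler_wpM2r ?ler_norm// schwartz_norm_ge0.
Qed.

End schwartz_estimates.

(** * Bump functions *)

Section antiderivative.
Context {R : realType}.

Lemma is_derive_quadratic (u : R -> R) (x C : R) : u x = 0 ->
  (forall t, `|u t| <= C * (t - x) ^+ 2) -> is_derive x 1 u 0.
Proof.
move=> ux uC; apply/is_deriveP/cvgrPdist_lt => e e0.
have C0 : 0 <= C by have := uC (x + 1); rewrite addrAC subrr add0r expr1n mulr1;
  exact: le_trans.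
near=> h; have h0 : h != 0 by near: h; exact: nbhs_dnbhs_neq.
rewrite sub0r normrN ux subr0 normrM normfV ltr_pdivrMl ?normr_gt0//.
apply: le_lt_trans (uC _) _; rewrite addrAC subrr add0r.
rewrite -real_normK ?num_real// expr2 mulrCA ltr_pM2l ?normr_gt0//.
have he : `|h| < e / (C + 1).
  near: h; apply: dnbhs0_lt; by rewrite divr_gt0// ltr_wpDl.
move: he; rewrite ltr_pdivlMr ?ltr_wpDl// mulrDr mulr1 => he.
by rewrite mulrC (le_lt_trans _ he)// lerDl.
Unshelve. all: by end_near. Qed.

(** Integrating from -n gives an antiderivative to the right of -n. Normalised at 0, these agree
    where they overlap, and the value at x is read from the first n above |x|. *)
Lemma continuous_antiderivative (f : R -> R) : continuous f ->
  exists F : R -> R, forall x : R, is_derive x 1 F (f x).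
Proof.
move=> cf.
pose G (n : nat) (x : R) : R := (\int[lebesgue_measure]_(t in `[(- n%:R)%R, x])
  f t)%R.
have Gd n (x : R) : - n%:R < x -> is_derive x 1 (G n) (f x).
  move=> nx; have [||||dG G'] := @continuous_FTC1_closed R f (- n%:R) x (x + 1).
  - by rewrite ltrDl.
  - apply: continuous_compact_integrable; first exact: segment_compact.
    exact: continuous_subspaceT.
  - exact: nx.
  - exact: cf.
  rewrite -G' derive1E; exact: (DeriveDef dG erefl).
pose F (n : nat) (x : R) : R := G n x - G n 0.
have Fd n (x : R) : - n%:R < x -> is_derive x 1 (F n) (f x).
  move=> nx; rewrite -[f x]subr0; apply: is_deriveB; exact: Gd.
have F0 n : F n 0 = 0 :> R by rewrite /F subrr.
have FE (m n : nat) (x : R) : `|x| < m%:R -> `|x| < n%:R -> F m x = F n x.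
  rewrite !ltr_norml => /andP[mx xm] /andP[nx xn].
  have m0 : (0 : R) < m%:R by lra.
  have n0 : (0 : R) < n%:R by lra.
  have D (t : R) : - m%:R < t -> - n%:R < t -> is_derive t 1 (F m - F n) 0.
    by move=> mt nt; rewrite -(subrr (f t)); apply: is_deriveB; exact: Fd.
  have Z (a b : R) : a <= b -> - m%:R < a -> - n%:R < a ->
      (F m - F n) a = (F m - F n) b.
    move=> ab ma na; apply/esym/eqP; rewrite -subr_eq0 -normr_le0.
    rewrite -(subrr (0 : R)).
    apply: (@derive_dist_le R (F m - F n) (fun=> 0) (cst 0) (fun=> 0)) => // t.
    - by move=> /andP[a_t tb]; apply: D; lra.
    - by rewrite normr0.
  apply/eqP; rewrite -subr_eq0.
  have -> : F m x - F n x = (F m - F n) 0.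
    have [x0|/ltW x0] := leP x 0.
      by rewrite -(Z x 0).
    by rewrite (Z 0 x)//; lra.
  by rewrite !fctE !F0 subrr.
exists (fun x => F (Num.truncn `|x|).+1 x) => x.
pose n := (Num.truncn (`|x| + 1)).+1.
have xn : `|x| + 1 < n%:R by rewrite truncnS_gt.
apply: (@near_eq_is_derive _ _ _ (F n)).
  have /nbhs_ballP : exists2 e : R, 0 < e & ball x e `<=` [set t | F n t =
    F (Num.truncn `|t|).+1 t].
    exists 1; first exact: ltr01.
    move=> t; rewrite -ball_normE /ball_/= => xt.
    apply: FE; last exact: truncnS_gt.
    apply: le_lt_trans xn; rewrite -lerBlDl.
    by apply: le_trans (lerB_dist _ _) _; rewrite distrC ltW.
  exact.
by apply: Fd; have : `|x| < n%:R by [apply: lt_trans xn; rewrite ltrDl];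
  rewrite ltr_norml => /andP[].
Qed.

Lemma complex_antiderivative (f : R -> R[i]^o) : continuous f ->
  exists F : R -> R[i]^o, F 0 = 0 /\ forall x, has_cderiv F x (f x).
Proof.
move=> cf.
have [|Fr Frf] := @continuous_antiderivative (fun x => complex.Re (f x)).
  by move=> x; have /cvg_ReImP[] := cf x.
have [|Fi Fif] := @continuous_antiderivative (fun x => complex.Im (f x)).
  by move=> x; have /cvg_ReImP[] := cf x.
exists (fun x => (Fr x - Fr 0) +i* (Fi x - Fi 0)); split.
  by rewrite !subrr.
move=> x; apply/has_cderivP; split => /=.
  by rewrite -[complex.Re _]subr0; apply: is_deriveB; exact: Frf.
by rewrite -[complex.Im _]subr0; apply: is_deriveB; exact: Fif.
Qed.

Lemma supported_bounded (f : R -> R[i]^o) (a b : R) : continuous f ->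
  (forall x, f x != 0 -> a <= x <= b) ->
  forall k, exists M, forall x, `|x| ^+ k * normc (f x) <= M.
Proof.
move=> cf fab k.
pose g x := `|x| ^+ k * (`|complex.Re (f x)| + `|complex.Im (f x)|).
have cg : continuous g.
  move=> x; have /cvg_ReImP[fr fi] := cf x.
  apply: cvgM.
    apply: (@cvg_comp _ _ _ (fun x : R => `|x|) (fun y : R => y ^+ k)
      (nbhs x) (nbhs `|x|)); first exact: (@norm_continuous R R x).
    exact: exprn_continuous.
  by apply: cvgD; [apply: (cvg_norm fr)|apply: (cvg_norm fi)].
have gf x : `|x| ^+ k * normc (f x) <= g x.
  by rewrite ler_wpM2l ?exprn_ge0// normc_le_ReIm.
have [ab|ba] := leP a b.
  have [c _ cmax] := EVT_max ab (continuous_subspaceT cg).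
  exists (Num.max 0 (g c)) => x.
  have [->|fx0] := eqVneq (f x) 0; first by rewrite normc0 mulr0 le_max lexx.
  apply: le_trans (gf x) _; rewrite le_max; apply/orP; right.
  by apply: cmax; rewrite in_itv/= fab.
exists 0 => x; have [->|/fab] := eqVneq (f x) 0; first by rewrite normc0 mulr0.
by move=> /andP[ax xb]; have := le_trans ax xb; rewrite leNgt ba.
Qed.

End antiderivative.

Section bump.
Context {R : realType}.

Definition flat (j : nat) (x : R) : R :=
  if 0 < x then (x^-1) ^+ j * expR (- x^-1) else 0.

Lemma flat_ge0 j x : 0 <= flat j x.
Proof.
rewrite /flat; case: ifP => // x0.
by rewrite mulr_ge0 ?expR_ge0// exprn_ge0// invr_ge0 ltW.
Qed.

(** With y = 1/x, the exponential series gives e^y >= y^(j+2) / (j+2)!. The right-hand side has the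
    shape of [is_derive_quadratic], which then yields the derivative 0 at the origin. *)
Lemma flat_le_sqr j x : `|flat j x| <= (j.+2)`!%:R * (x - 0) ^+ 2.
Proof.
rewrite ger0_norm ?flat_ge0// subr0 /flat; case: ifPn => x0; last first.
  by rewrite mulr_ge0 ?sqr_ge0.
have y0 : 0 < x^-1 by rewrite invr_gt0.
rewrite expRN ler_pdivrMr ?expR_gt0//.
apply: (@le_trans _ _ ((j.+2)`!%:R * x ^+ 2 * ((x^-1) ^+ j.+2 / (j.+2)`!%:R)));
  last first.
  apply: ler_wpM2l; first by apply: mulr_ge0; [exact: ler0n|exact: sqr_ge0].
  by have := expR_ge1Dxn j.+1 (ltW y0); lra.
have f0 : (j.+2)`!%:R != 0 :> R by rewrite pnatr_eq0 -lt0n fact_gt0.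
rewrite -[in X in _ * (X / _)]addn2 exprD [_ / _]mulrC mulrACA divff// mul1r.
by rewrite mulrCA -exprMn mulfV ?gt_eqF// expr1n mulr1.
Qed.

Lemma is_derive_flat j (x : R) :
  is_derive x 1 (flat j) (- j%:R * flat j.+1 x + flat j.+2 x).
Proof.
have [x0|x0|<-] := ltgtP 0 x; last 1 first.
- have -> : - j%:R * flat j.+1 0 + flat j.+2 0 = 0.
    by rewrite /flat ltxx mulr0 addr0.
  by apply: is_derive_quadratic (flat_le_sqr j); rewrite /flat ltxx.
- have y0 : x != 0 by rewrite gt_eqF.
  have dV : is_derive x 1 (fun t : R => t^-1) (- x ^- 2).
    have := @is_deriveV R id x 1 1 y0 (is_derive_id x (1 : R)).
    by rewrite [_ *: _]mulr1.
  have dE : is_derive x 1 (fun t : R => expR (- t^-1)) (x ^- 2 * expR (- x^-1)).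
    have := @is_derive1_comp R expR (fun t => - t^-1) x _ _ (is_derive_expR _)
      (is_deriveN dV).
    by rewrite opprK mulrC.
  have dP : is_derive x 1 ((fun t : R => t^-1) ^+ j) ((j%:R * x^-1 ^+ j.-1) *: -
    x ^- 2).
    exact: is_deriveX.
  have := is_deriveM dP dE; rewrite !fctE => D.
  apply: (@near_eq_is_derive _ _ _ (fun t : R => t^-1 ^+ j * expR (- t^-1))).
    near=> t; have t0 : 0 < t by near: t; exact: lt_nbhsr.
    by rewrite /flat t0.
  apply: is_derive_eq D _.
  rewrite /flat x0 /GRing.scale/=.
  case: j {dP} => [|j]; first by rewrite !mul0r /= -!exprVn; ring.
  by rewrite -!exprVn /= !exprS expr0; set a := j.+1%:R; ring.
- have -> : - j%:R * flat j.+1 x + flat j.+2 x = 0.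
    by rewrite /flat !(ltNge 0 x) !(ltW x0)/= mulr0 addr0.
  apply: (@near_eq_is_derive _ _ _ (cst 0)).
  near=> t; have t0 : t < 0 by near: t; exact: lt_nbhsl.
  by rewrite /flat ltNge ltW.
Unshelve. all: by end_near. Qed.


(* Finite sums of the [c * flat j (y - a) * flat k (b - y)] are closed under
   differentiation, because flat j' = - j flat (j + 1) + flat (j + 2). *)
Definition bump_eval (a b : R) (l : seq (R * nat * nat)) (y : R) : R :=
  \sum_(p <- l) p.1.1 * (flat p.1.2 (y - a) * flat p.2 (b - y)).

Definition bump_deriv (l : seq (R * nat * nat)) : seq (R * nat * nat) :=
  flatten [seq [:: (- p.1.1 * p.1.2%:R, p.1.2.+1, p.2);
                   (p.1.1, p.1.2.+2, p.2);
                   (p.1.1 * p.2%:R, p.1.2, p.2.+1);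
                   (- p.1.1, p.1.2, p.2.+2)] | p <- l].

Lemma is_derive_bump_eval a b l (y : R) :
  is_derive y 1 (bump_eval a b l) (bump_eval a b (bump_deriv l) y).
Proof.
elim: l => [|[[c j] k] l IHl].
  have E : bump_eval a b [::] = cst 0.
    by apply/funext => t; rewrite /bump_eval big_nil.
  by rewrite E; exact: (is_derive_cst (0 : R) y 1).
have E : bump_eval a b ((c, j, k) :: l) =
    c *: ((fun t => flat j (t - a)) * (fun t => flat k (b - t))) + bump_eval a b
      l.
  by apply/funext => t; rewrite /bump_eval big_cons.
have da : is_derive y 1 (fun t : R => t - a) 1.
  have := is_deriveB (is_derive_id y (1 : R)) (is_derive_cst a y 1).
  by rewrite subr0.
have db : is_derive y 1 (fun t : R => b - t) (- 1).
  have := is_deriveB (is_derive_cst b y 1) (is_derive_id y (1 : R)).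
  by rewrite sub0r.
have fa := @is_derive1_comp R (flat j) _ y _ _ (is_derive_flat j (y - a)) da.
have fb := @is_derive1_comp R (flat k) _ y _ _ (is_derive_flat k (b - y)) db.
rewrite E.
apply: (is_derive_eq (is_deriveD (is_deriveZ c (is_deriveM fa fb)) IHl)).
rewrite {2}/bump_eval /bump_deriv /= !big_cons -/(bump_deriv l) /=
  /GRing.scale/=.
rewrite -/(bump_eval a b (bump_deriv l) y).
by set A := bump_eval _ _ _ _; ring.
Qed.

Lemma bump_eval_out a b l (y : R) : y <= a \/ b <= y -> bump_eval a b l y = 0.
Proof.
move=> yab; rewrite /bump_eval big1// => p _.
case: yab => [ya|yb].
  by rewrite {1}/flat subr_gt0 ltNge ya mul0r mulr0.
by rewrite {2}/flat subr_gt0 ltNge yb mulr0 mulr0.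
Qed.

Lemma schwartz_bump (a b : R) : a < b -> exists u : R -> R,
  [/\ (forall y, 0 <= u y), (forall y, a < y < b -> 0 < u y),
      continuous u, (forall y, y <= a \/ b <= y -> u y = 0) &
      exists phi : schwartz R, forall y, phi y = (u y)%:C].
Proof.
move=> ab; pose l n := iter n bump_deriv [:: (1, 0%N, 0%N)].
have E y : bump_eval a b (l 0%N) y = flat 0 (y - a) * flat 0 (b - y).
  by rewrite /bump_eval big_seq1 /= mul1r.
exists (bump_eval a b (l 0%N)); split.
- by move=> y; rewrite E mulr_ge0 ?flat_ge0.
- move=> y /andP[ay yb].
  by rewrite E /flat !subr_gt0 ay yb !mulr_gt0 ?expR_gt0// exprn_gt0// invr_gt0
    subr_gt0.
- move=> y; have [d _] := is_derive_bump_eval a b (l 0%N) y.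
  by apply/differentiable_continuous/derivable1_diffP.
- exact: bump_eval_out.
pose F n (y : R) : R[i]^o := (bump_eval a b (l n) y)%:C.
have FF n x : has_cderiv (F n) x (F n.+1 x).
  apply/has_cderivP; split => /=; last exact: (is_derive_cst (0 : R) x 1).
  exact: is_derive_bump_eval.
have [|phi phiF] := schwartz_intro FF; last first.
  by exists phi => y; rewrite -[LHS]/(vderiven 0%N phi y) phiF.
move=> k n; apply: (@supported_bounded _ _ a b).
  by move=> x; apply: has_cderiv_continuous (FF n x).
move=> x; have [//|] := boolP (a <= x <= b).
rewrite negb_and -!ltNge /F => /orP H /negP[]; apply/eqP.
by rewrite bump_eval_out//; case: H => /ltW; [left|right].
Qed.

(** The bump is accompanied by its primitive [S], a smooth step from 0 to 1: subtracting a multiple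
    of [S] makes a primitive of a test function vanish to the right of the support. *)
Lemma mollifier_exists (a b : R) : a < b ->
  exists (rho : schwartz R) (S : R -> R),
  [/\ forall x, has_cderiv (fun t => (S t)%:C : R[i]^o) x (rho x),
      forall x, x <= a -> S x = 0, forall x, b <= x -> S x = 1,
      forall x, 0 <= S x <= 1 &
      forall x, x <= a \/ b <= x -> rho x = 0].
Proof.
move=> ab; have [u [u0 up uc uout [phi phiu]]] := schwartz_bump ab.
have [V Vu] := continuous_antiderivative uc.
have Vmono x y : x <= y -> V x <= V y.
  move=> xy; rewrite -subr_ge0; apply: le_trans (normr_ge0 (V y - V x)) _.
  apply: (@derive_dist_le _ V u V u) => // t _.
  by rewrite ger0_norm.
have Vcst x y : x <= y -> (forall t, x <= t <= y -> u t = 0) -> V x = V y.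
  move=> xy t0; apply/eqP; rewrite eq_le Vmono//= -subr_le0.
  apply: le_trans (ler_norm _) _.
  rewrite -(subrr (0 : R)).
  apply: (@derive_dist_le R V u (cst 0) (fun=> 0)) => // t /t0 ->.
  by rewrite normr0.
have Va x : x <= a -> V x = V a.
  by move=> xa; apply: Vcst => // t /andP[_ ta]; apply: uout; left.
have Vb x : b <= x -> V x = V b.
  by move=> bx; apply/esym/Vcst => // t /andP[tb _]; apply: uout; right.
(* Equality would force the monotone [V] to be constant on the interval, hence [u] to vanish at its
   midpoint. *)
have Vab : V a < V b.
  rewrite lt_neqAle Vmono ?ltW// andbT; apply/eqP => VaVb.
  pose c := (a + b) / 2.
  have cab : a < c < b by rewrite /c; lra.
  have := up _ cab; suff -> : u c = 0 by rewrite ltxx.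
  have [_ <-] := Vu c.
  apply: derive_val; apply: (@near_eq_is_derive _ _ _ (cst (V a))).
  move: cab => /andP[ac cb].
  near=> t; apply/eqP; rewrite eq_le Vmono/=; last first.
    by near: t; apply: filterS (lt_nbhsr ac) => ?; exact: ltW.
  by rewrite VaVb Vmono//; near: t; apply: filterS (lt_nbhsl cb) => ?;
    exact: ltW.
pose Z := V b - V a; have Z0 : 0 < Z by rewrite subr_gt0.
have Zne : Z != 0 by rewrite gt_eqF.
exists ((Z^-1)%:C *: phi), (fun x => Z^-1 * (V x - V a)); split.
- move=> x; have := @has_cderiv_real R (Z^-1 *: (V - cst (V a))) (Z^-1 *: (u x -
    0)) 1 x.
  rewrite mulr1 subr0 -[_%:C *: phi]/((Z^-1)%:C *: phi) => H.
  have := H _; rewrite (_ : (_%:C *: phi : schwartz R) x = (Z^-1 *: u x)%:C);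
    last first.
    by rewrite -[LHS]/((Z^-1)%:C * phi x) phiu -rmorphM.
  under eq_fun do rewrite mulr1 /=.
  apply; apply: is_deriveZ; rewrite -[u x]subr0; apply: is_deriveB.
- by move=> x xa; rewrite Va// subrr mulr0.
- by move=> x bx; rewrite Vb// mulVf.
- move=> x; apply/andP; split.
    apply: mulr_ge0; first by rewrite invr_ge0 ltW.
    by rewrite subr_ge0; have [/Va->//|/ltW/Vmono] := leP x a.
  rewrite ler_pdivrMl// mulr1 lerD2r.
  by have [/Vmono|/ltW/Vb->] := leP x b.
- by move=> x xab; rewrite -[LHS]/((Z^-1)%:C * phi x) phiu uout// mulr0.
Unshelve. all: by end_near. Qed.

End bump.

(** * Extension of bounded functionals *)

Section limits.
Context {R : realType}.

Lemma ler_addeps_nat (a b c : R) : (forall n, a <= b + c / n.+1%:R) -> a <= b.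
Proof.
move=> abc; rewrite leNgt; apply/negP => ba.
pose n := Num.truncn (`|c| / (a - b)).
have := abc n; rewrite -lerBlDl leNgt => /negP; apply.
rewrite ltr_pdivrMr// mulrC -ltr_pdivrMr ?subr_gt0//.
apply: le_lt_trans (truncnS_gt _).
by apply: ler_wpM2r; [rewrite invr_ge0 subr_ge0 ltW|exact: ler_norm].
Qed.

Lemma normc_le_addeps (z : R[i]) (c : R) :
  (forall n, normc z <= c / n.+1%:R) -> z = 0.
Proof.
move=> zc; apply/eqP; rewrite -normc_eq0 eq_le normc_ge0 andbT.
by apply: (@ler_addeps_nat _ _ c) => n; rewrite add0r.
Qed.

(** Completeness with an explicit error: the intervals of centre [u i] and radius [e i] meet
    pairwise, so the supremum of their left ends lies in all of them. *)
Lemma complete_real (T : Type) (t0 : T) (u e : T -> R) :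
  (forall i j, `|u i - u j| <= e i + e j) -> exists l, forall i, `|u i - l|
    <= e i.
Proof.
move=> ue; pose A := [set u i - e i | i in [set: T]].
have Aub j : ubound A (u j + e j).
  by move=> _ [i _ <-]; have := ue i j; rewrite ler_norml => /andP[]; lra.
exists (sup A) => i; rewrite ler_norml; apply/andP; split.
  rewrite lerBrDl lerBlDr; apply: ge_sup (Aub i).
  by exists (u t0 - e t0); exists t0.
suff : u i - e i <= sup A by lra.
by apply: ub_le_sup; [exists (u i + e i); exact: Aub|exists i].
Qed.

Lemma complete_complex (T : Type) (t0 : T) (u : T -> R[i]) (e : T -> R) :
  (forall i j, normc (u i - u j) <= e i + e j) ->
  exists l, forall i, normc (u i - l) <= 2 * e i.
Proof.
move=> ue.
have [|a ua] := @complete_real T t0 (fun i => complex.Re (u i)) e.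
  by move=> i j; rewrite -ReB; apply: le_trans (Re_le_normc _) (ue i j).
have [|b ub] := @complete_real T t0 (fun i => complex.Im (u i)) e.
  by move=> i j; rewrite -ImB; apply: le_trans (Im_le_normc _) (ue i j).
exists (a +i* b) => i; apply: le_trans (normc_le_ReIm _) _.
by rewrite ReB ImB mulrDl !mul1r lerD.
Qed.

End limits.

Section eidelheit.
Context {R : realType} {V : lmodType R[i]} (p : V -> R).
Context (pD : forall x y, p (x + y) <= p x + p y).
Context (pZ : forall c x, p (c *: x) <= normc c * p x).
Context (p0 : forall x, 0 <= p x).

Definition lin_form (g : V -> R[i]) := forall c x y, g (c *: x + y) =
  c * g x + g y.

(** Subspaces are predicates on one fixed space, so that the induction in [extend_many] can shrink
    them to kernels. *)
Definition lin_closed (D : V -> Prop) :=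
  D 0 /\ forall c x y, D x -> D y -> D (c *: x + y).

Lemma lin_form0 g : lin_form g -> g 0 = 0.
Proof. by move=> gl; have := gl (-1) 0 0;
  rewrite scaler0 addr0 mulN1r addNr. Qed.

Lemma lin_formZ g c x : lin_form g -> g (c *: x) = c * g x.
Proof. by move=> gl; rewrite -[c *: x]addr0 gl lin_form0// addr0. Qed.

Lemma lin_formB g x c y : lin_form g -> g (x - c *: y) = g x - c * g y.
Proof. by move=> gl; rewrite addrC -scaleNr gl mulNr addrC. Qed.

Lemma seminormB x c y : p (x - c *: y) <= p x + normc c * p y.
Proof. by rewrite -scaleNr (le_trans (pD _ _))// lerD2l -(normc_opp c) pZ. Qed.

(** If [h] is p-bounded on [D], then so is the projection to its kernel along any [e] with
    [h e != 0], and [b = g e / h e] works. If not, vectors of [h]-value 1 and small seminorm correct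
    any [x] into the kernel at small cost, and the constant [C] survives. *)
Lemma extend_one D g h C : lin_closed D -> lin_form g -> lin_form h -> 0 <= C ->
  (forall x, D x -> h x = 0 -> normc (g x) <= C * p x) ->
  exists b C', 0 <= C' /\ forall x, D x -> normc (g x - b * h x) <= C' * p x.
Proof.
move=> [D0 DL] gl hl C0 gC.
have DB x c y : D x -> D y -> D (x - c *: y).
  by move=> Dx Dy; rewrite addrC -scaleNr; exact: DL.
have DZ c x : D x -> D (c *: x) by move=> Dx; rewrite -[c *: x]addr0; exact: DL.
have [[K hK]|hunb] := pselect (exists K, forall x, D x -> normc (h x)
  <= K * p x).
  have [[e [De he]]|h0] := pselect (exists e, D e /\ h e != 0); last first.
    exists 0, C; split=> // x Dx; rewrite mul0r subr0; apply: gC => //.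
    by apply/eqP/negPn/negP => hx; apply: h0; exists x.
  exists (g e / h e), (C * (1 + `|K| * normc (h e)^-1 * p e)); split.
    by rewrite mulr_ge0// addr_ge0// !mulr_ge0// normc_ge0.
  move=> x Dx; pose y := x - (h x / h e) *: e.
  have -> : g x - g e / h e * h x = g y by rewrite lin_formB//; ring.
  have hy : h y = 0 by rewrite lin_formB// divfK// subrr.
  apply: le_trans (gC _ (DB _ _ _ Dx De) hy) _.
  rewrite -mulrA ler_wpM2l// (le_trans (seminormB _ _ _))// mulrDl mul1r lerD2l.
  rewrite normcM normcV.
  have -> : `|K| * (normc (h e))^-1 * p e * p x =
      `|K| * p x * ((normc (h e))^-1 * p e) by ring.
  rewrite -mulrA; apply: ler_wpM2r.
    by apply: mulr_ge0 => //; rewrite invr_ge0 normc_ge0.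
  by apply: le_trans (hK x Dx) _; apply: ler_wpM2r => //; exact: ler_norm.
(* [h] is unbounded: [b] is the limit of [g] along vectors of [h]-value 1 whose
   seminorm tends to 0. *)
have ex n : exists e, [/\ D e, h e = 1 & p e <= n.+1%:R^-1].
  apply: contrapT => hn; apply: hunb; exists n.+1%:R => x Dx.
  rewrite leNgt; apply/negP => hx.
  have hx0 : 0 < normc (h x) by apply: le_lt_trans hx; rewrite mulr_ge0.
  have hxn0 : h x != 0 by rewrite -normc_eq0 gt_eqF.
  apply: hn; exists ((h x)^-1 *: x); split; first exact: DZ.
    by rewrite lin_formZ// mulVf.
  apply: le_trans (pZ _ _) _; rewrite normcV ler_pdivrMl//.
  by rewrite ler_pdivlMr// mulrC ltW.
have [e eP] := choice ex.
have [|l gl'] := @complete_complex R nat 0%N (fun n => g (e n)) (fun n => C *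
  n.+1%:R^-1).
  move=> i j; have [Di hi pi] := eP i; have [Dj hj pj] := eP j.
  rewrite -[g (e j)]mul1r -lin_formB//.
  have h0 : h (e i - 1 *: e j) = 0 by rewrite lin_formB// hi hj mulr1 subrr.
  apply: le_trans (gC _ (DB _ _ _ Di Dj) h0) _.
  rewrite -mulrDr ler_wpM2l// (le_trans (seminormB _ _ _))//.
  by rewrite normc1 mul1r lerD.
exists l, C; split=> // x Dx.
apply: (@ler_addeps_nat _ _ _ (3 * C * normc (h x))) => n.
have [Dn hn pn] := eP n.
have -> : g x - l * h x = g (x - h x *: e n) + h x * (g (e n) - l).
  by rewrite lin_formB//; ring.
have h0 : h (x - h x *: e n) = 0 by rewrite lin_formB// hn mulr1 subrr.
apply: le_trans (normc_le_add _ _) _; rewrite normcM.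
have H1 := gC _ (DB _ (h x) _ Dx Dn) h0.
have H2 : C * p (x - h x *: e n) <= C * (p x + normc (h x) * n.+1%:R^-1).
  rewrite ler_wpM2l// (le_trans (seminormB _ _ _))// lerD2l ler_wpM2l//.
  exact: normc_ge0.
have H3 : normc (h x) * normc (g (e n) - l)
  <= normc (h x) * (2 * (C * n.+1%:R^-1)).
  by rewrite ler_wpM2l// normc_ge0.
apply: le_trans (lerD (le_trans H1 H2) H3) _.
by rewrite le_eqVlt; apply/orP; left; apply/eqP; ring.
Qed.

(** Induction on [m] with [D] generalised: the hypothesis is applied on the kernel of [h m] in [D],
    and [extend_one] leads back to [D]. *)
Lemma extend_many (h : nat -> V -> R[i]) m D g C : lin_closed D -> lin_form g ->
  (forall i, lin_form (h i)) -> 0 <= C ->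
  (forall x, D x -> (forall i, (i < m)%N -> h i x = 0) -> normc (g x)
    <= C * p x) ->
  exists (b : nat -> R[i]) C', 0 <= C' /\
    forall x, D x -> normc (g x - \sum_(i < m) b i * h i x) <= C' * p x.
Proof.
move=> Dl gl hl; elim: m D Dl C => [|m IHm] D Dl C C0 gC.
  by exists (fun=> 0), C; split=> // x Dx; rewrite big_ord0 subr0; exact: gC.
have [D0 DL] := Dl.
have D'l : lin_closed (fun x => D x /\ h m x = 0).
  split=> [|c x y [Dx hx] [Dy hy]]; first by split=> //; exact: lin_form0.
  by split; [exact: DL|rewrite hl hx hy mulr0 addr0].
have [|b [C' [C'0 bC']]] := IHm _ D'l C C0.
  move=> x [Dx hx] hi; apply: gC => // i;
    rewrite ltnS leq_eqVlt => /orP[/eqP->//|].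
  exact: hi.
pose g' x := g x - \sum_(i < m) b i * h i x.
have g'l : lin_form g'.
  move=> c x y; rewrite /g' gl.
  under eq_bigr do rewrite hl mulrDr mulrCA.
  by rewrite big_split/= -mulr_sumr; ring.
have [|bm [C2 [C20 H]]] := extend_one Dl g'l (hl m) C'0.
  by move=> x Dx hx; exact: bC'.
exists (fun i => if i == m then bm else b i), C2; split=> // x Dx.
rewrite big_ord_recr/= eqxx opprD addrA.
under eq_bigr do rewrite ltn_eqF//.
exact: H.
Qed.

(** Without such an [x], rescaling shows that [h k] is at most [e^-1 * p] on the common kernel of
    the earlier [h i]. By [extend_many], some combination with coefficient 1 at [k] is then
    p-bounded on [D], against the hypothesis. *)
Lemma small_dual (h : nat -> V -> R[i]) k D : lin_closed D ->
  (forall i, lin_form (h i)) ->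
  (forall (b : nat -> R[i]) (C : R), 0 <= C ->
     (forall x, D x -> normc (\sum_(i < k.+1) b i * h i x) <= C * p x) -> b k =
       0) ->
  forall e, 0 < e -> exists x,
    [/\ D x, forall i, (i < k)%N -> h i x = 0, h k x = 1 & p x < e].
Proof.
move=> Dl hl hb e e0; apply: contrapT => hn.
have [D0 DL] := Dl.
have [||b [C [C0 bC]]] := @extend_many h k D (h k) (e^-1) Dl (hl k) hl.
- by rewrite invr_ge0 ltW.
- move=> x Dx hx; rewrite leNgt; apply/negP => px.
  have hk0 : 0 < normc (h k x) by apply: le_lt_trans px;
    rewrite mulr_ge0// invr_ge0 ltW.
  have hkn0 : h k x != 0 by rewrite -normc_eq0 gt_eqF.
  apply: hn; exists ((h k x)^-1 *: x); split.
  + by rewrite -[_ *: x]addr0; exact: DL.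
  + by move=> i ik; rewrite (lin_formZ _ _ (hl i)) (hx _ ik) mulr0.
  + by rewrite (lin_formZ _ _ (hl k)) mulVf.
  + by apply: le_lt_trans (pZ _ _) _; rewrite normcV ltr_pdivrMl// mulrC
      -ltr_pdivrMl.
have := hb (fun i => if i == k then 1 else - b i) C C0; rewrite eqxx => H.
have /eqP : 1 = 0 :> R[i]; last by rewrite oner_eq0.
apply: H => x Dx; rewrite big_ord_recr/= eqxx mul1r addrC.
under eq_bigr do rewrite ltn_eqF// mulNr.
by rewrite sumrN; exact: bC.
Qed.

End eidelheit.

(** * Primitives in S'_+ *)

Section supports.
Context {R : realType}.
Implicit Types (phi psi : schwartz R) (a b c x : R).

Definition supp_in a b (f : R -> R[i]^o) := forall x, x <= a \/ b <= x -> f x =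
  0.

Lemma supp_in_sub a b a' b' f : a' <= a -> b <= b' -> supp_in a b f ->
  supp_in a' b' f.
Proof.
move=> aa bb fs x [xa|bx]; apply: fs; first by left; exact: le_trans xa aa.
by right; exact: le_trans bb bx.
Qed.

Lemma supp_inE a b f x : supp_in a b f -> f x != 0 -> a <= x <= b.
Proof.
move=> fs; have [//|] := boolP (a <= x <= b).
rewrite negb_and -!ltNge => /orP H /negP[]; apply/eqP; apply: fs.
by case: H => /ltW; [left|right].
Qed.

Lemma fsupp_sub (f : R -> R[i]^o) (A : set R) : closed A ->
  (forall x, f x != 0 -> A x) -> fsupp f `<=` A.
Proof.
by move=> cA fA; rewrite [A](closure_id _).1//; apply: closureS.
Qed.

Lemma fsupp_in (f : R -> R[i]^o) x : f x != 0 -> fsupp f x.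
Proof. exact: (@subset_closure _ [set x | f x != 0]). Qed.

Lemma fsupp_pos_supp (f : R -> R[i]^o) x : fsupp f `<=` `[0, +oo[%classic ->
  x < 0 -> f x = 0.
Proof.
move=> f0 x0; apply/eqP/negPn/negP => fx.
have := f0 x (fsupp_in fx); rewrite /= in_itv/= andbT.
by rewrite leNgt x0.
Qed.

Lemma supp_in_fsupp_pos a b (f : R -> R[i]^o) : 0 <= a -> supp_in a b f ->
  fsupp f `<=` `[0, +oo[%classic.
Proof.
move=> a0 fs; apply: fsupp_sub; first exact: interval_closed.
move=> x /(supp_inE fs)/andP[ax _].
by rewrite /= in_itv/= andbT (le_trans a0).
Qed.

Lemma supp_in_test_on a b phi (U : set R) : supp_in a b phi ->
  `[a, b]%classic `<=` U -> test_on U phi.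
Proof.
move=> fs abU; have H : fsupp (phi : R -> R[i]^o) `<=` `[a, b]%classic.
  apply: fsupp_sub; first exact: interval_closed.
  by move=> x /(supp_inE fs); rewrite /= in_itv.
split; last exact: subset_trans H abU.
by apply: subclosed_compact H; [exact: closed_closure|exact: segment_compact].
Qed.

(** A compact support stays away from the boundary of [U]. The last clause records this on the left:
    on a subset of the positive half-line it gives 0 < a. *)
Lemma test_on_supp_in (U : set R) phi : test_on U phi -> open U ->
  (exists x, U x) ->
  exists a b, [/\ a <= b, supp_in a b phi, (exists2 a', U a' & a < a' ) &
    forall a0, (forall x, U x -> a0 < x) -> a0 < a].
Proof.
move=> [cs sU] oU [x0 Ux0].
have [x1 Ux1 x1l] : exists2 x1, U x1 & forall t, phi t != 0 -> x1 <= t.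
  have [[t ft]|nt] := pselect (exists t, fsupp (phi : R -> R[i]^o) t).
    have [c cA cmin] := compact_EVT_min (ex_intro _ t ft) cs
      (continuous_subspaceT (fun x => @cvg_id _ (nbhs x))).
    exists c; first by apply: sU; rewrite inE in cA.
    by move=> y fy; apply: cmin; rewrite inE; exact: fsupp_in.
  exists x0 => // t ft; exfalso; apply: nt; exists t; exact: fsupp_in.
have [x2 x2l] : exists x2, forall t, phi t != 0 -> t <= x2.
  have [[t ft]|nt] := pselect (exists t, fsupp (phi : R -> R[i]^o) t).
    have [c cA cmax] := compact_EVT_max (ex_intro _ t ft) cs
      (continuous_subspaceT (fun x => @cvg_id _ (nbhs x))).
    exists c => y fy; apply: cmax; rewrite inE; exact: fsupp_in.
  exists x0 => t ft; exfalso; apply: nt; exists t; exact: fsupp_in.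
have /nbhs_ballP[e e0 eU] := open_nbhs_nbhs (conj oU Ux1).
(* The left end is moved off the least point of the support, so that [phi] vanishes there too, but
   remains inside [U], so that strict lower bounds of [U] stay below it. *)
exists (x1 - e / 2), (Num.max x1 x2 + 1); split.
- have : x1 <= Num.max x1 x2 by rewrite le_max lexx.
  rewrite /= in e0; lra.
- move=> x xab; apply/eqP/negPn/negP => fx.
  have := x1l x fx; have := x2l x fx.
  have : x2 <= Num.max x1 x2 by rewrite le_max lexx orbT.
  by rewrite /= in e0; case: xab; lra.
- by exists x1 => //; rewrite /= in e0; lra.
- move=> a0 Ua0; apply: Ua0; apply: eU; rewrite -ball_normE /ball_/=.
  rewrite /= in e0; rewrite opprB addrC subrK ger0_norm; lra.
Qed.

Lemma primitive_supp a b phi : a <= b -> supp_in a b phi ->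
  exists (F : R -> R[i]^o) (c : R[i]),
  [/\ forall x, has_cderiv F x (phi x), forall x, x <= a -> F x = 0 &
      forall x, b <= x -> F x = c].
Proof.
move=> ab fs.
have [F [_ FF]] : exists F : R -> R[i]^o, F 0 = 0
  /\ forall x, has_cderiv F x (phi x).
  apply: complex_antiderivative => x.
  exact: has_cderiv_continuous (@schwartz_has_cderiv0 _ phi x).
exists (F - cst (F a)), (F b - F a); split.
- by move=> x; rewrite -[phi x]subr0; apply: has_cderivB => //;
    exact: has_cderiv_cst.
- move=> x xa; rewrite !fctE (@cderiv0_cst _ F x a) ?subrr// => t /andP[_ ta].
  by rewrite -(fs t); [exact: FF|left].
- move=> x bx; rewrite !fctE -(@cderiv0_cst _ F b x)// => t /andP[bt _].
  by rewrite -(fs t); [exact: FF|right].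
Qed.

Lemma schwartz_of_supp a b (F : R -> R[i]^o) phi :
  (forall x, has_cderiv F x (phi x)) -> supp_in a b F ->
  exists psi, (forall x, psi x = F x) /\ schwartz_derive psi = phi.
Proof.
move=> FF Fs; apply: schwartz_primitive_intro => // k.
apply: (@supported_bounded _ _ a b).
  by move=> x; exact: has_cderiv_continuous (FF x).
by move=> x; exact: supp_inE.
Qed.

Lemma schwartz_derive_has_cderiv phi x : has_cderiv phi x (schwartz_derive phi
  x).
Proof. exact: (@schwartz_has_cderiv0 R phi x). Qed.

End supports.

(** * Decay of primitives of Schwartz functions *)

Section primitives.
Context {R : realType}.
Implicit Types (phi psi : schwartz R) (x : R).

(** The arctangent is a bounded primitive of the majorant, so [F] has a limit [l] at -oo. To the
    left of a point x <= 0 one has |t| >= |x|, and the weight |x|^k may be replaced by |t|^k in the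
    bound of the derivative. *)
Lemma left_primitive_decay (f F : R -> R[i]^o) (A : nat -> R) :
  (forall x, has_cderiv F x (f x)) -> F 0 = 0 ->
  (forall k x, `|x| ^+ k * normc (f x) <= A k / (1 + x ^+ 2)) ->
  exists l : R[i], forall k x, x <= 0 ->
    `|x| ^+ k * normc (F x - l) <= 2 * pi * A k.
Proof.
move=> Ff F0 fA.
have sq (t : R) : 0 < 1 + t ^+ 2 by rewrite ltr_wpDr// sqr_ge0.
have A0 k : 0 <= A k.
  have := fA k 0; rewrite expr0n /= addr0 divr1; apply: le_trans.
  by rewrite mulr_ge0 ?exprn_ge0// normc_ge0.
have atd (k : nat) (t : R) : is_derive t 1 (fun t => A k * atan t) (A k / (1 + t
  ^+ 2)).
  have : is_derive t 1 (A k *: (atan : R -> R)) (A k *: (1 + t ^+ 2)^-1).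
    exact: is_deriveZ.
  by [].
have dist y x : y <= x -> normc (F x - F y) <= 2 * A 0%N * (atan x - atan y).
  move=> yx; rewrite -mulrA [A 0%N * _]mulrBr.
  apply: (@cderiv_dist_le R F f (fun t => A 0%N * atan t) (fun t => A 0%N / (1 +
    t ^+ 2))) => // t _.
  by have := fA 0%N t; rewrite mul1r.
have distk k y x : y <= x -> x <= 0 ->
    `|x| ^+ k * normc (F x - F y) <= 2 * A k * (atan x - atan y).
  move=> yx x0; rewrite -normrX -normc_real -normcM mulrBr.
  have H : normc ((x ^+ k)%:C * F x - (x ^+ k)%:C * F y) <=
      2 * (A k * atan x - A k * atan y).
    apply: (@cderiv_dist_le R (fun t => (x ^+ k)%:C * F t)
      (fun t => (x ^+ k)%:C * f t) (fun t => A k * atan t)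
      (fun t => A k / (1 + t ^+ 2)) y x yx) => t /andP[yt tx].
    - exact: (has_cderivZ (x ^+ k)%:C (Ff t)).
    - rewrite normcM normc_real normrX; apply: le_trans (fA k t).
      rewrite ler_wpM2r ?normc_ge0// lerXn2r ?nnegrE//.
      by rewrite !ler0_norm ?lerN2// (le_trans tx).
  by apply: le_trans H _; rewrite -mulrBr mulrA.
have atanNy e : 0 < e -> forall x, exists y : R, y <= x /\ atan y + pi / 2 < e.
  move=> e0 x; have [y [yx ye]] : exists y : R, - x <= y /\ pi / 2 - atan y < e.
    have /cvgrPdist_lt/(_ e e0) H := @cvgy_atan R.
    near (+oo : set_system R) => y; exists y; split.
      near: y; apply: nbhs_pinfty_ge; exact: num_real.
    have : `|pi / 2 - atan y| < e by near: y.
    by apply: le_lt_trans; exact: ler_norm.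
  by exists (- y); rewrite atanN lerNl; split => //; lra.
have [|l lF] := @complete_complex R R 0 F (fun x => 2 * A 0%N * (atan x + pi /
  2)).
  move=> i j; have ap t := @atan_gtNpi2 R t.
  have A2 : 0 <= 2 * A 0%N by rewrite mulr_ge0.
  wlog ij : i j / i <= j.
    move=> W; have [/W//|/ltW/W H] := leP i j.
    by rewrite normc_distC [leRHS]addrC.
  rewrite normc_distC; apply: le_trans (dist _ _ ij) _;
    rewrite -mulrDr ler_wpM2l//.
  by have := ap i; have := ap j; lra.
exists l => k x x0; apply/ler_addgt0Pr => e e0.
(* [K] majorises the factor of [atan y + pi / 2] in the error of replacing [l] by [F y]; the added 1
   makes it invertible. *)
pose K := `|x| ^+ k * (2 * (2 * A 0%N)) + 1.
have K0 : 0 < K by rewrite ltr_wpDl// !mulr_ge0// exprn_ge0.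
have [y [yx ye]] := atanNy (e / K) (divr_gt0 e0 K0) x.
apply: le_trans (_ : `|x| ^+ k * normc (F x - F y) + `|x| ^+ k * normc (F y - l)
  <= _).
  by rewrite -mulrDr ler_wpM2l ?exprn_ge0// normc_dist_trans.
apply: lerD.
  apply: le_trans (distk k y x yx x0) _.
  rewrite mulrAC ler_wpM2r//.
  by have := @atan_gtNpi2 R y; have := @atan_ltpi2 R x; lra.
apply: le_trans (_ : `|x| ^+ k * (2 * (2 * A 0%N * (atan y + pi / 2))) <= _).
  by rewrite ler_wpM2l ?exprn_ge0// lF.
have -> : `|x| ^+ k * (2 * (2 * A 0%N * (atan y + pi / 2))) =
  (K - 1) * (atan y + pi / 2) by rewrite /K; ring.
apply: le_trans (_ : K * (atan y + pi / 2) <= _).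
  rewrite ler_wpM2r//; last by rewrite gerBl.
  by have := @atan_gtNpi2 R y; lra.
by rewrite mulrC -ler_pdivlMr// ltW.
Unshelve. all: by end_near. Qed.

End primitives.

Section tempered_primitive.
Context {R : realType}.
Implicit Types (phi psi rho : schwartz R) (x : R).

Lemma has_cderiv_neg (f : R -> R[i]^o) (x : R) (l : R[i]) :
  has_cderiv f (- x) l ->
  has_cderiv (fun t => f (- t)) x (- l).
Proof.
move=> /has_cderivP[fr fi].
have dN : is_derive x 1 (fun t : R => - t) (- 1) by exact: (is_deriveNid x (1 :
  R)).
have dr := @is_derive1_comp R (fun t => complex.Re (f t)) (fun t => - t) x _ _
  fr dN.
have di := @is_derive1_comp R (fun t => complex.Im (f t)) (fun t => - t) x _ _
  fi dN.
apply/has_cderivP; split.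
  apply: is_derive_eq dr _; by case: l {fr fi di} => a b /=; rewrite mulrN1.
by apply: is_derive_eq di _; case: l {fr fi dr} => a b /=; rewrite mulrN1.
Qed.

(** The two spare powers of x turn a bound on |x|^k |phi| into one by a multiple of 1 / (1 +
    x^2). *)
Definition decay_weight k phi : R :=
  schwartz_seminorm k 0%N phi + schwartz_seminorm k.+2 0%N phi.

Lemma decay_weight_ge0 k phi : 0 <= decay_weight k phi.
Proof. by rewrite addr_ge0 ?schwartz_seminorm_ge0. Qed.

Lemma decay_weightP k phi (x : R) :
  `|x| ^+ k * normc (phi x) <= decay_weight k phi / (1 + x ^+ 2).
Proof.
rewrite ler_pdivlMr ?ltr_wpDr// ?sqr_ge0// mulrDr mulr1 lerD//.
  exact: (@schwartz_seminorm_ge R phi k 0%N x).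
rewrite -(real_normK (num_real x)) mulrAC -exprD addn2.
exact: (@schwartz_seminorm_ge R phi k.+2 0%N x).
Qed.

Lemma decay_weight_le_norm k n phi : (k < n)%N ->
  decay_weight k phi <= 2 * schwartz_norm n.+2 phi.
Proof.
move=> kn; rewrite mulrDl mul1r lerD// schwartz_norm_ge//.
by rewrite (leq_trans kn)// -addn2 leq_addr.
Qed.

Lemma primitive_decay phi (F : R -> R[i]^o) :
  (forall x, has_cderiv F x (phi x)) -> F 0 = 0 ->
  exists l r : R[i],
   (forall k x, x <= 0 -> `|x| ^+ k * normc (F x - l)
     <= 2 * pi * decay_weight k phi) /\
   (forall k x, 0 <= x -> `|x| ^+ k * normc (F x - r)
     <= 2 * pi * decay_weight k phi).
Proof.
move=> FF F0.
have [l lF] := left_primitive_decay FF F0 (fun k x => @decay_weightP k phi x).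
have [||k x|r rF] := @left_primitive_decay R (fun x => - phi (- x)) (fun x => F
  (- x))
   (decay_weight^~ phi).
- by move=> x; apply: has_cderiv_neg.
- by rewrite oppr0.
- by rewrite normc_opp -normrN -sqrrN; exact: decay_weightP.
exists l, r; split => // k x x0; have := rF k (- x).
by rewrite opprK normrN; apply; rewrite oppr_le0.
Qed.

Context (a b : R) (rho : schwartz R) (S : R -> R).
Context (rhoS : forall x, has_cderiv (fun t => (S t)%:C : R[i]^o) x (rho x)).
Context (Sa : forall x, x <= a -> S x = 0) (Sb : forall x, b <= x -> S x = 1).
Context (S01 : forall x, 0 <= S x <= 1).

(** Here [psi - c S] is constant; decay at -oo, where S = 0, kills the constant, and decay at +oo,
    where S = 1, kills [c]. This uniqueness is what makes the primitive chosen later depend linearly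
    on the test function. *)
Lemma schwartz_step_uniq psi (c : R[i]) :
  schwartz_derive psi = c *: rho -> psi = 0 /\ c = 0.
Proof.
move=> psiE.
have D x : has_cderiv (schwartz_val psi - (c *: (fun t => (S t)%:C :
  R[i]^o))) x 0.
  have := has_cderivB (schwartz_derive_has_cderiv psi x) (has_cderivZ c (rhoS
    x)).
  by rewrite psiE subrr.
have [M psiM] := schwartz_bounded psi 1%N 0%N.
have small (z : R[i]) : (forall n : nat, exists x, n.+1%:R <= `|x| /\ psi x =
  z) -> z = 0.
  move=> zP; apply: (@normc_le_addeps R _ M) => n.
  have [x [nx <-]] := zP n; rewrite ler_pdivlMr// mulrC.
  apply: le_trans (psiM x); rewrite expr1 ler_wpM2r//.
  exact: normc_ge0.
pose z := psi a.
have E x : psi x - c * (S x)%:C = z.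
  have := @cderiv0_cstT R _ x a D; rewrite !fctE => ->.
  by rewrite -[_ *: _]/(c * (S a)%:C) Sa// mulr0 subr0.
have z0 : z = 0.
  apply: small => n; exists (Num.min a (- n.+1%:R)); split.
    rewrite ler_normr; apply/orP; right; rewrite lerNr.
    by rewrite ge_min lexx orbT.
  rewrite -(E (Num.min a (- n.+1%:R))) Sa ?mulr0 ?subr0//.
  by rewrite ge_min lexx.
have c0 : c = 0.
  apply: small => n; exists (Num.max b n.+1%:R); split.
    by rewrite ler_normr le_max lexx orbT.
  have := E (Num.max b n.+1%:R); rewrite z0 Sb ?mulr1;
    last by rewrite le_max lexx.
  by move/eqP; rewrite subr_eq0 => /eqP.
split=> //; apply: schwartz_ext => x.
by have := E x; rewrite z0 c0 mul0r subr0.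
Qed.

(** Let l and r be the limits of a primitive F of phi at the two ends. Then c = r - l is the
    integral of phi, and psi = F - l - c S decays on both sides. The step contributes an extra term
    only between 0 and [a], or between 0 and [b], where |x| is below |a| + |b| + 1. *)
Lemma schwartz_step_primitive : exists K : R, 0 <= K /\ forall phi,
  exists psi (c : R[i]), [/\ schwartz_derive psi = phi - c *: rho,
    normc c <= K * decay_weight 0 phi &
    forall k x, `|x| ^+ k * normc (psi x) <=
      K * (decay_weight k phi + (`|a| + `|b| + 1) ^+ k * decay_weight 0 phi)].
Proof.
pose P : R := 2 * pi; have P0 : 0 <= P by rewrite mulr_ge0// pi_ge0.
exists (4 * P); split => [|phi]; first by rewrite mulr_ge0.
have [F [F0 FF]] : exists F : R -> R[i]^o, F 0 = 0
  /\ forall x, has_cderiv F x (phi x).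
  apply: complex_antiderivative => x.
  exact: has_cderiv_continuous (@schwartz_has_cderiv0 _ phi x).
have [l [r [lF rF]]] := primitive_decay FF F0.
pose c := r - l.
have lb : normc l <= P * decay_weight 0 phi.
  by have := lF 0%N 0 (lexx _); rewrite mul1r F0 sub0r normc_opp.
have rb : normc r <= P * decay_weight 0 phi.
  by have := rF 0%N 0 (lexx _); rewrite mul1r F0 sub0r normc_opp.
have cb : normc c <= 2 * P * decay_weight 0 phi.
  by apply: le_trans (normc_le_sub _ _) _; lra.
pose G : R -> R[i]^o := F - cst l - (c *: (fun t => (S t)%:C : R[i]^o)).
have GG x : has_cderiv G x ((phi - c *: rho : schwartz R) x).
  have := has_cderivB (has_cderivB (FF x) (has_cderiv_cst l x)) (has_cderivZ c
    (rhoS x)).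
  by rewrite subr0.
have w0 := decay_weight_ge0 0 phi.
pose T := `|a| + `|b| + 1.
have T0 : 0 <= T by rewrite !addr_ge0.
have Pw0 : 0 <= 2 * P * decay_weight 0 phi.
  by apply: mulr_ge0 => //; apply: mulr_ge0.
have Gk k x : `|x| ^+ k * normc (G x) <=
    4 * P * (decay_weight k phi + T ^+ k * decay_weight 0 phi).
  have wk := decay_weight_ge0 k phi.
  have Tk : 0 <= T ^+ k by rewrite exprn_ge0.
  have Gx : G x = F x - l - c * (S x)%:C by [].
  have [x0|x0] := leP x 0.
    have : `|x| ^+ k * normc (c * (S x)%:C)
      <= T ^+ k * (2 * P * decay_weight 0 phi).
      have [xa|ax] := leP x a.
        by rewrite Sa// mulr0 normc0 mulr0 mulr_ge0.
      apply: ler_pM; rewrite ?exprn_ge0 ?normc_ge0//.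
        rewrite lerXn2r ?nnegrE// /T.
        rewrite ler0_norm//; have := ler_norm (- a); rewrite normrN.
        by have := normr_ge0 b; lra.
      rewrite normcM normc_real; apply: le_trans cb.
      by rewrite ler_piMr ?normc_ge0//; have /andP[s0 s1] := S01 x;
        rewrite ger0_norm.
    have := lF k x x0 => H1 H2; rewrite Gx.
    apply: le_trans (_ : `|x| ^+ k * normc (F x - l) + `|x| ^+ k * normc (c * (S
      x)%:C) <= _).
      by rewrite -mulrDr ler_wpM2l ?exprn_ge0// normc_le_sub.
    apply: le_trans (lerD H1 H2) _; rewrite -/P.
    have Q1 : 0 <= P * decay_weight k phi by rewrite mulr_ge0.
    have Q2 : 0 <= P * (T ^+ k * decay_weight 0 phi)
      by rewrite (mulr_ge0 P0)// mulr_ge0.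
    rewrite -subr_ge0; have := addr_ge0 (mulr_ge0 (ler0n R 3) Q1) (mulr_ge0
      (ler0n R 2) Q2).
    by congr (_ <= _); ring.
  have : `|x| ^+ k * normc (c * (1 - S x)%:C)
    <= T ^+ k * (2 * P * decay_weight 0 phi).
    have [bx|xb] := leP b x.
      by rewrite Sb// subrr mulr0 normc0 mulr0 mulr_ge0.
    apply: ler_pM; rewrite ?exprn_ge0 ?normc_ge0//.
      rewrite lerXn2r ?nnegrE// /T.
      rewrite gtr0_norm//; have := ler_norm b.
      by have := normr_ge0 a; lra.
    rewrite normcM normc_real; apply: le_trans cb.
    by rewrite ler_piMr ?normc_ge0//; have /andP[s0 s1] := S01 x;
      rewrite ger0_norm; lra.
  have := rF k x (ltW x0) => H1 H2.
  have -> : G x = (F x - r) + c * (1 - S x)%:C.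
    by rewrite Gx /c rmorphB/=; ring.
  apply: le_trans (_ : `|x| ^+ k * normc (F x - r) + `|x| ^+ k * normc (c * (1 -
    S x)%:C) <= _).
    by rewrite -mulrDr ler_wpM2l ?exprn_ge0// normc_le_add.
  apply: le_trans (lerD H1 H2) _; rewrite -/P.
  have Q1 : 0 <= P * decay_weight k phi by rewrite mulr_ge0.
  have Q2 : 0 <= P * (T ^+ k * decay_weight 0 phi)
    by rewrite (mulr_ge0 P0)// mulr_ge0.
  rewrite -subr_ge0; have := addr_ge0 (mulr_ge0 (ler0n R 3) Q1) (mulr_ge0 (ler0n
    R 2) Q2).
  by congr (_ <= _); ring.
have [|psi [psiG psi']] := schwartz_primitive_intro GG.
  by move=> k; eexists; exact: Gk.
exists psi, c; split=> //; last by move=> k x; rewrite psiG; exact: Gk.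
apply: le_trans cb _; rewrite ler_wpM2r//; lra.
Qed.

End tempered_primitive.

Section tempered_primitive_exists.
Context {R : realType}.
Implicit Types (phi psi : schwartz R) (u v : schwartz R -> R[i]^o).

Lemma schwartz_deriveZD (c : R[i]) phi psi :
  schwartz_derive (c *: phi + psi) = c *: schwartz_derive phi + schwartz_derive
    psi.
Proof.
by apply: schwartz_ext => x; exact: (@vderiven_schwartzZD R c phi psi 1%N x).
Qed.

Lemma schwartz_deriveB phi psi :
  schwartz_derive (phi - psi) = schwartz_derive phi - schwartz_derive psi.
Proof. by rewrite addrC -scaleN1r schwartz_deriveZD scaleN1r addrC. Qed.

(** [J] and [I] are obtained by choice, but [char] determines them from the equation they satisfy;
    linearity and J(phi') = phi, that is v' = u, follow. [I] is the integral, and the last clause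
    evaluates it on functions whose primitive is constant near both ends. *)
Lemma tempered_primitive_integral u : tempered u ->
  exists v I, [/\ tempered v, dderive v = u, tempered I, dderive I = (fun=> 0) &
    forall phi a b (F : R -> R[i]^o) (c : R[i]),
      (forall x, has_cderiv F x (phi x)) -> (forall x, x <= a -> F x = 0) ->
      (forall x, b <= x -> F x = c) -> I phi = c].
Proof.
move=> tu; have [rho [S [rhoS Sa Sb S01 _]]] := @mollifier_exists R 0 1 ltr01.
have uniq := @schwartz_step_uniq R 0 1 rho S rhoS Sa Sb.
have [K [K0 KP]] := @schwartz_step_primitive R 0 1 rho S rhoS Sa Sb S01.
have exJ : forall phi : schwartz R, exists pc : schwartz R * R[i],
    [/\ schwartz_derive pc.1 = phi - pc.2 *: rho,
    normc pc.2 <= K * decay_weight 0 phi &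
    forall k (x : R), `|x| ^+ k * normc (pc.1 x) <=
      K * (decay_weight k phi +
        (`|0 : R| + `|1 : R| + 1) ^+ k * decay_weight 0 phi)].
  by move=> phi; have [psi [c H]] := KP phi; exists (psi, c).
have [Jc JcP] := choice exJ.
pose J phi := (Jc phi).1; pose I phi : R[i]^o := (Jc phi).2.
have JE phi : schwartz_derive (J phi) = phi - I phi *: rho
  by have [] := JcP phi.
have char phi psi (c : R[i]) : schwartz_derive psi = phi - c *: rho -> J phi =
  psi /\ I phi = c.
  move=> psiE; have [] := uniq (J phi - psi) (c - I phi).
    by rewrite schwartz_deriveB JE psiE opprB addrCA addrAC subrr sub0r scalerBl
      addrC.
  by move/eqP; rewrite subr_eq0 => /eqP -> /eqP; rewrite subr_eq0 => /eqP ->.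
have JIL (c : R[i]) phi psi : J (c *: phi + psi) = c *: J phi + J psi /\
    I (c *: phi + psi) = c * I phi + I psi.
  apply: char; rewrite schwartz_deriveZD !JE scalerBr scalerA scalerDl.
  by rewrite opprD addrACA.
have Jd phi : J (schwartz_derive phi) = phi /\ I (schwartz_derive phi) = 0.
  by apply: char; rewrite scale0r subr0.
have Ib phi : normc (I phi) <= K * decay_weight 0 phi by have [] := JcP phi.
have tI : tempered I.
  split; first by move=> c phi psi; have [_ ->] := JIL c phi psi.
  exists 3%N, (K * 2) => phi; apply: le_trans (Ib phi) _.
  by rewrite -mulrA ler_wpM2l// (@decay_weight_le_norm R 0 1).
(* The power of 2 comes from |0| + |1| + 1 and serves the order 0. Derivatives of positive order are
   those of [phi - I phi *: rho], which accounts for the norm of [rho]. *)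
have JI phi n : schwartz_norm n (J phi) <=
    (n * n)%:R * ((2 * K * (1 + 2 ^+ n) + 1 + 2 * K * schwartz_norm n rho) *
      schwartz_norm n.+2 phi).
  apply: schwartz_norm_le => k m x kn mn.
  set Nphi := schwartz_norm n.+2 phi; have N0 : 0 <= Nphi
    by exact: schwartz_norm_ge0.
  set Nrho := schwartz_norm n rho; have Nr0 : 0 <= Nrho
    by exact: schwartz_norm_ge0.
  have n0 : (0 < n)%N by exact: leq_ltn_trans kn.
  have dk : decay_weight k phi <= 2 * Nphi by exact: decay_weight_le_norm.
  have d0 : decay_weight 0 phi <= 2 * Nphi by exact: decay_weight_le_norm.
  have p2 : (2 : R) ^+ k <= 2 ^+ n by rewrite ler_eXn2l ?ltr1n// ltnW.
  case: m mn => [_|m mn].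
    have [_ _ /(_ k x) H] := JcP phi; apply: le_trans H _.
    rewrite normr0 normr1 add0r -[1 + 1]/2%:R.
    apply: le_trans (_ : K * (2 * Nphi + 2 ^+ n * (2 * Nphi)) <= _).
      rewrite ler_wpM2l// lerD//; apply: ler_pM => //.
      exact: decay_weight_ge0.
    rewrite -subr_ge0; have H : 0 <= (1 + 2 * K * Nrho) * Nphi.
      by rewrite mulr_ge0// addr_ge0// !mulr_ge0.
    by move: H; congr (_ <= _); ring.
  rewrite -vderiven_schwartz_derive JE addrC -scaleNr vderiven_schwartzZD.
  apply: le_trans (_ : `|x| ^+ k * (normc (I phi) * normc (vderiven m rho x)) +
     `|x| ^+ k * normc (vderiven m phi x) <= _).
    rewrite -mulrDr ler_wpM2l ?exprn_ge0// (le_trans (normc_le_add _ _))//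
      normcM.
    by rewrite normc_opp.
  have H1 : `|x| ^+ k * normc (vderiven m phi x) <= Nphi.
    apply: schwartz_norm_ge_at; first by rewrite (leq_trans kn)// -addn2
      leq_addr.
    by rewrite (leq_trans (ltnW mn))// -addn2 leq_addr.
  have H2 : `|x| ^+ k * (normc (I phi) * normc (vderiven m rho x))
    <= K * (2 * Nphi) * Nrho.
    rewrite mulrCA; apply: ler_pM; rewrite ?normc_ge0 ?mulr_ge0 ?normc_ge0
      ?exprn_ge0//.
      by apply: le_trans (Ib phi) _; rewrite ler_wpM2l.
    by apply: schwartz_norm_ge_at => //; exact: ltnW.
  apply: le_trans (lerD H2 H1) _.
  rewrite -subr_ge0; have H : 0 <= (2 * K * (1 + 2 ^+ n)) * Nphi.
    by rewrite !mulr_ge0// addr_ge0// exprn_ge0.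
  by move: H; congr (_ <= _); ring.
have [n [M [M0 uM]]] := tempered_bound tu.
exists (fun phi => - u (J phi)), I; split.
- split.
    move=> c phi psi; have [-> _] := JIL c phi psi.
    by rewrite tempered_linD// tempered_linZ// opprD scalerN.
  eexists n.+2, _ => phi; rewrite normc_opp; apply: le_trans (uM _) _.
  apply: le_trans (ler_wpM2l M0 (JI phi n)) _.
  by rewrite !mulrA.
- by apply/funext => phi; rewrite /dderive opprK; have [-> _] := Jd phi.
- exact: tI.
- by apply/funext => phi; rewrite /dderive; have [_ ->] := Jd phi;
    rewrite oppr0.
- move=> phi a b F c FF Fa Fb.
  have GG x : has_cderiv (F - (c *: (fun t => (S t)%:C : R[i]^o))) x
      ((phi - c *: rho : schwartz R) x).
    exact: has_cderivB (FF x) (has_cderivZ c (rhoS x)).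
  have [|psi [_ psiE]] := @schwartz_of_supp R (Num.min a 0) (Num.max b 1) _ _
    GG.
    move=> x xab; rewrite !fctE -[_ *: _]/(c * (S x)%:C); case: xab => H.
      rewrite Fa ?Sa ?mulr0 ?subr0// (le_trans H)// ge_min lexx ?orbT//.
    rewrite Fb ?Sb ?mulr1 ?subrr// (le_trans _ H)// le_max lexx ?orbT//.
  by have [] := char phi psi c psiE.
Qed.

End tempered_primitive_exists.

Section tempered_pos.
Context {R : realType}.
Implicit Types (phi psi : schwartz R) (u v : schwartz R -> R[i]^o).

Lemma temperedZD (c : R[i]) u v : tempered u -> tempered v ->
  tempered (c *: u + v).
Proof.
move=> tu tv; split.
  move=> k phi psi; rewrite !fctE !tempered_linD// !tempered_linZ//.
  rewrite /GRing.scale/=; ring.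
have [n [M [M0 uM]]] := tempered_bound tu;
  have [n' [M' [M'0 vM]]] := tempered_bound tv.
exists (maxn n n'), (normc c * M + M') => phi.
rewrite !fctE; apply: le_trans (normc_le_add _ _) _.
rewrite -[_ *: _]/(c * u phi) normcM mulrDl -mulrA lerD//.
  rewrite ler_wpM2l ?normc_ge0// (le_trans (uM _))// ler_wpM2l//.
  by apply: schwartz_norm_mono; rewrite leq_maxl.
rewrite (le_trans (vM _))// ler_wpM2l//.
by apply: schwartz_norm_mono; rewrite leq_maxr.
Qed.

Lemma tempered0 : tempered (fun _ : schwartz R => 0 : R[i]^o).
Proof.
split; first by move=> c phi psi; rewrite scaler0 addr0.
by exists 0%N, 0 => phi; rewrite mul0r normc0.
Qed.

Lemma dsuppNP u x : ~ dsupp u x <-> exists U, [/\ open U, dvanish u U & U x].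
Proof.
split=> [|[U [oU uU Ux]]]; last by move=> H; apply: H; exists U.
by move=> /contrapT[U [oU uU] Ux]; exists U.
Qed.

Lemma dsupp_posP u : dsupp u `<=` `[0, +oo[%classic <->
  forall x, x < 0 -> exists U, [/\ open U, dvanish u U & U x].
Proof.
split=> [H x x0|H x].
  by apply/dsuppNP => /H; rewrite /= in_itv/= andbT leNgt x0.
by move=> ux; rewrite /= in_itv/= andbT leNgt; apply/negP => /H/dsuppNP.
Qed.

Lemma test_onS (U U' : set R) phi : U `<=` U' -> test_on U phi ->
  test_on U' phi.
Proof. by move=> UU' [cphi phiU]; split=> //; exact: subset_trans UU'. Qed.

Lemma tempered_posZD (c : R[i]) u v : tempered_pos u -> tempered_pos v ->
  tempered_pos (c *: u + v).
Proof.
move=> [tu su] [tv sv]; split; first exact: temperedZD.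
apply/dsupp_posP => x x0.
have [U [oU uU Ux]] := (dsupp_posP u).1 su x x0.
have [U' [oU' vU' U'x]] := (dsupp_posP v).1 sv x x0.
exists (U `&` U'); split => //; first exact: openI.
move=> phi phiU; rewrite !fctE uU ?vU'; first by rewrite scaler0 addr0.
  by apply: test_onS phiU; exact: subIsetr.
by apply: test_onS phiU; exact: subIsetl.
Qed.

Lemma tempered_pos0 : tempered_pos (0 : schwartz R -> R[i]^o).
Proof.
split; first exact: tempered0.
by apply/dsupp_posP => x x0; exists setT; split => //; exact: openT.
Qed.

Lemma tempered_pos_sum (N : nat) (b : nat -> R[i]) (f : nat -> schwartz R ->
  R[i]^o) :
  (forall j, tempered_pos (f j)) -> tempered_pos (\sum_(n < N) b n *: f n).
Proof.
move=> fp; elim: N => [|N IHN]; first by rewrite big_ord0; exact: tempered_pos0.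
by rewrite big_ord_recr/= addrC; exact: tempered_posZD.
Qed.

Lemma dderiveZD (c : R[i]) u v : dderive (c *: u + v) =
  c *: dderive u + dderive v.
Proof. by apply/funext => phi; rewrite /dderive !fctE opprD scalerN. Qed.

Lemma iter_dderive_sum (m N : nat) (b : nat -> R[i]) (f g : nat -> schwartz R ->
  R[i]^o) :
  (forall j, iter m dderive (g j) = f j) ->
  iter m dderive (\sum_(n < N) b n *: g n) = \sum_(n < N) b n *: f n.
Proof.
have iterZD (c : R[i]) u v k : iter k dderive (c *: u + v) =
    c *: iter k dderive u + iter k dderive v.
  by elim: k => [//|k IHk]; rewrite !iterS IHk dderiveZD.
have iter0 k : iter k dderive (0 : schwartz R -> R[i]^o) = 0.
  by elim: k => [//|k IHk]; rewrite iterS IHk; apply/funext => phi;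
    rewrite /dderive oppr0.
move=> gf; elim: N => [|N IHN]; first by rewrite !big_ord0.
by rewrite !big_ord_recr/= addrC iterZD gf IHN addrC.
Qed.

Lemma test_on_itv_supp (a b : R) phi : test_on `]a, b[%classic phi ->
  supp_in a b phi.
Proof.
move=> [_ phis] x xab; apply/eqP/negPn/negP => fx.
have := phis x (fsupp_in fx); rewrite /= in_itv/= => /andP[ax xb].
by case: xab; rewrite leNgt ?ax ?xb.
Qed.

Lemma tempered_pos_primitive u : tempered_pos u ->
  exists v, tempered_pos v /\ dderive v = u.
Proof.
move=> [tu /dsupp_posP su].
have [v [I [tv vu tI dI Ic]]] := tempered_primitive_integral tu.
pose loc x e (c : R[i]) := forall phi, supp_in (x - e) (x + e) phi -> v phi =
  c * I phi.
have locP x : exists c, x < 0 -> exists2 e, 0 < e & loc x e c.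
  have [x0|x0] := ltP x 0; last by exists 0.
  have [U [oU uU Ux]] := su x x0.
  have /nbhs_ballP[e /= e0 eU] := open_nbhs_nbhs (conj oU Ux).
  have e20 : 0 < e / 2 by rewrite divr_gt0.
  have xe : x - e / 2 < x + e / 2 by lra.
  have [rho [S [rhoS Sa Sb _ rs]]] := mollifier_exists xe.
  (* With c the integral of phi, the function phi - c rho is the derivative of a test function
     supported near x, where [u] vanishes; so v(phi) = c v(rho). *)
  exists (v rho) => _; exists (e / 2) => // phi phis.
  have [F [c [FF Fa Fb]]] := primitive_supp (ltW xe) phis.
  rewrite (Ic phi _ _ F c FF Fa Fb).
  have GG y : has_cderiv (F - (c *: (fun t => (S t)%:C : R[i]^o))) y
      ((phi - c *: rho : schwartz R) y).
    exact: has_cderivB (FF y) (has_cderivZ c (rhoS y)).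
  have Gs : supp_in (x - e / 2) (x + e / 2) (F - (c *: (fun t => (S t)%:C :
    R[i]^o))).
    move=> y ye; rewrite !fctE -[_ *: _]/(c * (S y)%:C); case: ye => H.
      by rewrite Fa ?Sa ?mulr0 ?subr0.
    by rewrite Fb ?Sb ?mulr1 ?subrr.
  have [psi [psiG psiE]] := schwartz_of_supp GG Gs.
  have : u psi = 0.
    apply: uU; apply: supp_in_test_on (_ :
      supp_in (x - e / 2) (x + e / 2) psi) _.
      by move=> y /Gs; rewrite psiG.
    move=> y; rewrite /= in_itv/= => /andP[y1 y2]; apply: eU.
    by rewrite -ball_normE /ball_/= ltr_distlC; lra.
  rewrite -vu /dderive psiE tempered_linB// tempered_linZ// => /eqP.
  by rewrite oppr_eq0 subr_eq0 => /eqP ->; rewrite mulrC.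
have [c cP] := choice locP.
(* A mollifier supported in both intervals has integral 1, so [v] takes both constants on it. *)
have loc_uniq x e y e' : 0 < e -> 0 < e' -> `|y - x| < e ->
    loc x e (c x) -> loc y e' (c y) -> c y = c x.
  move=> e0 e'0 yx lx ly.
  have ab : Num.max (x - e) (y - e') < Num.min (x + e) (y + e').
    by rewrite gt_max !lt_min; move: yx; rewrite ltr_distlC => /andP[]; lra.
  have [rho [S [rhoS Sa Sb _ rs]]] := mollifier_exists ab.
  have I1 : I rho = 1 by apply: Ic rhoS _ _ => z; [move/Sa->|move/Sb->].
  have := lx rho _; rewrite I1 mulr1 => <-.
    rewrite -[LHS]mulr1 -I1; apply/esym; apply: ly.
    by apply: supp_in_sub rs; rewrite ?le_max ?ge_min lexx ?orbT.
  by apply: supp_in_sub rs; rewrite ?le_max ?ge_min lexx ?orbT.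
(* A locally constant function has derivative 0, so the mean value inequality takes the place of a
   connectedness argument. *)
have cd x : x < 0 -> has_cderiv (c : R -> R[i]^o) x 0.
  move=> x0; have [e e0 lx] := cP x x0.
  apply: (@has_cderiv_near R c (cst (c x))); last exact: has_cderiv_cst.
  apply/nbhs_ballP; exists (Num.min e (- x)).
    by rewrite /= lt_min e0 oppr_gt0.
  move=> y; rewrite -ball_normE /ball_/= lt_min => /andP[ye yx].
  have y0 : y < 0 by move: yx; rewrite ltr_distlC => /andP[]; lra.
  have [e' e'0 ly] := cP y y0.
  by apply: (loc_uniq x e y e') => //; rewrite distrC.
have cE x : x < 0 -> c x = c (- 1).
  move=> x0; have [H|/ltW H] := leP x (- 1).
    by apply: (@cderiv0_cst R c) => // t tx; apply: cd; lra.
  by apply/esym; apply: (@cderiv0_cst R c) => // t tx; apply: cd; lra.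
exists ((- c (- 1)) *: (I : schwartz R -> R[i]^o) + v); split.
  split; first exact: temperedZD.
  apply/dsupp_posP => x x0; have [e e0 lx] := cP x x0.
  exists `]x - e, x + e[%classic; split.
  - exact: interval_open.
  - move=> phi /test_on_itv_supp /lx; rewrite !fctE => ->; rewrite cE//.
    by rewrite -[_ *: _]/(- c (-1) * I phi) mulNr addNr.
  - by rewrite /= in_itv/=; lra.
rewrite dderiveZD dI vu; apply/funext => phi.
by rewrite !fctE scaler0 add0r.
Qed.

Lemma tempered_pos_iter_primitive m u : tempered_pos u ->
  exists v, tempered_pos v /\ iter m dderive v = u.
Proof.
move=> pu; elim: m => [|m [v [pv vu]]]; first by exists u.
have [w [pw wv]] := tempered_pos_primitive pv.
by exists w; split => //; rewrite iterSr wv.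
Qed.

Lemma dprimitiveP m u : tempered_pos u ->
  tempered_pos (dprimitive m u) /\ iter m dderive (dprimitive m u) = u.
Proof.
move=> /(tempered_pos_iter_primitive m)[v vP]; rewrite /dprimitive.
by case: xgetP => [w _ //|/(_ v)].
Qed.

End tempered_pos.

(** * Regularity of primitives of bounded functionals *)

Section primitive_bounds.
Context {R : realType}.
Implicit Types (phi psi : schwartz R) (u v g : schwartz R -> R[i]^o) (a b K M :
  R).

Lemma iter_schwartz_deriveZD m (c : R[i]) phi psi :
  iter m (@schwartz_derive R) (c *: phi + psi) =
  c *: iter m (@schwartz_derive R) phi + iter m (@schwartz_derive R) psi.
Proof. by elim: m => [//|m IHm]; rewrite !iterS IHm schwartz_deriveZD. Qed.

Lemma vderiven_supp a b phi r x : supp_in a b phi -> x < a \/ b < x ->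
  vderiven r phi x = 0.
Proof.
move=> phis; elim: r x => [|r IHr] x xab.
  by apply: phis; case: xab => /ltW; [left|right].
apply: has_cderiv_uniq (@schwartz_has_cderiv R phi r x) _.
apply: (@has_cderiv_near R _ (cst 0)); last exact: has_cderiv_cst.
case: xab => H.
  near=> t; apply: IHr; left; near: t; exact: lt_nbhsl.
near=> t; apply: IHr; right; near: t; exact: lt_nbhsr.
Unshelve. all: by end_near. Qed.

(* [K] bounds the antiderivative, a weaker quantity than the L^1 norm *)
Definition prim_bounded b K phi := supp_in 0 b phi /\
  exists F : R -> R[i]^o, [/\ forall x, has_cderiv F x (phi x),
    forall x, x <= 0 -> F x = 0 & forall x, normc (F x) <= K].

Lemma prim_bounded_ge0 b K phi : prim_bounded b K phi -> 0 <= K.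
Proof. by move=> [_ [F [_ _ FK]]]; apply: le_trans (FK 0);
  exact: normc_ge0. Qed.

(** The bound involves the length of the support and not [b]; this makes it small for differences of
    nearby mollifiers. *)
Lemma prim_bounded_of_sup s t b M phi : 0 <= s -> s <= t -> t <= b ->
  supp_in s t phi -> (forall x, normc (phi x) <= M) ->
  prim_bounded b (2 * M * (t - s)) phi.
Proof.
move=> s0 st tb phis phiM; split; first exact: supp_in_sub phis.
have [F [c [FF Fs Ft]]] := primitive_supp st phis.
have M0 : 0 <= M by apply: le_trans (phiM 0); exact: normc_ge0.
have K0 : 0 <= 2 * M * (t - s) by rewrite !mulr_ge0// subr_ge0.
have Fst x : s <= x <= t -> normc (F x) <= 2 * M * (t - s).
  move=> /andP[sx xt]; rewrite -[F x]subr0 -(Fs s (lexx _)).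
  apply: le_trans (cderiv_lipschitz sx (fun y _ => FF y) (fun y _ => phiM y)) _.
  by rewrite ler_wpM2l ?mulr_ge0// lerD2r.
exists F; split => [//|x x0|x]; first by apply: Fs; exact: le_trans s0.
have [xs|/ltW sx] := leP x s; first by rewrite Fs// normc0.
have [xt|/ltW tx] := leP x t; first by apply: Fst; rewrite sx xt.
by rewrite Ft// -(Ft t (lexx _)); apply: Fst; rewrite st lexx.
Qed.

Context (rho : schwartz R) (S : R -> R).
Context (rhoS : forall x, has_cderiv (fun t => (S t)%:C : R[i]^o) x (rho x)).
Context (Sa : forall x, x <= 0 -> S x = 0) (Sb : forall x, 1 <= x -> S x = 1).
Context (S01 : forall x, 0 <= S x <= 1).

(** Since psi = F - c S with c = F b, a bound on the antiderivative of [phi] becomes one on the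
    values of [psi]; returning to an antiderivative costs a factor of order [b]. *)
Lemma prim_bounded_step b K phi : 1 <= b -> prim_bounded b K phi ->
  exists psi (c : R[i]), [/\ schwartz_derive psi = phi - c *: rho,
    normc c <= K, forall x, normc (psi x) <= 2 * K &
    prim_bounded b (4 * b * K) psi].
Proof.
move=> b1 [phis [F [FF F0 FK]]]; pose c := F b.
have Fb x : b <= x -> F x = c.
  move=> bx; rewrite /c -(@cderiv0_cst _ F b x)// => t /andP[bt _].
  by rewrite -(phis t); [exact: FF|right].
have GG x : has_cderiv (F - (c *: (fun t => (S t)%:C : R[i]^o))) x
    ((phi - c *: rho : schwartz R) x).
  exact: has_cderivB (FF x) (has_cderivZ c (rhoS x)).
have Gs : supp_in 0 b (F - (c *: (fun t => (S t)%:C : R[i]^o))).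
  move=> x xb; rewrite !fctE -[_ *: _]/(c * (S x)%:C); case: xb => H.
    by rewrite F0// Sa// mulr0 subr0.
  by rewrite Fb// Sb ?mulr1 ?subrr// (le_trans b1).
have [psi [psiG psiE]] := schwartz_of_supp GG Gs.
have psis : supp_in 0 b psi by move=> x /Gs; rewrite psiG.
have psib x : normc (psi x) <= 2 * K.
  rewrite psiG !fctE -[_ *: _]/(c * (S x)%:C) (le_trans (normc_le_sub _ _))//.
  rewrite mulrDl !mul1r lerD// normcM normc_real.
  have /andP[s0 s1] := S01 x; rewrite ger0_norm//.
  by apply: le_trans (FK b); rewrite ler_piMr ?normc_ge0.
exists psi, c; split=> //; first exact: FK.
have := @prim_bounded_of_sup 0 b b (2 * K) psi (lexx _) (le_trans ler01 b1)
  (lexx _) psis psib.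
by rewrite subr0 (_ : 2 * (2 * K) * b = 4 * b * K)//; ring.
Qed.

(** Each step replaces phi by psi' + c rho. In the factor 4 + N + V, the 4 comes from
    [prim_bounded_step], [N] bounds the derivatives of [rho], and [V] bounds [v] on the discarded
    term. *)
Lemma prim_bounded_iter v m : tempered v -> exists B : R, 0 <= B /\
  forall phi b K, 1 <= b -> prim_bounded b K phi -> exists psi,
  [/\ prim_bounded b (B * b ^+ m * K) psi,
      forall r x, (r < m)%N -> normc (vderiven r psi x) <= B * b ^+ m * K &
      normc (v phi - v (iter m (@schwartz_derive R) psi)) <= B * b ^+ m * K].
Proof.
move=> tv; elim: m => [|m [B [B0 IHm]]].
  exists 1; split=> // phi b K b1 pb; exists phi.
  rewrite expr0 !mul1r subrr normc0; split=> //; exact: prim_bounded_ge0 pb.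
pose N := schwartz_norm m.+1 rho; pose V := normc (v (iter m (@schwartz_derive
  R) rho)).
have N0 : 0 <= N by exact: schwartz_norm_ge0.
have V0 : 0 <= V by exact: normc_ge0.
exists (B * (4 + N + V)); split=> [|phi b K b1 pb].
  by rewrite mulr_ge0// !addr_ge0.
have [psi0 [pb0 d0 v0]] := IHm phi b K b1 pb.
set K0 := B * b ^+ m * K in pb0 d0 v0.
have K00 : 0 <= K0 := prim_bounded_ge0 pb0.
have b0 : 0 <= b by exact: le_trans b1.
have [psi [c [psiE cK psib pbp]]] := prim_bounded_step b1 pb0.
have -> : B * (4 + N + V) * b ^+ m.+1 * K = (4 + N + V) * b * K0.
  by rewrite /K0 exprS; ring.
have bK : K0 <= b * K0 by rewrite ler_peMl.
have bK0 : 0 <= b * K0 by rewrite mulr_ge0.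
have big (s : R) : s <= 4 + N + V -> s * K0 <= (4 + N + V) * b * K0.
  move=> sN; apply: le_trans (ler_wpM2r K00 sN) _.
  by rewrite -mulrA ler_wpM2l// !addr_ge0.
exists psi; split.
- have [psis [F [FF F0 FK]]] := pbp; split=> //; exists F; split=> // x.
  apply: le_trans (FK x) _; rewrite -!mulrA; apply: ler_wpM2r => //.
  by rewrite -addrA lerDl addr_ge0.
- move=> [|r] x rm; first by apply: le_trans (psib x) _; apply: big; lra.
  rewrite -vderiven_schwartz_derive psiE addrC -scaleNr vderiven_schwartzZD.
  apply: le_trans (normc_le_add _ _) _; rewrite normcM normc_opp.
  apply: le_trans (_ : (N + 1) * K0 <= _); last by apply: big; lra.
  rewrite mulrDl mul1r [N * _]mulrC; apply: lerD; last exact: d0.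
  apply: ler_pM; rewrite ?normc_ge0//.
  have := @schwartz_norm_ge_at R m.+1 rho 0%N r x (ltn0Sn _) (ltnW rm).
  by rewrite mul1r.
- rewrite iterSr psiE.
  have -> : iter m (@schwartz_derive R) (psi0 - c *: rho) =
      - c *: iter m (@schwartz_derive R) rho + iter m (@schwartz_derive R) psi0.
    by rewrite addrC -scaleNr iter_schwartz_deriveZD.
  rewrite tempered_linD// tempered_linZ// mulNr opprD opprK addrCA.
  apply: le_trans (normc_le_add _ _) _; rewrite normcM -/V.
  apply: le_trans (_ : (V + 1) * K0 <= _); last by apply: big; lra.
  rewrite mulrDl mul1r [V * _]mulrC; apply: lerD => //.
  by apply: ler_wpM2r.
Qed.

(** Up to sign v(psi^(m)) is g(psi), to which the norm bound applies. On [0,b] the weights |x|^k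
    with k < n are at most b^n, whence the exponent m + n; as n <= m, the derivatives of [psi] that
    occur are among those controlled. *)
Lemma prim_bounded_estimate v g m n C : tempered v -> iter m dderive v = g ->
  0 <= C -> (n <= m)%N ->
  (forall phi, fsupp (phi : R -> R[i]^o) `<=` `[0, +oo[%classic ->
    normc (g phi) <= C * schwartz_norm n phi) ->
  exists C', 0 <= C' /\ forall phi b K, 1 <= b -> prim_bounded b K phi ->
    normc (v phi) <= C' * b ^+ (m + n) * K.
Proof.
move=> tv vg C0 nm gC; have [B [B0 BP]] := prim_bounded_iter m tv.
exists (B + C * ((n * n)%:R * B)); split.
  by rewrite addr_ge0// !mulr_ge0.
move=> phi b K b1 pb; have [psi [pbp d v0]] := BP phi b K b1 pb.
have b0 : 0 <= b by exact: le_trans b1.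
have K0 := prim_bounded_ge0 pb.
set K' := B * b ^+ m * K in pbp d v0.
have K'0 : 0 <= K' := prim_bounded_ge0 pbp.
have gpsi : normc (v (iter m (@schwartz_derive R) psi)) = normc (g psi).
  rewrite -vg dderive_iter normcM -[LHS]mul1r; congr (_ * _).
  by elim: (m) => [|k IHk]; rewrite ?expr0 ?normc1// exprS normcM normc_opp
    normc1 mul1r.
have [psis _] := pbp.
have gb : normc (g psi) <= C * ((n * n)%:R * (b ^+ n * K')).
  apply: le_trans (gC _ (supp_in_fsupp_pos (lexx _) psis)) _.
  apply: ler_wpM2l => //; apply: schwartz_norm_le => k r x kn rn.
  have [->|nz] := eqVneq (vderiven r psi x) 0.
    by rewrite normc0 mulr0 mulr_ge0// exprn_ge0.
  have xb : `|x| <= b.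
    have [x0|x0] := leP 0 x; last first.
      by move: nz; rewrite (vderiven_supp _ psis) ?eqxx//; left.
    rewrite ger0_norm// leNgt; apply/negP => bx.
    by move: nz; rewrite (vderiven_supp _ psis) ?eqxx//; right.
  apply: ler_pM; rewrite ?normc_ge0 ?exprn_ge0//; last exact/d/(leq_trans rn).
  apply: le_trans (_ : b ^+ k <= _); first by rewrite lerXn2r ?nnegrE.
  by apply: ler_weXn2l => //; exact: ltnW.
rewrite -[v phi](subrK (v (iter m (@schwartz_derive R) psi))).
apply: le_trans (normc_le_add _ _) _; rewrite gpsi.
apply: le_trans (lerD v0 gb) _; rewrite mulrDl mulrDl; apply: lerD.
  rewrite /K' exprD; apply: ler_wpM2r => //.
  by rewrite ler_wpM2l// ler_peMr ?exprn_ge0// exprn_ege1.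
by rewrite le_eqVlt; apply/orP; left; apply/eqP; rewrite /K' exprD; ring.
Qed.

End primitive_bounds.

(** * Recovering a density from the values on mollifiers *)

Section density.
Context {R : realType}.
Implicit Types (phi psi : schwartz R) (a b x y e : R).
Context (v : schwartz R -> R[i]^o) (tv : tempered v) (C : R) (C0 : 0 <= C) (A :
  nat).
Context (vC : forall phi b K, 1 <= b -> prim_bounded b K phi ->
  normc (v phi) <= C * b ^+ A * K).
Context (v'C : forall phi b K, 1 <= b -> prim_bounded b K phi ->
  normc (v (schwartz_derive phi)) <= C * b ^+ A * K).

(** The support lies to the right of [x], so that mollifiers at 0 still live on the half-line. *)
Definition mollifier x e (rS : schwartz R * (R -> R)) :=
  [/\ forall t, has_cderiv (fun t => (rS.2 t)%:C : R[i]^o) t (rS.1 t),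
      forall t, t <= x -> rS.2 t = 0, forall t, x + e <= t -> rS.2 t = 1,
      forall t, 0 <= rS.2 t <= 1 &
      supp_in x (x + e) rS.1].

Lemma mollifiers_exist : exists mol : R -> R -> schwartz R * (R -> R),
  forall x e, 0 < e -> mollifier x e (mol x e).
Proof.
have H (p : R * R) : exists rS, 0 < p.2 -> mollifier p.1 p.2 rS.
  have [e0|e0] := leP p.2 0; first by exists (0, fun=> 0).
  have [|r [S [H1 H2 H3 H4 H5]]] := @mollifier_exists R p.1 (p.1 + p.2).
    by rewrite ltrDl.
  by exists (r, S).
have [mol molP] := choice H.
by exists (fun x e => mol (x, e)) => x e; exact: (molP (x, e)).
Qed.

Context (mol : R -> R -> schwartz R * (R -> R)).
Context (molP : forall x e, 0 < e -> mollifier x e (mol x e)).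

Let L b := 4 * (C * b ^+ A).

Let L0 b : 0 <= b -> 0 <= L b.
Proof. by move=> b0; rewrite !mulr_ge0// exprn_ge0. Qed.

Let Lmono b b' : 0 <= b -> b <= b' -> L b <= L b'.
Proof.
move=> b0 bb; rewrite ler_wpM2l// ler_wpM2l// lerXn2r ?nnegrE//.
exact: le_trans bb.
Qed.

(** The difference of the mollifiers is the derivative of the difference of their steps. The latter
    is at most 1 in absolute value and vanishes outside an interval of length at most |x - y| + e +
    e', so the bound on v' applies. *)
Lemma mollifier_dist x y e e' b : 0 <= x -> 0 <= y -> 0 < e -> 0 < e' ->
  x + e <= b -> y + e' <= b -> 1 <= b ->
  normc (v (mol x e).1 - v (mol y e').1) <= L b * (`|x - y| + e + e').
Proof.
move=> x0 y0 e0 e'0 xb yb b1.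
have [r1 Sx Sxe S1 s1] := molP x e0; have [r2 Sy Sye S2 s2] := molP y e'0.
have GG t := has_cderivB (r1 t) (r2 t).
have Gs : supp_in (Num.min x y) (Num.max (x + e) (y + e'))
    ((fun t => ((mol x e).2 t)%:C : R[i]^o) - (fun t => ((mol y e').2 t)%:C :
      R[i]^o)).
  move=> t; rewrite !fctE => -[|]; rewrite ?le_min ?ge_max => /andP[H1 H2].
    by rewrite Sx// Sy// subrr.
  by rewrite Sxe// Sye// subrr.
have [psi [psiG psiE]] := @schwartz_of_supp R _ _ _ ((mol x e).1 - (mol y e').1)
  GG Gs.
rewrite -tempered_linB// -psiE.
have psi1 t : normc (psi t) <= 1.
  rewrite psiG !fctE -rmorphB normc_real/=.
  by have := S1 t; have := S2 t; rewrite ler_norml; lra.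
have mM : Num.min x y <= Num.max (x + e) (y + e').
  by rewrite ge_min le_max lerDl ltW.
have /v'C H : prim_bounded b (2 * 1 * (Num.max (x + e) (y + e') - Num.min x y))
  psi.
  apply: prim_bounded_of_sup => //.
  - by rewrite le_min x0.
  - by rewrite ge_max xb.
  - by move=> t /Gs; rewrite psiG.
apply: le_trans (H b1) _; rewrite mulr1 /L.
have b0 : 0 <= b by exact: le_trans b1.
have Cb : 0 <= C * b ^+ A by rewrite mulr_ge0// exprn_ge0.
have D : Num.max (x + e) (y + e') - Num.min x y <= `|x - y| + e + e'.
  rewrite lerBlDl; have := ler_norm (x - y); have := ler_norm (y - x).
  rewrite distrC => H1 H2; rewrite minEle maxEle.
  by case: ifP => _; case: ifP => _; lra.
have D0 : 0 <= `|x - y| + e + e' by have := normr_ge0 (x - y); lra.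
apply: le_trans (_ : C * b ^+ A * (2 * (`|x - y| + e + e')) <= _).
  by apply: ler_wpM2l => //; rewrite ler_wpM2l.
rewrite -subr_ge0; have := mulr_ge0 (ler0n R 2) (mulr_ge0 Cb D0).
by congr (_ <= _); ring.
Qed.

Lemma density_exists : exists h : R -> R[i],
  [/\ forall x e, 0 <= x -> 0 < e -> e <= 1 ->
        normc (v (mol x e).1 - h x) <= L (x + 1) * e,
      forall x y b, `|x| + 1 <= b -> `|y| + 1 <= b ->
        normc (h x - h y) <= L b * `|x - y| &
      forall x, normc (h x) <= 3 * L (`|x| + 1)].
Proof.
pose en (n : nat) : R := n.+1%:R^-1.
have en0 n : 0 < en n by rewrite invr_gt0.
have en1 n : en n <= 1 by rewrite invf_le1// ler1n.
(* The mollifiers are placed at |x|: this extends the density evenly to the whole line, where it is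
   continuous without an exception at 0. *)
have hx x : exists l, forall n, normc (v (mol `|x| (en n)).1 - l)
  <= 2 * (L (`|x| + 1) * en n).
  apply: (@complete_complex R nat 0%N (fun n => v (mol `|x| (en n)).1) (fun n =>
    L (`|x| + 1) * en n)) => i j.
  have := @mollifier_dist `|x| `|x| (en i) (en j) (`|x| + 1);
    rewrite subrr normr0 add0r mulrDr.
  by apply => //; rewrite ?lerD2l ?lerDr.
have [h hP] := choice hx.
have h1 x e : 0 <= x -> 0 < e -> e <= 1 -> normc (v (mol x e).1 - h x)
  <= L (x + 1) * e.
  move=> x0 e0 e1; apply: (@ler_addeps_nat _ _ _ (3 * L (x + 1))) => n.
  have := hP x n; rewrite ger0_norm// => H.
  have D := @mollifier_dist x x e (en n) (x + 1) x0 x0 e0 (en0 n).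
  rewrite subrr normr0 add0r in D.
  apply: le_trans (normc_dist_trans (v (mol x (en n)).1) _ _) _.
  apply: le_trans (lerD (D _ _ _) H) _; rewrite ?lerD2l ?lerDr//.
  by rewrite le_eqVlt; apply/orP; left; apply/eqP; rewrite /en; ring.
exists h; split => // [x y b xb yb|x].
  apply: (@ler_addeps_nat _ _ _ (6 * L b)) => n.
  have b1 : 1 <= b by apply: le_trans xb; rewrite lerDr.
  have Hx := hP x n; have Hy := hP y n.
  have D := @mollifier_dist `|x| `|y| (en n) (en n) b (normr_ge0 _) (normr_ge0
    _) (en0 n) (en0 n).
  have {}D := D (le_trans (lerD (lexx `|x|) (en1 n)) xb) (le_trans (lerD (lexx
    `|y|) (en1 n)) yb) b1.
  have Lx : L (`|x| + 1) <= L b by apply: Lmono.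
  have Ly : L (`|y| + 1) <= L b by apply: Lmono.
  have Lb : 0 <= L b by rewrite L0// (le_trans ler01).
  apply: le_trans (normc_dist_trans (v (mol `|x| (en n)).1) _ _) _.
  rewrite normc_distC.
  apply: le_trans (_ : _ <= 2 * (L b * en n) + (L b * (`|x - y| + en n + en n) +
    2 * (L b * en n))) _.
    apply: lerD.
      by apply: le_trans Hx _; rewrite ler_wpM2l// ler_wpM2r// ltW.
    apply: le_trans (normc_dist_trans (v (mol `|y| (en n)).1) _ _) _.
    apply: lerD; last by apply: le_trans Hy _;
      rewrite ler_wpM2l// ler_wpM2r// ltW.
    apply: le_trans D _; rewrite ler_wpM2l// !lerD2r.
    exact: ler_dist_dist.
  by rewrite le_eqVlt; apply/orP; left; apply/eqP; rewrite /en; ring.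
(* For growth, [h x] is compared with the mollifier of width [en 0 = 1], whose antiderivative is at
   most 1. *)
rewrite -[h x](subrK (v (mol `|x| (en 0%N)).1)).
have H := hP x 0%N; rewrite normc_distC in H.
have [r Sx Sxe S1 s] := molP `|x| (en0 0%N).
have b1 : 1 <= `|x| + 1 by rewrite lerDr.
have Lx : 0 <= L (`|x| + 1) by rewrite L0// (le_trans ler01).
have e1 : en 0%N = 1 by rewrite /en invr1.
have pb : prim_bounded (`|x| + 1) 1 (mol `|x| (en 0%N)).1.
  split; first by apply: supp_in_sub s => //; rewrite e1.
  exists (fun t => ((mol `|x| (en 0%N)).2 t)%:C); split => // t.
    by move=> t0; rewrite Sx// (le_trans t0).
  by rewrite normc_real ger0_norm; have /andP[] := S1 t.
rewrite [in X in _ <= X]e1 mulr1 in H.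
apply: le_trans (normc_le_add _ _) _.
apply: le_trans (lerD H (vC b1 pb)) _; rewrite mulr1 -subr_ge0.
have Cb : 0 <= 3 * (C * (`|x| + 1) ^+ A) by rewrite !mulr_ge0// exprn_ge0//
  (le_trans ler01).
by move: Cb; congr (_ <= _); rewrite /L; ring.
Qed.

(** A Riemann sum argument in which the integral of h phi is given through an antiderivative [Q], so
    that mean value inequalities do the work of integral estimates. *)
Lemma density_integral (h : R -> R[i]) :
  (forall x e, 0 <= x -> 0 < e -> e <= 1 ->
     normc (v (mol x e).1 - h x) <= L (x + 1) * e) ->
  (forall x y b, `|x| + 1 <= b -> `|y| + 1 <= b ->
     normc (h x - h y) <= L b * `|x - y|) ->
  forall phi b (Q : R -> R[i]^o), 1 <= b -> supp_in 0 b phi ->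
    (forall x, has_cderiv Q x (h x * phi x)) -> v phi = Q b - Q 0.
Proof.
move=> h1 h2 phi b Q b1 phis QQ.
have b0 : 0 <= b by exact: le_trans b1.
have [F [c0 [FF Fa Fb]]] := primitive_supp b0 phis.
have [M phiM] : exists M, forall x, normc (phi x) <= M.
  by have [M H] := schwartz_bounded phi 0%N 0%N; exists M => x; have := H x;
    rewrite mul1r.
have M0 : 0 <= M by apply: le_trans (phiM 0); exact: normc_ge0.
pose Lb := L (b + 1); have Lb0 : 0 <= Lb by rewrite L0// addr_ge0.
have Cb0 : 0 <= C * b ^+ A by rewrite mulr_ge0// exprn_ge0.
(* As [B] exceeds [b], cutting [0,b] into (n+1) B cells gives a step below 1/(n+1). *)
pose B := (Num.truncn b).+1; have Bb : b < B%:R by exact: truncnS_gt.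
have B0 : 0 < B%:R :> R by rewrite ltr0n.
apply/eqP; rewrite -subr_eq0; apply/eqP.
apply: (@normc_le_addeps R _ ((C * b ^+ A) * (8 * M * b) + 4 * Lb * M * b)) =>
  n.
(* On a subdivision of step [D], compare [phi] with the combination of the
   mollifiers of its cells with the same cell integrals: the difference is the
   derivative of a function of size O(D). *)
pose N := (n.+1 * B)%N; pose D : R := b / N%:R.
have N0 : 0 < N%:R :> R by rewrite ltr0n muln_gt0.
have D0 : 0 < D by rewrite divr_gt0// (lt_le_trans ltr01).
have DN : N%:R * D = b by rewrite /D mulrC divfK// gt_eqF.
have Dn : D <= n.+1%:R^-1.
  rewrite /D /N natrM invfM mulrCA mulrC ler_piMl ?invr_ge0//.
  by rewrite mulrC ler_pdivrMl// mulr1 ltW.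
have D1 : D <= 1 by apply: le_trans Dn _; rewrite invf_le1// ler1n.
pose t (i : nat) : R := i%:R * D.
have tS i : t i.+1 = t i + D by rewrite /t -addn1 natrD mulrDl mul1r.
have t0 i : 0 <= t i by rewrite mulr_ge0// ltW.
have tb i : (i < N)%N -> t i + D <= b.
  by move=> iN; rewrite -tS -DN /t ler_wpM2r ?ler_nat// ltW.
pose c i := F (t i.+1) - F (t i).
have cM i : normc (c i) <= 2 * M * D.
  have ti : t i <= t i.+1 by rewrite tS lerDl ltW.
  apply: le_trans (cderiv_lipschitz ti (fun y _ => FF y) (fun y _ => phiM y)) _.
  by rewrite tS addrAC subrr add0r.
have mP i := molP (t i) D0.
pose Sm i x : R := (mol (t i) D).2 x.
pose P k x : R[i] := \sum_(i < k) c i * (Sm i x)%:C.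
(* Each step function is completed within its cell, so [P k] agrees with [F] at the nodes up to
   [t k], and inside a cell both have moved by O(D). *)
have PP k : (forall x, x <= t k -> normc (F x - P k x) <= 4 * M * D) /\
    (forall x, t k <= x -> P k x = F (t k)).
  elim: k => [|k [IH1 IH2]].
    rewrite /t mul0r; split=> x x0; last by rewrite /P big_ord0 Fa.
    by rewrite /P big_ord0 Fa// subr0 normc0 mulr_ge0 ?mulr_ge0// ltW.
  have [_ S1 S2 S3 _] := mP k.
  split=> x xk; rewrite /P big_ord_recr/= -/(P k x); last first.
    rewrite IH2; last by apply: le_trans xk; rewrite tS lerDl ltW.
    by rewrite /Sm S2 -?tS// mulr1 /c addrC subrK.
  have [xk'|/ltW kx] := leP x (t k).
    by rewrite /Sm S1// mulr0 addr0; exact: IH1.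
  rewrite IH2// opprD addrA; apply: le_trans (normc_le_sub _ _) _.
  have H1 : normc (F x - F (t k)) <= 2 * M * D.
    apply: le_trans (cderiv_lipschitz kx (fun y _ => FF y) (fun y _ => phiM y))
      _.
    by rewrite ler_wpM2l ?mulr_ge0// lerBlDl -tS.
  have H2 : normc (c k * (Sm k x)%:C) <= 2 * M * D.
    apply: le_trans (cM k); rewrite normcM normc_real ler_piMr ?normc_ge0//.
    by have /andP[s0 s1] := S3 x; rewrite ger0_norm.
  by apply: le_trans (lerD H1 H2) _; rewrite le_eqVlt; apply/orP; left;
    apply/eqP; ring.
have tN : t N = b by [].
pose rhos := \sum_(i < N) c i *: (mol (t i) D).1.
have GG x : has_cderiv (F - P N) x ((phi - rhos : schwartz R) x).
  apply: has_cderivB; first exact: FF.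
  rewrite /P /rhos; elim: (N) => [|k IHk].
    rewrite big_ord0 (_ : (fun x => _) = cst 0); first exact: has_cderiv_cst.
    by apply/funext => y; rewrite big_ord0.
  rewrite big_ord_recr/= (_ : (fun x => _) =
    (fun x => \sum_(i < k) c i * (Sm i x)%:C) +
      (c k *: (fun x => (Sm k x)%:C : R[i]^o))); last first.
    by apply/funext => y; rewrite big_ord_recr.
  by apply: has_cderivD => //; apply: has_cderivZ; have [+ _ _ _ _] := mP k;
    apply.
have Gs : supp_in 0 b (F - P N).
  move=> x xb; rewrite !fctE; case: xb => H; last first.
    by have [_ ->] := PP N; rewrite ?tN// Fb// Fb// subrr.
  rewrite Fa// /P big1 ?subrr// => i _; rewrite /Sm.
  have [_ S1 _ _ _] := mP i; rewrite S1 ?mulr0//; exact: le_trans H (t0 i).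
have [psi [psiG psiE]] := schwartz_of_supp GG Gs.
have pb : prim_bounded b (2 * (4 * M * D) * (b - 0)) psi.
  apply: prim_bounded_of_sup => //; first by move=> x /Gs; rewrite psiG.
  move=> x; have [xb|bx] := leP x b.
    by rewrite psiG; have [/(_ x) H _] := PP N; apply: H; rewrite tN.
  rewrite psiG (Gs x (or_intror (ltW bx))) normc0.
  by apply: mulr_ge0; [apply: mulr_ge0|exact: ltW].
have V1 : normc (v phi - \sum_(i < N) c i * v (mol (t i) D).1)
  <= C * b ^+ A * (8 * M * b) * D.
  have -> : v phi - \sum_(i < N) c i * v (mol (t i) D).1 =
    v (schwartz_derive psi).
    rewrite psiE tempered_linB// tempered_lin_sum//; congr (_ - _).
    by apply: eq_bigr => i _; rewrite tempered_linZ.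
  apply: le_trans (v'C b1 pb) _; rewrite subr0.
  by rewrite le_eqVlt; apply/orP; left; apply/eqP; ring.
have V2 : normc (\sum_(i < N) c i * v (mol (t i) D).1 - (Q b - Q 0))
  <= 4 * Lb * M * b * D.
  have -> : Q b - Q 0 = \sum_(i < N) (Q (t i.+1) - Q (t i)).
    rewrite -tN (_ : 0 = t 0%N); last by rewrite /t mul0r.
    elim: (N) => [|k IHk]; first by rewrite big_ord0 subrr.
    by rewrite big_ord_recr/= -IHk; ring.
  rewrite -sumrB.
  (* On a cell [h] is frozen at [t i]. One error is that of [v] on the mollifier; the other is the
     increment of [Q - h (t i) *: F], whose derivative is (h - h(t i)) phi. *)
  have step i : (i < N)%N ->
      normc (c i * v (mol (t i) D).1 - (Q (t i.+1) - Q (t i)))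
        <= 4 * Lb * M * D * D.
    move=> iN; have ti1 : t i + 1 <= b + 1.
      by rewrite lerD2r; apply: le_trans (tb i iN); rewrite lerDl ltW.
    have -> : c i * v (mol (t i) D).1 - (Q (t i.+1) - Q (t i)) =
       c i * (v (mol (t i) D).1 - h (t i)) -
       ((Q - h (t i) *: F) (t i.+1) - (Q - h (t i) *: F) (t i)).
      by rewrite !fctE -![h (t i) *: _]/(h (t i) * _) /c; ring.
    apply: le_trans (normc_le_sub _ _) _.
    have H1 : normc (c i * (v (mol (t i) D).1 - h (t i)))
      <= 2 * M * D * (Lb * D).
      rewrite normcM; apply: ler_pM; rewrite ?normc_ge0//.
      apply: le_trans (h1 _ _ (t0 i) D0 D1) _; apply: ler_wpM2r;
        first exact: ltW.
      by apply: Lmono => //; rewrite addr_ge0.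
    have H2 : normc ((Q - h (t i) *: F) (t i.+1) - (Q - h (t i) *: F) (t i)) <=
        2 * (Lb * D * M) * (t i.+1 - t i).
      apply: (@cderiv_lipschitz R _ (fun y => h y * phi y - h (t i) * phi y)).
      - by rewrite tS lerDl ltW.
      - move=> y _; apply: has_cderivB; first exact: QQ.
        by apply: has_cderivZ; exact: FF.
      - move=> y /andP[y1 y2]; rewrite -mulrBl normcM; apply: ler_pM;
          rewrite ?normc_ge0//.
        have y0 : 0 <= y by apply: le_trans y1.
        have yb : y <= b by apply: le_trans y2 _; rewrite tS tb.
        have yb1 : `|y| + 1 <= b + 1 by rewrite ger0_norm// lerD2r.
        have tb1 : `|t i| + 1 <= b + 1 by rewrite ger0_norm.
        apply: le_trans (h2 y (t i) (b + 1) yb1 tb1) _; apply: ler_wpM2l => //.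
        by rewrite ger0_norm ?subr_ge0// lerBlDl -tS.
    apply: le_trans (lerD H1 H2) _; rewrite tS addrAC subrr add0r.
    by rewrite le_eqVlt; apply/orP; left; apply/eqP; ring.
  have : normc (\sum_(i < N) (c i * v (mol (t i) D).1 - (Q (t i.+1) - Q (t i))))
    <=
      \sum_(i < N) 4 * Lb * M * D * D.
    elim/big_ind2 : _ => [|x x' y y' H1 H2|i _]; first by rewrite normc0.
      by apply: le_trans (normc_le_add _ _) _; exact: lerD.
    exact: step.
  move/le_trans; apply; rewrite sumr_const card_ord -mulr_natr -DN.
  by rewrite le_eqVlt; apply/orP; left; apply/eqP; ring.
apply: le_trans (normc_dist_trans (\sum_(i < N) c i * v (mol (t i) D).1) _ _) _.
apply: le_trans (lerD V1 V2) _; rewrite -mulrDl; apply: ler_wpM2l => //.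
apply: addr_ge0; first by rewrite (mulr_ge0 Cb0)// mulr_ge0// mulr_ge0.
by rewrite mulr_ge0// mulr_ge0// mulr_ge0.
Qed.

End density.

Section local_density.
Context {R : realType}.
Implicit Types (phi psi : schwartz R) (u v g : schwartz R -> R[i]^o) (a b K M :
  R).

Lemma tempered_dderive v : tempered v -> tempered (dderive v).
Proof.
move=> tv; split=> [c phi psi|].
  by rewrite /dderive schwartz_deriveZD tempered_linD// tempered_linZ// opprD
    scalerN.
have [n [M [M0 vM]]] := tempered_bound tv.
exists n.+1, (M * (n * n)%:R) => phi; rewrite /dderive normc_opp
  -/(schwartz_norm n.+1 phi).
apply: le_trans (vM _) _; rewrite -mulrA; apply: ler_wpM2l => //.
apply: schwartz_norm_le => k m x kn mn; rewrite vderiven_schwartz_derive.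
by apply: schwartz_norm_ge_at; rewrite ?ltnS// ltnW.
Qed.

(** The estimate is applied to v as an m-primitive of [g] and to v' as an (m-1)-primitive, hence n <
    m. Since [v] may be any tempered m-primitive, the result covers both [dprimitive] of a sum and a
    sum of [dprimitive]s. *)
Lemma local_density v g m n C : tempered v -> iter m dderive v = g ->
  0 <= C -> (n < m)%N ->
  (forall phi, fsupp (phi : R -> R[i]^o) `<=` `[0, +oo[%classic ->
    normc (g phi) <= C * schwartz_norm n phi) ->
  exists (h : R -> R[i]^o) (C' : R), [/\ 0 <= C', continuous h,
    forall x, normc (h x) <= C' * (`|x| + 1) ^+ (m + n) &
    forall phi b (Q : R -> R[i]^o), 1 <= b -> supp_in 0 b phi ->
      (forall x, has_cderiv Q x (h x * phi x)) -> v phi = Q b - Q 0].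
Proof.
move=> tv vg C0; case: m vg => [//|m] vg nm gC.
have [rho [S [rhoS Sa Sb S01 _]]] := @mollifier_exists R 0 1 ltr01.
have [C1 [C10 vC1]] := prim_bounded_estimate rhoS Sa Sb S01 tv vg C0 (leqW nm)
  gC.
have v'g : iter m dderive (dderive v) = g by rewrite -iterSr.
have [C2 [C20 vC2]] := prim_bounded_estimate rhoS Sa Sb S01 (tempered_dderive
  tv) v'g C0 nm gC.
have C120 : 0 <= C1 + C2 by rewrite addr_ge0.
have vC phi b K : 1 <= b -> prim_bounded b K phi ->
    normc (v phi) <= (C1 + C2) * b ^+ (m.+1 + n) * K.
  move=> b1 pb; apply: le_trans (vC1 _ _ _ b1 pb) _.
  rewrite ler_wpM2r ?(prim_bounded_ge0 pb)// ler_wpM2r ?exprn_ge0 ?(le_trans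
    ler01)//.
  by rewrite lerDl.
have v'C phi b K : 1 <= b -> prim_bounded b K phi ->
    normc (v (schwartz_derive phi)) <= (C1 + C2) * b ^+ (m.+1 + n) * K.
  move=> b1 pb; have b0 : 0 <= b := le_trans ler01 b1.
  rewrite -normc_opp; apply: le_trans (vC2 _ _ _ b1 pb) _.
  rewrite ler_wpM2r ?(prim_bounded_ge0 pb)//; apply: ler_pM;
    rewrite ?exprn_ge0//.
    by rewrite lerDr.
  by apply: ler_weXn2l => //; rewrite addSn.
have [mol molP] := @mollifiers_exist R.
have [h [h1 h2 h3]] := density_exists tv C120 vC v'C molP.
exists h, (3 * (4 * (C1 + C2))); split.
- by rewrite !mulr_ge0.
- move=> x; apply/cvg_normcP => e e0.
  pose b := `|x| + 2; pose Lb := 4 * ((C1 + C2) * b ^+ (m.+1 + n)).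
  have Lb0 : 0 <= Lb by rewrite !mulr_ge0// exprn_ge0// addr_ge0.
  apply/nbhs_ballP; exists (Num.min 1 (e / (Lb + 1))).
    by rewrite /= lt_min ltr01 divr_gt0// ltr_wpDl.
  move=> y; rewrite /ball_/= lt_min => /andP[yx1 yxe].
  rewrite normc_distC; apply: le_lt_trans (h2 x y b _ _) _.
  + by rewrite /b lerD2l ler1n.
  + rewrite /b; have := ler_norm (`|y| - `|x|); have := ler_dist_dist y x.
    by rewrite [`|y - x|]distrC; lra.
  + rewrite ltr_pdivlMr ?ltr_wpDl// in yxe.
    apply: le_lt_trans yxe; rewrite mulrC ler_wpM2l// -/Lb; lra.
- by move=> x; apply: le_trans (h3 x) _; rewrite !mulrA.
- exact: (density_integral tv C120 v'C molP h1 h2).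
Qed.

(** [f] vanishes off [U] and off [a,b], so extending its restriction to either set by 0 returns [f],
    and the two integrals coincide. *)
Lemma has_cderiv_FTC2 (f Q : R -> R[i]^o) a b : a < b -> continuous f ->
  (forall x, has_cderiv Q x (f x)) -> (forall x, f x != 0 -> a <= x <= b) ->
  forall U : set R, (forall x, f x != 0 -> U x) ->
  cintegral U f = Q b - Q a.
Proof.
move=> ab cf Qf fab U fU.
have key (p q : R -> R) : continuous p -> (forall x :
  R, is_derive x 1 q (p x)) ->
    (forall x, p x != 0 -> f x != 0) ->
    (\int[lebesgue_measure]_(x in U) p x)%R = q b - q a.
  move=> cp qp pf.
  have E (D : set R) : (forall x, f x != 0 -> D x) -> p \_ D = p.
    move=> fD; apply/funext => x; rewrite patchE; case: ifPn => // xD.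
    apply/esym/eqP/negPn/negP => px; move/negP: xD; apply.
    by rewrite inE; apply: fD; exact: pf.
  rewrite Rintegral_mkcond E// -(E `[a, b]%classic); last first.
    by move=> x /fab; rewrite /= in_itv.
  rewrite -Rintegral_mkcond /Rintegral (@continuous_FTC2 _ p q)//.
  - exact: continuous_subspaceT.
  - have cq x : {for x, continuous q}.
      by have [d _] := qp x; apply/differentiable_continuous/derivable1_diffP.
    split.
    + by move=> x _; have [] := qp x.
    + exact: cvg_at_right_filter (cq a).
    + exact: cvg_at_left_filter (cq b).
  - by move=> x _; have [_] := qp x; rewrite derive1E.
rewrite /cintegral; apply: ReIm_inj => /=.
  rewrite ReB; apply: (key (fun x => complex.Re (f x)) (fun x => complex.Re (Q
    x))).
  - by move=> x; have /cvg_ReImP[] := cf x.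
  - by move=> x; have /has_cderivP[] := Qf x.
  - by move=> x; apply: contra => /eqP ->.
rewrite ImB; apply: (key (fun x => complex.Im (f x)) (fun x => complex.Im (Q
  x))).
- by move=> x; have /cvg_ReImP[] := cf x.
- by move=> x; have /has_cderivP[] := Qf x.
- by move=> x; apply: contra => /eqP ->.
Qed.

Lemma continuous_locally_integrable (U : set R) (p : R -> R) :
  open U -> continuous p -> locally_integrable U p.
Proof.
move=> oU cp; split=> //.
  by apply: measurable_realfun.open_continuous_measurable_fun => // x _;
    exact: cp.
move=> K KU cK; have /integrableP[_] : lebesgue_measure.-integrable K (EFin \o
  p).
  by apply: continuous_compact_integrable => //; exact: continuous_subspaceT.
exact.
Qed.

Lemma regular_on_density (U : set R) v (h : R -> R[i]^o) : open U ->
  (exists x, U x) -> U `<=` [set x | 0 < x] -> continuous h ->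
  (forall phi b (Q : R -> R[i]^o), 1 <= b -> supp_in 0 b phi ->
      (forall x, has_cderiv Q x (h x * phi x)) -> v phi = Q b - Q 0) ->
  regular_on U v h.
Proof.
move=> oU U0 Up ch vh; split.
  split; apply: continuous_locally_integrable => // x.
    by have /cvg_ReImP[] := ch x.
  by have /cvg_ReImP[] := ch x.
move=> phi phiU; have [a [b [ab phis _ a0]]] := test_on_supp_in phiU oU U0.
have {}a0 : 0 < a by apply: a0 => x /Up.
pose b' := Num.max b 1.
have phis' : supp_in 0 b' phi.
  by apply: supp_in_sub phis; [exact: ltW|rewrite le_max lexx].
have b'1 : 1 <= b' by rewrite le_max lexx orbT.
have cphi : continuous (phi : R -> R[i]^o).
  by move=> x; exact: has_cderiv_continuous (@schwartz_has_cderiv0 R phi x).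
have chphi : continuous (fun x => h x * phi x : R[i]^o).
  by move=> x; apply: (@cvgM _ _ _ _ h phi (h x) (phi x));
    [exact: ch|exact: cphi].
have [Q [_ QQ]] := complex_antiderivative chphi.
rewrite (vh phi b' Q)//; apply/esym; apply: has_cderiv_FTC2 => //.
- exact: lt_le_trans b'1.
- move=> x; rewrite mulf_eq0 negb_or => /andP[_]; exact: supp_inE.
- move=> x; rewrite mulf_eq0 negb_or => /andP[_ fx].
  by have [_ +] := phiU; apply; exact: fsupp_in.
Qed.

End local_density.

(** * Consequences of (P2) *)

Section finite_order.
Context {R : realType}.
Implicit Types (phi psi : schwartz R) (u v g : schwartz R -> R[i]^o).

Lemma half_notin_int (k : nat) : (k%:R + 2^-1 : R) \isn't a Num.int.
Proof.
apply/negP => kint.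
have /intrP[z zE] : (2^-1 : R) \is a Num.int.
  by rewrite -(rpredDl _ (_ : k%:R \is a Num.int))// rpred_nat.
have z0 : (0 < z)%R by rewrite -(ltr0z R) -zE invr_gt0.
have z1 : (z < 1)%R by rewrite -(ltrz1 R) -zE invf_lt1// ltr1n.
by move: z0 z1; case: z {zE} => [[|n]|n].
Qed.

Lemma condP2_finite_order (f : nat -> schwartz R -> R[i]^o) :
  (forall j, tempered_pos (f j)) -> condP2 f ->
  forall n, exists nu : nat, forall N (b : nat -> R[i]) C, (nu <= N)%N -> 0
    <= C ->
   (forall phi, fsupp (phi : R -> R[i]^o) `<=` `[0, +oo[%classic ->
    normc ((\sum_(k < N.+1) b k *: f k) phi) <= C * schwartz_norm n phi) ->
   forall k, (nu <= k <= N)%N -> b k = 0.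
Proof.
move=> fp [ms [ms_mono msP]] n.
have ms_ge j : (j <= ms j)%N.
  by elim: j => [//|j IHj]; exact: leq_ltn_trans IHj (ms_mono j).
(* A strictly increasing sequence of integers satisfies m_j >= j, so the index n + 1 yields m >
   n. *)
pose m := ms n.+1; have nm : (n < m)%N by exact: ms_ge.
(* [A] is the growth degree of the density, and alpha + m >= A settles the condition at infinity.
   Near 0 the exponent -alpha + m is negative, so the comparison power is at least 1 and a bounded
   density suffices. The half keeps [alpha] off the integers. *)
pose A := (m + n)%N; pose alpha : R := (A + m)%:R + 2^-1.
have alpha0 : 0 < alpha by rewrite ltr_wpDl// invr_gt0.
have [nu nuP] := msP n.+1 alpha alpha0 (half_notin_int _).
exists nu => N b C nuN C0 fb; apply: (nuP N b nuN); rewrite -/m.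
- set g := \sum_(k < N.+1) _ in fb *.
  have gp : tempered_pos g by exact: tempered_pos_sum.
  have [[tv _] vg] := dprimitiveP m gp.
  have [h [C' [C'0 ch hb rep]]] := local_density tv vg C0 nm fb.
  exists 0, h, 0; split.
  + apply: regular_on_density rep => //.
    * by exists 1; rewrite /= in_itv/= andbT.
    * by move=> x; rewrite /= in_itv/= andbT.
  + by rewrite size_poly0.
  + exists (C' * 2 ^+ A); near=> x.
    have x1 : 1 <= x by near: x; apply: nbhs_pinfty_ge; exact: num_real.
    have x0 : 0 <= x by exact: le_trans x1.
    rewrite horner0 subr0; apply: le_trans (hb x) _; rewrite -mulrA ler_wpM2l//.
    apply: le_trans (_ : (2 * x) ^+ A <= _).
      by rewrite lerXn2r ?nnegrE ?mulr_ge0 ?addr_ge0// ger0_norm//; lra.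
    rewrite exprMn ler_wpM2l ?exprn_ge0// -powR_mulrn// ler_powR//.
    rewrite /alpha natrD; have := ler0n R m;
      have : 0 <= 2^-1 :> R by rewrite invr_ge0.
    by lra.
(* Here the primitive is the combination of the primitives of the [f k], not the chosen primitive of
   their combination. *)
- set g := \sum_(k < N.+1) b k *: f k in fb.
  pose v := \sum_(k < N.+1) b k *: dprimitive m (f k).
  have dP j := dprimitiveP m (fp j).
  have [tv _] : tempered_pos v by apply: (@tempered_pos_sum R N.+1 b (fun j =>
    dprimitive m (f j))) => j; have [] := dP j.
  have vg : iter m dderive v = g by apply: (@iter_dderive_sum R m N.+1 b f (fun
    j => dprimitive m (f j))) => j; have [] := dP j.
  have [h [C' [C'0 ch hb rep]]] := local_density tv vg C0 nm fb.
  exists h; first by move=> x _; exact: ch.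
  apply: regular_on_density rep => //.
  + by exists 1; rewrite /= in_itv/= andbT.
  + by move=> x; rewrite /= in_itv/= andbT.
- set g := \sum_(k < N.+1) _ in fb *.
  have gp : tempered_pos g by exact: tempered_pos_sum.
  have [[tv _] vg] := dprimitiveP m gp.
  have [h [C' [C'0 ch hb rep]]] := local_density tv vg C0 nm fb.
  exists 1, h, 0; split => //.
  + apply: regular_on_density rep => //.
    * by exists 2^-1; rewrite /= in_itv/= invr_gt0 invf_lt1 ?ltr1n ?ltr0n.
    * by move=> x; rewrite /= in_itv/= => /andP[].
  + by rewrite size_poly0.
  + exists (C' * 2 ^+ A); near=> x.
    have x0 : 0 < x by near: x; exact: nbhs_right_gt.
    have x1 : x <= 1 by near: x; exact: nbhs_right_le.
    rewrite horner0 subr0; apply: le_trans (hb x) _; rewrite -mulrA ler_wpM2l//.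
    rewrite -[leLHS]mulr1; apply: ler_pM; rewrite ?exprn_ge0 ?addr_ge0//.
      by rewrite lerXn2r ?nnegrE ?addr_ge0// (ger0_norm (ltW x0)); lra.
    rewrite -[leLHS](powRr0 x); apply: ger_powR; first by rewrite x0 x1.
    rewrite /alpha natrD; have := ler0n R A;
      have : 0 <= 2^-1 :> R by rewrite invr_ge0.
    lra.
Unshelve. all: by end_near. Qed.

End finite_order.

(** * Series in a Frechet space *)

Section tvs_series.
Context {R : realType} (X : tvsType R[i]).
Context (hX : hausdorff_space X).
Context (complX : forall F : set_system X, ProperFilter F -> tvs_cauchy F ->
   exists l : X, F --> l).

Lemma nbhs0_halve (U : set X) : nbhs (0 : X) U -> exists2 V : set X,
  nbhs (0 : X) V & forall x y, V x -> V y -> U (x + y).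
Proof.
move=> U0.
have : nbhs ((0 : X), (0 : X)) [set p | U (p.1 + p.2)].
  by apply: (@add_continuous X (0, 0)); rewrite /= addr0.
case=> -[V V'] /= [V0 V'0] VU; exists (V `&` V'); first exact: filterI.
by move=> x y [Vx _] [_ V'y]; exact: (VU (x, y)).
Qed.

Lemma nbhs0_opp (U : set X) : nbhs (0 : X) U -> nbhs (0 : X) [set x | U (- x)].
Proof. by move=> U0; apply: (@opp_continuous X 0); rewrite oppr0. Qed.

Lemma nbhs_translate (U : set X) (l : X) :
  nbhs (0 : X) U -> nbhs l [set x | U (x - l)].
Proof.
move=> U0; have : (fun x => x - l) @ l --> l - l.
  apply: (@cvg_comp _ _ _ (fun x : X => (x, - l)) (fun z : X * X => z.1 + z.2)
    (nbhs l) (nbhs (l, - l))); last exact: (@add_continuous X (l, - l)).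
  by apply: cvg_pair; [exact: cvg_id|exact: cvg_cst].
by apply; rewrite subrr.
Qed.

Lemma nbhs_translateP (U : set X) (l : X) :
  nbhs l U -> nbhs (0 : X) [set x | U (x + l)].
Proof.
move=> Ul; have : (fun x => x + l) @ (0 : X) --> 0 + l.
  apply: (@cvg_comp _ _ _ (fun x : X => (x, l)) (fun z : X * X => z.1 + z.2)
    (nbhs (0 : X)) (nbhs (0 : X, l))); last exact: (@add_continuous X (0, l)).
  by apply: cvg_pair; [exact: cvg_id|exact: cvg_cst].
by apply; rewrite add0r.
Qed.

Lemma scale_small (c : X) (U : set X) : nbhs (0 : X) U ->
  exists2 e : R, 0 < e & forall z : R[i], normc z < e -> U (z *: c).
Proof.
move=> U0; have : (fun z : R[i]^o => z *: c) @ (0 : R[i]^o) --> (0 : R[i]) *: c.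
  apply: (@cvg_comp _ _ _ (fun z : R[i]^o => (z, c)) (fun z :
    R[i]^o * X => z.1 *: z.2)
    (nbhs (0 : R[i]^o)) (nbhs (0 : R[i]^o, c))).
    by apply: (@cvg_pair _ _ _ _ (nbhs (0 : R[i]^o)));
      [exact: cvg_id|exact: cvg_cst].
  exact: (@scale_continuous _ X (0, c)).
rewrite scale0r => /(_ U U0)/nbhs_normcP[e e0 eU].
by exists e => // z ze; apply: eU; rewrite subr0.
Qed.

Lemma scaler_cont (z : R[i]) : continuous ( *:%R z : X -> X).
Proof.
move=> x; apply: (@cvg_comp _ _ _ (fun y : X => (z : R[i]^o, y))
  (fun z : R[i]^o * X => z.1 *: z.2) _ (nbhs ((z : R[i]^o), x))).
  by apply: (@cvg_pair _ _ _ _ (nbhs (z : R[i]^o)));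
    [exact: cvg_cst|exact: cvg_id].
exact: (@scale_continuous _ X (z, x)).
Qed.

(** The sets [W n] act as balls of radius 2^-n: terms taken from [W k.+1] add up like a geometric
    series. *)
Lemma halving_base : (exists B : nat -> set X,
    (forall n, nbhs (0 : X) (B n)) /\
    (forall U, nbhs (0 : X) U -> exists n, B n `<=` U)) ->
  exists W : nat -> set X, [/\ forall n, nbhs (0 : X) (W n),
    forall n x y, W n.+1 x -> W n.+1 y -> W n (x + y) &
    forall U, nbhs (0 : X) U -> exists n, W n `<=` U].
Proof.
move=> [B [B0 BU]].
have H (U : set X) : exists V : set X, nbhs (0 : X) U ->
    nbhs (0 : X) V /\ forall x y, V x -> V y -> U (x + y).
  have [/nbhs0_halve[V V0 VU]|nU] := pselect (nbhs (0 : X) U);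
    first by exists V.
  by exists U.
have [half halfP] := choice H.
pose W := fix W n := if n is n'.+1 then half (W n') `&` B n else B 0%N.
have W0 n : nbhs (0 : X) (W n).
  elim: n => [|n IHn] /=; first exact: B0.
  by apply: filterI; [have [] := halfP _ IHn|exact: B0].
exists W; split => //.
  move=> n x y [hx _] [hy _]; have [_] := halfP _ (W0 n); exact.
move=> U /BU[n BnU]; exists n; apply: subset_trans BnU.
by case: n => [//|n] x [].
Qed.

Context (W : nat -> set X) (W0 : forall n, nbhs (0 : X) (W n))
  (WD : forall n x y, W n.+1 x -> W n.+1 y -> W n (x + y))
  (WU : forall U, nbhs (0 : X) U -> exists n, W n `<=` U).

Lemma W_0 n : W n 0. Proof. exact: nbhs_singleton. Qed.

Lemma W_anti m n : (m <= n)%N -> W n `<=` W m.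
Proof.
move=> mn; rewrite -(subnKC mn); elim: (n - m)%N => [|k IHk];
  first by rewrite addn0.
rewrite addnS => x Wx; apply: IHk; rewrite -[x]addr0; apply: WD => //;
  exact: W_0.
Qed.

Definition psum (w : nat -> X) n := \sum_(k < n) w k.

Definition sumX (w : nat -> X) : X := xget 0 [set l | psum w @ \oo --> l].

Lemma psum_tail (w : nat -> X) m l : (forall k, (m <= k)%N -> W k.+1 (w k)) ->
  W m (psum w (m + l) - psum w m).
Proof.
elim: l m => [|l IHl] m wW; first by rewrite addn0 subrr; exact: W_0.
have := IHl m.+1 (fun k mk => wW k (ltnW mk)).
rewrite addSnnS => H.
have -> : psum w (m + l.+1) - psum w m = w m + (psum w (m + l.+1) - psum w
  m.+1).
  have -> : psum w m.+1 = psum w m + w m by rewrite /psum big_ord_recr.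
  by apply/esym; rewrite opprD addrC -!addrA addNr addr0.
by apply: WD => //; exact: wW.
Qed.

Lemma sumX_cvg (w : nat -> X) K : (forall k, (K <= k)%N -> W k.+1 (w k)) ->
  psum w @ \oo --> sumX w.
Proof.
move=> wW; have : tvs_cauchy (psum w @ \oo); last first.
  by move=> /complX[l wl]; rewrite /sumX; case: xgetP => [y -> //|/(_ l)].
move=> U U0 /=.
have [V V0 VU] := nbhs0_halve U0.
have [k kVV] := WU (filterI V0 (nbhs0_opp V0)).
pose M := maxn K k.
have MV n : (M <= n)%N -> V (psum w n - psum w M)
  /\ V (- (psum w n - psum w M)).
  move=> Mn; have := @psum_tail w M (n - M); rewrite subnKC// => H.
  apply: kVV; apply: (W_anti (leq_maxr K k)); apply: H => j Mj.
  by apply: wW; apply: leq_trans Mj; exact: leq_maxl.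
exists ([set x | V (x - psum w M)], [set x | V (- (x - psum w M))]).
  by split; exists M => // n /= /MV[].
move=> [x y] [/= H1 H2].
by have := VU _ _ H1 H2; rewrite opprB addrA subrK; exact.
Qed.

(** The sets [W n] may fail to be closed, so passing to the limit costs one index: a finite tail and
    the distance to the limit both lie in [W m.+1], and their sum in [W m]. *)
Lemma sumX_tail (w : nat -> X) K : (forall k, (K <= k)%N -> W k.+1 (w k)) ->
  forall m, (K <= m)%N -> W m (sumX w - psum w m.+1).
Proof.
move=> wW m Km.
have wl := sumX_cvg wW.
have /wl : nbhs (sumX w) [set x | W m.+1 (- (x - sumX w))].
  exact: (nbhs_translate (U := [set x | W m.+1 (- x)]) _ (nbhs0_opp (W0 _))).
move=> [n0 _ n0P].
pose n := maxn n0 m.+1.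
have := n0P n (leq_maxl _ _); rewrite /= opprB => H1.
have H2 := @psum_tail w m.+1 (n - m.+1) (fun k mk => wW k (leq_trans Km (ltnW
  mk))).
rewrite subnKC ?leq_maxr// in H2.
by have := WD H1 H2; rewrite addrA subrK.
Qed.

Lemma sumX_eq (w : nat -> X) l : psum w @ \oo --> l -> sumX w = l.
Proof.
move=> wl; rewrite /sumX; case: xgetP => [y -> yl|/(_ l)//].
exact: (@cvg_unique X hX (psum w @ \oo)).
Qed.

Lemma sumXZ (w : nat -> X) (z : R[i]) : psum w @ \oo --> sumX w ->
  psum (fun k => z *: w k) @ \oo --> z *: sumX w.
Proof.
move=> wl; have -> : psum (fun k => z *: w k) = *:%R z \o psum w.
  by apply/funext => n; rewrite /psum /= scaler_sumr.
exact: (cvg_comp _ _ wl (scaler_cont (z := z) (x := sumX w))).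
Qed.

Lemma sumXB (w w' : nat -> X) : psum w @ \oo --> sumX w -> psum w' @ \oo -->
  sumX w' ->
  psum (fun k => w k - w' k) @ \oo --> sumX w - sumX w'.
Proof.
move=> wl w'l; have -> : psum (fun k => w k - w' k) =
  (fun n => psum w n - psum w' n).
  by apply/funext => n; rewrite /psum sumrB.
apply: (@cvg_comp _ _ _ (fun n => (psum w n, psum w' n))
  (fun z : X * X => z.1 - z.2) _ (nbhs (sumX w, sumX w')));
    first exact: cvg_pair.
apply: (@cvg_comp _ _ _ (fun z : X * X => (z.1, - z.2)) (fun z :
  X * X => z.1 + z.2)
  _ (nbhs (sumX w, - sumX w'))); last exact: (@add_continuous X (sumX w, - sumX
    w')).
apply: cvg_pair; first exact: cvg_fst.
apply: (@cvg_comp _ _ _ snd (fun x => - x) _ (nbhs (sumX w')));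
  first exact: cvg_snd.
exact: opp_continuous.
Qed.

Context (c : nat -> X) (eps : nat -> R).
Context (epsP : forall k z, normc z < eps k -> W k.+1 (z *: c k)).

Lemma psum_small (I J : Type) (F : set_system I) (FF : Filter F)
    (s : nat -> I -> J -> R[i]) :
  (forall k d, 0 < d -> \forall i \near F, forall j, normc (s k i j) < d) ->
  forall n U, nbhs (0 : X) U ->
    \forall i \near F, forall j, U (psum (fun k => s k i j *: c k) n).
Proof.
move=> s0; elim=> [|n IHn] U U0.
  by apply: nearW => i j; rewrite /psum big_ord0; exact: nbhs_singleton.
have [V V0 VU] := nbhs0_halve U0.
have [d d0 dV] := scale_small (c n) V0.
apply: filterS2 (IHn V V0) (s0 n d d0) => i H1 H2 j.
rewrite /psum big_ord_recr/=; apply: VU; first exact: H1.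
by apply: dV; exact: H2.
Qed.

(** Dominated convergence for series: [eps] dominates the tail uniformly along [F], and finitely
    many terms tend to 0. The convergence is uniform in [J], which is trivial for differentiability
    and is the real line for boundedness. *)
Lemma sumX_small (I J : Type) (F : set_system I) (FF : Filter F)
    (s : nat -> I -> J -> R[i]) :
  (exists K, \forall i \near F, forall k j, (K <= k)%N ->
    normc (s k i j) < eps k) ->
  (forall k d, 0 < d -> \forall i \near F, forall j, normc (s k i j) < d) ->
  forall U, nbhs (0 : X) U ->
    \forall i \near F, forall j, U (sumX (fun k => s k i j *: c k)).
Proof.
move=> [K sK] s0 U U0; have [V V0 VU] := nbhs0_halve U0.
have [m mV] := WU V0; pose M := maxn K m.
apply: filterS2 sK (psum_small FF s0 M.+1 V0) => i H1 H2 j.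
rewrite -[sumX _](subrK (psum (fun k => s k i j *: c k) M.+1)).
apply: VU; last exact: H2.
apply: mV; apply: (W_anti (leq_maxr K m)).
apply: (@sumX_tail _ K); last exact: leq_maxl.
by move=> k Kk; apply: epsP; exact: H1.
Qed.

End tvs_series.

(** * Vector-valued series of Schwartz functions *)

Section schwartz_series.
Context {R : realType} (X : tvsType R[i]).
Context (hX : hausdorff_space X).
Context (complX : forall F : set_system X, ProperFilter F -> tvs_cauchy F ->
   exists l : X, F --> l).
Context (W : nat -> set X) (W0 : forall n, nbhs (0 : X) (W n))
  (WD : forall n x y, W n.+1 x -> W n.+1 y -> W n (x + y))
  (WU : forall U, nbhs (0 : X) U -> exists n, W n `<=` U).
Context (c : nat -> X) (eps : nat -> R).
Context (epsP : forall k z, normc z < eps k -> W k.+1 (z *: c k)).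
Context (phi : nat -> schwartz R) (nn : nat -> nat).
Context (nnP : forall n, exists K, forall k, (K <= k)%N -> (n <= nn k)%N).
Context (phi_eps : forall k, schwartz_norm (nn k) (phi k) < eps k).

Let term m x k : X := vderiven m (phi k) x *: c k.
Let S m (x : R) : X := sumX (term m x).

Lemma series_weight l m : exists K, forall k, (K <= k)%N -> forall x : R,
  `|x| ^+ l * normc (vderiven m (phi k) x) < eps k.
Proof.
have [K KP] := nnP (maxn l m).+1; exists K => k Kk x.
apply: le_lt_trans (phi_eps k); apply: schwartz_norm_ge_at.
  by apply: leq_trans (KP k Kk); rewrite ltnS leq_maxl.
by apply: leq_trans (KP k Kk); rewrite ltnS leq_maxr.
Qed.

Lemma series_in_W l m : exists K, forall k, (K <= k)%N -> forall x : R,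
  W k.+1 ((x ^+ l)%:C *: term m x k).
Proof.
have [K KP] := series_weight l m; exists K => k Kk x.
by rewrite /term scalerA; apply: epsP; rewrite normcM normc_real normrX;
  exact: KP.
Qed.

Lemma series_cvg m x : psum (term m x) @ \oo --> S m x.
Proof.
have [K KP] := series_in_W 0 m; apply: (sumX_cvg complX W0 WD WU (K := K)) => k
  Kk.
by have := KP k Kk x; rewrite expr0 scale1r.
Qed.

Lemma series_quot m x h : psum (fun k =>
    (vquot (vderiven m (phi k)) x h - vderiven m.+1 (phi k) x) *: c k) @ \oo -->
  vquot (S m) x h - S m.+1 x.
Proof.
have H1 := sumXB (@series_cvg m (x + h)) (@series_cvg m x).
have E1 := sumX_eq hX H1; rewrite -E1 in H1.
have H2 := sumXZ (z := (h^-1)%:C) H1.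
have E2 := sumX_eq hX H2; rewrite -E2 in H2.
have E3 : (fun k => (vquot (vderiven m (phi k)) x h - vderiven m.+1 (phi k) x)
  *: c k) =
    (fun k => (h^-1)%:C *: (term m (x + h) k - term m x k) - term m.+1 x k).
  by apply/funext => k; rewrite /term -scalerBl scalerA -scalerBl.
rewrite E3; have := sumXB H2 (@series_cvg m.+1 x).
by rewrite E2 E1.
Qed.

Lemma series_vderiv m x : vquot (S m) x @ 0^' --> S m.+1 x.
Proof.
move=> U /nbhs_translateP U0.
pose s k h (_ : unit) := vquot (vderiven m (phi k)) x h - vderiven m.+1 (phi k)
  x.
have : \forall h \near (0 : R)^', forall j : unit,
    U (sumX (fun k => s k h j *: c k) + S m.+1 x).
  apply: (sumX_small complX W0 WD WU epsP (s := s) _ _ _ U0).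
    (* The remainder of the difference quotient involves the derivative of order m + 2, which the
       norm of index [nn k] controls once nn k >= m + 3. For |h| < 1/4 the constant 4 of
       [vquot_dist_le] is absorbed. *)
    have [K KP] := nnP m.+3; exists K.
    near=> h => k j Kk; rewrite {j}/s.
    have h0 : h != 0 by near: h; exact: nbhs_dnbhs_neq.
    have h1 : `|h| < 4^-1 by near: h; apply: dnbhs0_lt; rewrite invr_gt0.
    have phi2 y : normc (vderiven m.+2 (phi k) y)
      <= schwartz_norm (nn k) (phi k).
      have := @schwartz_norm_ge_at R (nn k) (phi k) 0%N m.+2 y.
      rewrite mul1r; apply; last exact: KP.
      by apply: leq_trans (KP k Kk).
    apply: le_lt_trans (phi_eps k).
    have := vquot_dist_le x h0 (@schwartz_has_cderiv R (phi k) m)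
      (@schwartz_has_cderiv R (phi k) m.+1) phi2.
    move/le_trans; apply; rewrite mulrAC ler_piMl ?schwartz_norm_ge0//.
    by rewrite mulrC -ler_pdivlMr// mul1r ltW.
  move=> k d d0; have /has_cderivE/cvg_normcP/(_ d d0) := @schwartz_has_cderiv R
    (phi k) m x.
  by apply: filterS => h + j.
apply: filterS => h /(_ tt); rewrite (sumX_eq hX (@series_quot m x h)).
by rewrite subrK.
Unshelve. all: by end_near. Qed.

Lemma series_vderiven m : vderiven m (S 0%N) = S m.
Proof.
elim: m => [//|m IHm]; apply/funext => x.
rewrite /vderiven iterS -/(vderiven m _) IHm; apply: vderive_eq => //.
exact: series_vderiv.
Qed.

Lemma series_schwartz : schwartz_fun (S 0%N).
Proof.
split=> [m x|l m]; rewrite series_vderiven; first by exists (S m.+1 x);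
  exact: series_vderiv.
move=> U U0.
(* Boundedness means that division by a large [t] brings all values into [U]: this is [sumX_small]
   along +oo with [x] as the parameter. *)
pose s k t x : R[i] := (t^-1)%:C * ((x ^+ l)%:C * vderiven m (phi k) x).
have : \forall t \near (+oo : set_system R), forall x :
  R, U (sumX (fun k => s k t x *: c k)).
  apply: (sumX_small complX W0 WD WU epsP (s := s) _ _ _ U0).
    have [K KP] := series_weight l m; exists K.
    near=> t => k x Kk; apply: le_lt_trans (KP k Kk x).
    have t1 : 1 <= t by near: t; apply: nbhs_pinfty_ge; exact: num_real.
    rewrite /s !normcM !normc_real normrX ler_piMl//.
      by rewrite mulr_ge0 ?exprn_ge0 ?normc_ge0.
    by rewrite ger0_norm ?invr_ge0 ?(le_trans ler01)// invf_le1// (lt_le_trans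
      ltr01).
  move=> k d d0; have [M MP] := schwartz_bounded (phi k) l m.
  near=> t => x.
  have t0 : 0 < t by near: t; apply: nbhs_pinfty_gt; exact: num_real.
  rewrite /s !normcM !normc_real normrX [`|t^-1|]gtr0_norm ?invr_gt0//
    ltr_pdivrMl//.
  apply: le_lt_trans (MP x) _; rewrite -ltr_pdivrMr//.
  by near: t; apply: nbhs_pinfty_gt; exact: num_real.
move=> H; near=> t => _ [x _ <-].
have Ht : forall x : R, U (sumX (fun k => s k t x *: c k)) by near: t; exact: H.
have t0 : 0 < t by near: t; apply: nbhs_pinfty_gt; exact: num_real.
have E : sumX (fun k => s k t x *: c k) = (t^-1)%:C *: ((x ^+ l)%:C *: S m x).
  rewrite scalerA -(sumX_eq hX (sumXZ (z := (t^-1)%:C * (x ^+ l)%:C)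
    (@series_cvg m x))).
  by congr sumX; apply/funext => k; rewrite /s /term scalerA mulrA.
exists ((t^-1)%:C *: ((x ^+ l)%:C *: S m x)).
  by rewrite -E; exact: Ht.
by rewrite scalerA -rmorphM mulfV ?gt_eqF// scale1r.
Unshelve. all: by end_near. Qed.

Lemma series_supp : (forall k, fsupp (phi k : R ->
  R[i]^o) `<=` `[0, +oo[%classic) ->
  fsupp (S 0%N) `<=` `[0, +oo[%classic.
Proof.
move=> phi0; rewrite /fsupp [X in _ `<=` X](closure_id _).1;
  last exact: interval_closed.
apply: closureS => x /= Sx; rewrite in_itv/= andbT leNgt; apply/negP => x0.
move/negP: Sx; apply; apply/eqP; apply: (sumX_eq hX).
rewrite (_ : psum _ = cst 0); first exact: cvg_cst.
apply/funext => n; rewrite /psum big1// => k _.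
by rewrite /term /vderiven /= (fsupp_pos_supp (phi0 k)) ?scale0r.
Qed.

(** Continuity of [T] makes it small on some [W M], which contains the weighted tails uniformly in
    x. Convergence thus holds in every Schwartz norm, and tempered distributions pass through the
    sum. *)
Lemma series_norm_approx (T : {linear X -> R[i]^o}) (cT : continuous T) (g :
  schwartz R) :
  (forall x, g x = T (S 0%N x)) ->
  forall q (e : R), 0 < e -> exists n0, forall n, (n0 <= n)%N ->
    schwartz_norm q (g - \sum_(k < n) T (c k) *: phi k) <= (q * q)%:R * e.
Proof.
move=> gE q e e0.
have gm m x : vderiven m g x = T (S m x).
  have -> : (g : R -> R[i]^o) = T \o S 0%N by apply/funext => y; exact: gE.
  by rewrite (vderiven_linear m hausC cT series_schwartz.1)/= series_vderiven.
have sm m x n : vderiven m (\sum_(k < n) T (c k) *: phi k : schwartz R) x =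
    T (psum (term m x) n).
  elim: n => [|n IHn].
    rewrite /psum !big_ord0 linear0 -(scale0r (0 :
      schwartz R)) vderiven_schwartzZ.
    by rewrite mul0r.
  rewrite /psum !big_ord_recr/= [RHS]linearD /term linearZ/= -IHn addrC
    [RHS]addrC.
  by rewrite -[X in _ = X + _]/(vderiven m (phi n) x * T (c n)) mulrC
    -vderiven_schwartzZD.
have U0 : nbhs (0 : X) [set y | normc (T y) < e].
  have : nbhs (T 0) [set z : R[i]^o | normc z < e].
    by rewrite linear0; apply/nbhs_normcP; exists e => // w; rewrite subr0.
  exact: cT.
have [M MU] := WU U0.
have [K KP] : exists K, forall l m, (l < q)%N -> (m < q)%N ->
    forall k, (K <= k)%N -> forall x : R, W k.+1 ((x ^+ l)%:C *: term m x k).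
  have [K KP] := nnP q; exists K => l m lq mq k Kk x.
  rewrite /term scalerA; apply: epsP; rewrite normcM normc_real normrX.
  apply: le_lt_trans (phi_eps k); apply: schwartz_norm_ge_at.
    by apply: leq_trans (KP k Kk).
  by apply: leq_trans (KP k Kk).
(* The shift by one matches [sumX_tail], which pairs [W n] with the sum of n + 1 terms. *)
exists (maxn K M).+1 => [[//|n]] n0.
apply: schwartz_norm_le => l m x lq mq.
have -> : vderiven m (g - \sum_(k < n.+1) T (c k) *: phi k) x =
    T (S m x - psum (term m x) n.+1).
  by rewrite linearB -gm -sm -scaleN1r addrC vderiven_schwartzZD mulN1r addrC.
rewrite -normrX -normc_real -normcM.
rewrite -[_ * _]/((x ^+ l)%:C *: T _) -linearZ/= ltW//.
apply: MU; rewrite ltnS geq_max in n0; have /andP[Kn Mn] := n0.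
apply: (W_anti W0 WD Mn).
have := sumX_tail complX W0 WD WU (fun k Kk => KP l m lq mq k Kk x) Kn.
rewrite (sumX_eq hX (sumXZ (z := (x ^+ l)%:C) (@series_cvg m x))).
by rewrite scalerBr /psum scaler_sumr.
Qed.

End schwartz_series.

Section assembly.
Context {R : realType}.

(** At stage k a small dual function must be available for the norm of index [nn k], while these
    norms must eventually pass any given one. [nu 0 = 0] makes the index 0 always admissible, and
    the cap n <= k gives a maximum even when [nu] is bounded. *)
Lemma slow_index (nu : nat -> nat) : nu 0%N = 0%N -> exists nn : nat -> nat,
  (forall k, (nu (nn k) <= k)%N) /\
  forall n, exists K, forall k, (K <= k)%N -> (n <= nn k)%N.
Proof.
move=> nu0.
(* [nn k] is the largest [n <= k] with [nu n <= k] *)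
have H k : exists n, (nu n <= k)%N /\ forall n', (n' <= k)%N -> (nu n'
  <= k)%N -> (n' <= n)%N.
  have ex0 : exists n, (nu n <= k)%N && (n <= k)%N by exists 0%N; rewrite nu0.
  have ub n : (nu n <= k)%N && (n <= k)%N -> (n <= k)%N by case/andP.
  have [n /andP[nk _] nmax] := ex_maxnP ex0 ub.
  by exists n; split=> // n' n'k nun'; apply: nmax; rewrite nun' n'k.
have [nn nnP] := choice H; exists nn; split=> [k|n]; first by have [] := nnP k.
exists (maxn n (nu n)) => k; rewrite geq_max => /andP[nk nunk].
by have [_] := nnP k; apply.
Qed.

(** Each vector depends on all earlier choices and each choice on the current vector, so the
    recursion carries the list of the previous pairs. *)
Lemma moment_recursion (X : lmodType R[i]) (E : Type) (a : nat -> X)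
    (f : nat -> E -> R[i]) (good : nat -> X -> E -> Prop) :
  (forall k x, exists y, good k x y) ->
  exists (c : nat -> X) (phi : nat -> E), forall k, good k (c k) (phi k) /\
    c k = a k - \sum_(j < k) f k (phi j) *: c j.
Proof.
move=> ex.
have [sel selP] := choice (fun kx : nat * X => ex kx.1 kx.2).
pose next (l : seq (E * X)) k :=
  let c := a k - \sum_(p <- l) f k p.1 *: p.2 in (sel (k, c), c).
pose build := fix build n := if n is n'.+1 then rcons (build n') (next (build
  n') n') else [::].
pose pc k := next (build k) k.
have bE n : build n = [seq pc k | k <- iota 0 n].
  elim: n => [//|n IHn]; rewrite -addn1 iotaD map_cat cats1 addn1 -IHn //.
exists (fun k => (pc k).2), (fun k => (pc k).1) => k; split;
  first exact: (selP (k, _)).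
have E0 : iota 0 k = index_iota 0 k by rewrite /index_iota subn0.
by rewrite [LHS]/= bE big_map E0 big_mkord.
Qed.

End assembly.

(** * The moment problem *)

Section moment_problem.
Context {R : realType}.
Implicit Types (phi psi : schwartz R) (f : nat -> schwartz R -> R[i]^o).

Definition schwartz_half_line phi : Prop :=
  fsupp (phi : R -> R[i]^o) `<=` `[0, +oo[%classic.

Lemma schwartz_half_line_lin_closed : lin_closed schwartz_half_line.
Proof.
have closed0 : closed (`[0, +oo[%classic : set R) by exact: interval_closed.
split=> [|k phi psi phi0 psi0]; apply: fsupp_sub => // x;
  rewrite /= in_itv/= andbT.
  by rewrite eqxx.
rewrite leNgt; apply: contra => x0.
rewrite -[X in X == 0]/(k * phi x + psi x) (fsupp_pos_supp phi0 x0).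
by rewrite (fsupp_pos_supp psi0 x0) mulr0 addr0.
Qed.

Lemma sum_functionalE f (b : nat -> R[i]) N phi :
  (\sum_(k < N) b k *: f k) phi = \sum_(k < N) b k * f k phi.
Proof. by rewrite fct_sumE. Qed.

Lemma finite_order_exponents f : (forall j, tempered_pos (f j)) -> condP1 f ->
  condP2 f -> exists nu : nat -> nat, nu 0%N = 0%N /\
  forall n N (b : nat -> R[i]) C, (nu n <= N)%N -> 0 <= C ->
   (forall phi, schwartz_half_line phi ->
      normc (\sum_(k < N.+1) b k * f k phi) <= C * schwartz_norm n phi) ->
   forall k, (nu n <= k <= N)%N -> b k = 0.
Proof.
move=> fp P1 P2; have [nu nuP] := choice (condP2_finite_order fp P2).
exists (fun n => if n is 0%N then 0%N else nu n);
  split=> // -[|n] N b C nuN C0 fb k.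
  move=> /andP[_ kN]; apply: (P1 N b) => //; split;
    first exact: tempered_pos_sum.
  move=> phi phi0; apply/eqP; rewrite -normc_eq0 eq_le normc_ge0 andbT.
  apply: le_trans (_ : C * schwartz_norm 0 phi <= _).
    by rewrite sum_functionalE; exact: fb.
  by rewrite /schwartz_norm big_ord0 mulr0.
apply: (nuP n.+1 N b C nuN C0) => phi phi0.
by rewrite sum_functionalE; exact: fb.
Qed.

Lemma dual_sequence_exists f (nu : nat -> nat) n k e :
  (forall j, tempered_pos (f j)) ->
  (forall N (b : nat -> R[i]) C, (nu n <= N)%N -> 0 <= C ->
   (forall phi, schwartz_half_line phi ->
      normc (\sum_(k < N.+1) b k * f k phi) <= C * schwartz_norm n phi) ->
   forall k, (nu n <= k <= N)%N -> b k = 0) ->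
  (nu n <= k)%N -> 0 < e ->
  exists phi, [/\ schwartz_half_line phi, forall i, (i < k)%N -> f i phi = 0,
    f k phi = 1 & schwartz_norm n phi < e].
Proof.
move=> fp nuP nk e0.
apply: (small_dual (@schwartz_normD R n) (@schwartz_normZ R n)
  (@schwartz_norm_ge0 R n)
  schwartz_half_line_lin_closed _ _ e0).
  by move=> i c phi psi; have [[fL _] _] := fp i; exact: fL.
by move=> b C C0 fb; apply: (nuP k b C nk C0 fb); rewrite nk leqnn.
Qed.

End moment_problem.

Theorem theorem7p1 (R : realType) (X : tvsType R[i]) (hX : frechet_space X)
    (a : nat -> X) (f : nat -> schwartz R -> R[i]^o)
    (hf : forall j, tempered_pos (f j)) (hP1 : condP1 f) (hP2 : condP2 f) :
  exists phi : schwartz_pos X, forall j : nat, is_eval (f j) phi (a j).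
Proof.
have [hausX baseX complX] := hX.
have [W [W0 WD WU]] := halving_base baseX.
have [nu [nu0 nuP]] := finite_order_exponents hf hP1 hP2.
have [nn [nn1 nn2]] := slow_index nu0.
(* The radius is stored beside the function: it is dictated by the vector and must be known before
   the function is chosen. *)
pose good k (x : X) (pe : schwartz R * R) :=
  [/\ schwartz_half_line pe.1, forall i, (i < k)%N -> f i pe.1 = 0, f k pe.1 =
    1,
      schwartz_norm (nn k) pe.1 < pe.2 &
      forall z, normc z < pe.2 -> W k.+1 (z *: x)].
have exgood k x : exists pe, good k x pe.
  have [e e0 eW] := scale_small x (W0 k.+1).
  have [phi [H1 H2 H3 H4]] := dual_sequence_exists hf (nuP (nn k)) (nn1 k) e0.
  by exists (phi, e).
have [c [pe peP]] := moment_recursion a (fun k pe => f k pe.1) exgood.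
pose phi k := (pe k).1; pose eps k := (pe k).2.
have epsP k z : normc z < eps k -> W k.+1 (z *: c k).
  by have [[_ _ _ _ H] _] := peP k; exact: H.
have phi_eps k : schwartz_norm (nn k) (phi k) < eps k by have [[]] := peP k.
have phi0 k : schwartz_half_line (phi k) by have [[]] := peP k.
have fS := series_schwartz hausX complX W0 WD WU epsP nn2 phi_eps.
have fs := series_supp hausX (c := c) phi0.
exists (SchwartzPos fS fs) => j T cT.
set g := schwartz_linear cT _.
(* Terms beyond [j] are annihilated by [f j], and the term [j] contributes [c j], which cancels the
   earlier ones and leaves [a j]. *)
have fj_sum n : (j < n)%N -> f j (\sum_(k < n) T (c k) *: phi k) = T (a j).
  have [tfj _] := hf j.
  move=> jn; rewrite tempered_lin_sum//.
  under eq_bigr do rewrite tempered_linZ//.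
  rewrite -(subnKC jn); elim: (n - j.+1)%N => [|r IHr].
    rewrite addn0 big_ord_recr/=; have [[_ _ -> _ _] ->] := peP j.
    rewrite mulr1 linearB linear_sum/=.
    rewrite [X in X + _](_ : _ = \sum_(k < j) T (f j (pe k).1 *: c k)).
      by rewrite addrC subrK.
    by apply: eq_bigr => k _; rewrite linearZ/= mulrC.
  rewrite addnS big_ord_recr/= IHr; have [[_ H _ _ _] _] := peP (j.+1 + r)%N.
  by rewrite H ?mulr0 ?addr0// addSn ltnS leq_addr.
have [tfj _] := hf j.
have [q [M [M0 fM]]] := tempered_bound tfj.
apply/esym/eqP; rewrite -subr_eq0; apply/eqP.
apply: (@normc_le_addeps R _ (M * (q * q)%:R)) => r.
have e0 : 0 < r.+1%:R^-1 :> R by rewrite invr_gt0.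
have [n0 nP] := series_norm_approx hausX complX W0 WD WU epsP nn2 phi_eps cT
  (g := g) (fun x => erefl) q e0.
have [H1 H2] : (n0 <= maxn n0 j.+1)%N /\ (j < maxn n0 j.+1)%N.
  by rewrite leq_maxl leq_maxr.
rewrite -(fj_sum _ H2) -tempered_linB//.
apply: le_trans (fM _) _; rewrite -mulrA ler_wpM2l//; exact: nP.
Qed.
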